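(* Let $C_{n,j}$ be the number of subtrees of size $j$ cut off during the random edge-cutting procedure started with a uniformly random Cayley-tree of size $n$, and let $\lambda_{n,j}=\frac{\sqrt{n}\,j^{j-1}}{j!\,e^{j}}$. Then as $n\to\infty$, for every fixed $s\ge1$, \[ \mathbb{E}\big(C_{n,j}^{\underline{s}}\big)=\lambda_{n,j}^s\,2^{s/2}\,\Gamma\big(\tfrac{s}{2}+1\big)(1+o(1))\quad\text{for } j=j(n)=o(n), \] and $\mathbb{E}(C_{n,j}^{\underline{s}})=O(\lambda_{n,j}^s)$ for $1\le j\le n-1$. Let $X$ be Rayleigh distributed with parameter $1$. Then, for $1\le j=j(n)\le n-1$: (i) if $\lambda_{n,j}\to\infty$, $C_{n,j}/\lambda_{n,j}$ converges in distribution, with convergence of all moments, to $X$; (ii) if $\lambda_{n,j}\to\rho\in[0,\infty)$, $C_{n,j}$ converges in distribution, with convergence of all moments, to $Y\sim\mathrm{MPo}(\rho X)$.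
   Context: A Cayley-tree of size $n$ is a rooted unordered tree on vertex set $\{1,\dots,n\}$; random means uniform among the $n^{n-1}$ such trees. Random edge-cutting procedure: given a tree, choose an edge uniformly at random among the edges of the current tree and remove it; this splits the tree into the part $T'$ containing the root and the part $T''$ (the cut-off subtree); discard $T''$ and continue with $T'$ until only the root remains. The Rayleigh distribution with parameter $1$ has density $xe^{-x^2/2}$, $x\ge0$. $x^{\underline{s}}=x(x-1)\cdots(x-s+1)$. For non-negative $X$ and $\rho\ge0$, $Y\sim\mathrm{MPo}(\rho X)$ means $\mathbb{P}\{Y=\ell\}=\frac{\rho^\ell}{\ell!}\mathbb{E}(X^\ell e^{-\rho X})$ (point mass at $0$ when $\rho=0$). ''Convergence of all moments'' refers to non-negative integer moments. *)

(* Defs.v *)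
From mathcomp Require Import all_boot.
From Stdlib Require Import Reals.
From Coquelicot Require Import Coquelicot.

Set Implicit Arguments.
Unset Strict Implicit.
Unset Printing Implicit Defensive.

(* Rooted labelled (Cayley) trees on the vertex set 'I_n = {0,...,n-1}       *)
(* (a relabelling of {1,...,n}), encoded by their parent function:           *)
(* p v = Some w  iff  w is the parent of v;  p v = None iff v is the root.   *)
(* The edges of the tree are the pairs {v, p v} for non-root v.             *)

Definition parent_fun (n : nat) := {ffun 'I_n -> option 'I_n}.

(* one step towards the root (None = "above the root") *)
Definition up_step (n : nat) (p : parent_fun n) (o : option 'I_n) : option 'I_n :=
  if o is Some v then p v else None.

Definition is_cayley_tree (n : nat) (p : parent_fun n) : bool :=
  (#|[set v | p v == None]| == 1%nat) &&
  [forall v, iter n (up_step p) (Some v) == None].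

Definition cayley_trees (n : nat) : {set parent_fun n} :=
  [set p | is_cayley_tree p].

Definition desc (n : nat) (p : parent_fun n) (v : 'I_n) : {set 'I_n} :=
  [set u | [exists k : 'I_n.+1, iter k (up_step p) (Some u) == Some v]].

(* The random edge-cutting procedure.  The current tree is given by its     *)
(* vertex set V (it contains the root and is closed under taking parents).  *)
(* Its edges are {v, p v} for v in V non-root; cutting that edge cuts off   *)
(* the subtree desc p v :&: V, which is discarded.                          *)
(* cut_pmf p j fuel V k = probability that, starting from the current tree  *)
(* V, exactly k of the subtrees cut off have size j.  (fuel >= #|V| is      *)
(* always enough, since each cut removes at least one vertex.)              *)

Fixpoint cut_pmf (n : nat) (p : parent_fun n) (j : nat) (fuel : nat)
    (V : {set 'I_n}) (k : nat) {struct fuel} : R :=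
  let E := [set v in V | p v != None] in
  match fuel with
  | O => if k == 0%nat then 1%R else 0%R
  | S f =>
    if #|E| == 0%nat then (if k == 0%nat then 1%R else 0%R)
    else \big[Rplus/0%R]_(v in E)
           (/ INR #|E| *
            (if #|desc p v :&: V| == j then
               match k with
               | O => 0%R
               | S k' => cut_pmf p j f (V :\: desc p v) k'
               end
             else cut_pmf p j f (V :\: desc p v) k))%R
  end.

Definition C_pmf (n j k : nat) : R :=
  (/ INR #|cayley_trees n| *
   \big[Rplus/0%R]_(p in cayley_trees n) cut_pmf p j n setT k)%R.

(* E g(C_{n,j}); C_{n,j} <= n - 1, so the sum covers the whole support *)
Definition C_expect (n j : nat) (g : nat -> R) : R :=
  \big[Rplus/0%R]_(k < n.+1) (g k * C_pmf n j k)%R.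

Fixpoint ffact (x : R) (s : nat) : R :=
  match s with
  | O => 1%R
  | S s' => (ffact x s' * (x - INR s'))%R
  end.

Definition lambda (n j : nat) : R :=
  (sqrt (INR n) * INR j ^ (j - 1) / (INR (factorial j) * exp (INR j)))%R.

Definition Gamma (x : R) : R :=
  RInt_gen (fun t => Rpower t (x - 1) * exp (- t))%R
           (at_right 0) (Rbar_locally p_infty).

Definition rayleigh_density (x : R) : R := (x * exp (- (x ^ 2) / 2))%R.

Definition rayleigh_cdf (x : R) : R :=
  if Rle_dec x 0 then 0%R else RInt rayleigh_density 0 x.

(* Mixed Poisson MPo(rho X) with X Rayleigh(1):
   P{Y = l} = rho^l / l! * E(X^l e^{-rho X}); point mass at 0 if rho = 0 *)
Definition mpo_pmf (rho : R) (l : nat) : R :=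
  if Req_EM_T rho 0 then (if l == 0%nat then 1%R else 0%R)
  else (rho ^ l / INR (factorial l) *
        RInt_gen (fun x => x ^ l * exp (- rho * x) * rayleigh_density x)
                 (at_point 0) (Rbar_locally p_infty))%R.

Definition mpo_cdf (rho : R) (x : R) : R :=
  Series (fun l => if Rle_dec (INR l) x then mpo_pmf rho l else 0%R).

Definition conv_distr (F : nat -> R -> R) (G : R -> R) : Prop :=
  forall x : R, continuity_pt G x -> is_lim_seq (fun n => F n x) (G x).

(* Main.v *)
(* Discarding the cut-off subtree of size k leaves a uniform Cayley tree on n - k
   vertices, so the factorial moments F_s(n) = E C^(s) satisfy a convolution
   recurrence.  With b_n = n^n e^-n / n! and theta_n = b_n / n (coefficients of
   1/(1-T) and of the tree function T at z/e), a_s = b F_s solves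
     a_s = theta * a_s + a_s / m + s theta_j S_j a_(s-1),
   where * is convolution in n and S_j the shift by j, and since b = 1/(1 - theta),
     a_s = b * (a_s / m) + s theta_j S_j (b * a_(s-1)).
   The term b * (a_s / m) is of lower order, so a_s is close to
   s! theta_j^s c_(s+1) at n - s j, where c_r = b * ... * b (r factors).  These powers
   obey the exact recursion n c_r = r (c_(r+2) - c_(r+1)), which reduces their asymptotics to those
   of b (Stirling) and of c_2 -> 1/2 (comparison with binom(2n,n) / 4^n, whose
   convolution square is 1).  The limits are the Rayleigh moments, by log-convexity
   and M_(s+2) = (s+2) M_s.

   The limit laws follow from the moments by truncated expansions with one-sided
   error terms: Bonferroni's inequalities for the mixed Poisson limit, and for the
   Rayleigh limit the Laplace functionals E Z^l e^(-m Z) together with the smoothing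
   of the indicator of Z <= x by P(Poisson(m Z) <= m x). *)
From HB Require Import structures.
Require Import Defs.
From mathcomp Require Import all_boot.
From Stdlib Require Import Reals Lra.
From Coquelicot Require Import Coquelicot.
From Stdlib Require Import FunctionalExtensionality.
From mathcomp Require Import zify.
Set Implicit Arguments.
Unset Strict Implicit.
Unset Printing Implicit Defensive.
Arguments INR : simpl never.

(** * Trees as parent functions *)

(** The obstacle is uniformity: j may grow with n, so an error estimate that depends on j is
    useless. Since j enters the recurrence only through the factor theta_j and the shift by j, every
    error term can be written as a fixed sequence, independent of j, evaluated at a shifted index;
    shifts by o(n) do not change limits on a power scale. The discarding step rests on a bijection:
    trees with a chosen edge correspond to a vertex set W, a tree on W, a tree on the rest, and the
    vertex of the rest at which W hangs. The weights depend on sizes alone, so the procedure reduces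
    to a Markov chain of sizes. No constant is evaluated in closed form. Stirling's formula is used
    with an unspecified limit beta of b_n sqrt(n + 1), and the Rayleigh moments with an unspecified
    first moment m1. The recursion for c_r starts from beta and 1/2, the one for the moments from 1
    and m1, and the two match when m1 = 1 / (2 beta). The moment ratios prove this equation. *)

HB.instance Definition _ := Monoid.isComLaw.Build R 0%R Rplus
  (fun x y z => esym (Rplus_assoc x y z)) Rplus_comm Rplus_0_l.
HB.instance Definition _ := Monoid.isComLaw.Build R 1%R Rmult
  (fun x y z => esym (Rmult_assoc x y z)) Rmult_comm Rmult_1_l.
HB.instance Definition _ := Monoid.isMulLaw.Build R 0%R Rmult Rmult_0_l Rmult_0_r.
HB.instance Definition _ := Monoid.isAddLaw.Build R Rmult Rplus
  Rmult_plus_distr_r Rmult_plus_distr_l.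

Lemma Rsum_const (I : finType) (A : pred I) (c : R) :
  \big[Rplus/0%R]_(i in A) c = (INR #|A| * c)%R.
Proof.
rewrite big_const; elim: #|A| => [|m IH]; first by rewrite /= Rmult_0_l.
by rewrite iterS IH S_INR; ring.
Qed.

Section ParentFunctions.
Variable n : nat.
Implicit Types (p q : parent_fun n) (u v w r : 'I_n) (V W : {set 'I_n}).

Lemma iter_up_None p k : iter k (up_step p) None = None.
Proof. by elim: k => //= k ->. Qed.

Lemma iter_up_ge p k m u :
  (k <= m)%nat -> iter k (up_step p) (Some u) = None -> iter m (up_step p) (Some u) = None.
Proof. by move=> /subnK <- H; rewrite iterD H iter_up_None. Qed.

Definition acyclic p := forall u, exists k, iter k (up_step p) (Some u) = None.

(** A return to v could be repeated for ever, so the walk from v would never reach [None]. *)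
Lemma acyclic_irrefl p v k : acyclic p -> iter k.+1 (up_step p) (Some v) <> Some v.
Proof.
move=> ac E.
have H m : iter (m * k.+1) (up_step p) (Some v) = Some v.
  by elim: m => // m IH; rewrite mulSn iterD IH.
have [m Hm] := ac v.
have := iter_up_ge (leq_pmulr m (ltn0Sn k)) Hm.
by rewrite H.
Qed.

(** Pigeonhole: a walk alive after n steps would have n + 1 positions, distinct by [acyclic_irrefl],
    among n vertices. Hence the bounded test in [is_cayley_tree] amounts to [acyclic]. *)
Lemma acyclic_iter p u : acyclic p -> iter n (up_step p) (Some u) = None.
Proof.
move=> ac.
pose f (k : 'I_n.+1) := iter k (up_step p) (Some u).
case E: (iter n (up_step p) (Some u)) => [x|//].
have Hs (k : 'I_n.+1) : f k <> None.
  by move=> H; have := iter_up_ge (ltn_ord k : k <= n)%nat H; rewrite E.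
pose g k := odflt u (f k).
have fg k : f k = Some (g k) by rewrite /g; case: (f k) (Hs k).
have ig : injective g.
  have W (a b : 'I_n.+1) : (a < b)%nat -> g a <> g b.
    move=> ab e; have := fg b; rewrite -e /f.
    have -> : (b : nat) = ((b - a.+1).+1 + a)%nat by lia.
    rewrite iterD; have := fg a; rewrite /f => ->.
    exact: acyclic_irrefl.
  move=> a b e; case: (ltngtP a b) => [/W //|/W|/val_inj //].
  by rewrite e.
by have := leq_card g ig; rewrite !card_ord ltnn.
Qed.

Lemma descP p v u : acyclic p ->
  reflect (exists k, iter k (up_step p) (Some u) = Some v) (u \in desc p v).
Proof.
move=> ac; rewrite inE; apply: (iffP existsP) => [[k /eqP H]|[k H]].
  by exists k.
have kn : (k < n.+1)%nat.
  rewrite ltnS leqNgt; apply/negP => /ltnW/iter_up_ge/(_ (acyclic_iter u ac)).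
  by rewrite H.
by exists (Ordinal kn); apply/eqP.
Qed.

Lemma desc_self p v : v \in desc p v.
Proof. by rewrite inE; apply/existsP; exists ord0. Qed.

Lemma desc_root p v u : acyclic p -> p u = None -> (u \in desc p v) = (u == v).
Proof.
move=> ac pu; apply/idP/eqP => [/(descP _ _ ac)[[|k]]|->]; last exact: desc_self.
  by case.
by rewrite iterSr /= pu iter_up_None.
Qed.

Lemma desc_step p v u x : acyclic p -> p u = Some x -> u != v ->
  (u \in desc p v) = (x \in desc p v).
Proof.
move=> ac pu uv; apply/(descP _ _ ac)/(descP _ _ ac) => -[k H].
  by case: k H => [[] /eqP|k]; [rewrite (negbTE uv)|rewrite iterSr /= pu; exists k].
by exists k.+1; rewrite iterSr /= pu.
Qed.

(** Trees with vertex set V inside the fixed ambient ['I_n], so that all stages of the cutting share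
    one type. Vertices outside V are sent to [None], which makes the encoding unique and the counts
    correct. *)
Definition tree_on V p : bool :=
  [&& [forall v, (v \notin V) ==> (p v == None)],
      [forall v in V, forall w, (p v == Some w) ==> (w \in V)],
      #|[set v in V | p v == None]| == 1%nat &
      [forall v, iter n (up_step p) (Some v) == None]].

Lemma tree_onP V p :
  reflect [/\ forall v, v \notin V -> p v = None,
              forall v w, v \in V -> p v = Some w -> w \in V,
              exists2 r, r \in V & forall v, v \in V -> (p v == None) = (v == r)
            & acyclic p]
          (tree_on V p).
Proof.
apply: (iffP and4P) => [[/forallP H1 /forall_inP H2 /cards1P [r Er] /forallP H4]
                       |[H1 H2 [r rV Hr] ac]]; split.
- by move=> v vV; apply/eqP; apply: (implyP (H1 v)).
- by move=> v w vV /eqP E; move/forallP: (H2 _ vV) => /(_ w)/implyP/(_ E).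
- have : r \in [set r] by rewrite set11.
  rewrite -Er inE => /andP[rV pr]; exists r => // v vV.
  by move/setP: Er => /(_ v); rewrite !inE vV.
- by move=> u; exists n; apply/eqP.
- by apply/forallP => v; apply/implyP => /H1 ->.
- apply/forall_inP => v vV; apply/forallP => w; apply/implyP => /eqP; exact: H2.
- apply/cards1P; exists r; apply/setP => v; rewrite !inE.
  case vV: (v \in V); first by rewrite Hr.
  by apply/esym/eqP => e; rewrite -e vV in rV.
- by apply/forallP => v; apply/eqP/acyclic_iter.
Qed.

(** * Cutting a tree at an edge and gluing it back *)

Definition nonroots V p := [set v in V | p v != None].

Lemma card_nonroots V p : tree_on V p -> #|nonroots V p| = #|V|.-1.
Proof.
move=> /tree_onP [_ _ [r rV Hr] _].
rewrite (cardsD1 r V) rV /=; apply: eq_card => v; rewrite !inE andbC.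
by case vV: (v \in V); rewrite ?andbF // Hr.
Qed.

Lemma desc_sub V p v : tree_on V p -> v \in V -> desc p v \subset V.
Proof.
move=> /tree_onP [H1 _ _ ac] vV; apply/subsetP => u ud.
apply: contraTT ud => uV; rewrite desc_root //; last exact: H1.
by apply: contraNneq uV => ->.
Qed.

Definition restr p W : parent_fun n := [ffun u => if u \in W then p u else None].
Definition subtree p W v : parent_fun n :=
  [ffun u => if (u \in W) && (u != v) then p u else None].
(** For a tree q on W the default [w] is taken exactly at the root of q, which thereby becomes a
    child of w. *)
Definition glue W p w q : parent_fun n :=
  [ffun u => if u \in W then Some (odflt w (q u)) else p u].
Definition root_of W q w := odflt w [pick v in W | q v == None].

Lemma acyclic_weaken p q : (forall u, q u = None \/ q u = p u) -> acyclic p -> acyclic q.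
Proof.
move=> H ac u; have [k Hk] := ac u; exists k.
elim: k u Hk => // k IH u; rewrite !iterSr /=.
case: (H u) => ->; first by rewrite iter_up_None.
by case: (p u) => [x|]; [exact: IH | rewrite !iter_up_None].
Qed.

Lemma root_ofE W q w r : r \in W -> (forall v, v \in W -> (q v == None) = (v == r)) ->
  root_of W q w = r.
Proof.
move=> rW Hr; rewrite /root_of; case: pickP => [v /andP[vW]|/(_ r)].
  by rewrite Hr // => /eqP.
by rewrite rW Hr // eqxx.
Qed.

(** Together with [glue_tree] this is the bijection between trees on V with a chosen edge and
    quadruples made of W, a tree outside W, a vertex outside W and a tree on W. *)
Lemma split_tree V p v w : tree_on V p -> v \in nonroots V p -> p v = Some w ->
  let D := desc p v in
  [/\ [/\ D \subset V, tree_on (V :\: D) (restr p (V :\: D)), w \in V :\: D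
        & tree_on D (subtree p D v)],
      glue D (restr p (V :\: D)) w (subtree p D v) = p &
      root_of D (subtree p D v) w = v].
Proof.
move=> tp; rewrite inE => /andP[vV _] pv D.
have [H1 H2 [r rV Hr] ac] := tree_onP _ _ tp.
have DV : D \subset V := desc_sub tp vV.
have vr : v != r by rewrite -Hr // pv.
have pr : p r = None by apply/eqP; rewrite Hr.
have inD_some u : u \in D -> u != v -> exists2 x, p u = Some x & x \in D.
  move=> uD uv; case pu: (p u) => [x|].
    by exists x => //; rewrite /D -(desc_step ac pu uv).
  by move: uD; rewrite /D desc_root // (negbTE uv).
have wD : w \notin D.
  apply/negP => /(descP _ _ ac) [k Hk].
  by apply: (@acyclic_irrefl p v k ac); rewrite iterSr /= pv.
have Hroot u : u \in D -> (subtree p D v u == None) = (u == v).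
  move=> uD; rewrite ffunE uD /=; case: (eqVneq u v) => //= uv.
  by have [x -> _] := inD_some u uD uv.
split; last 1 first.
- exact: root_ofE (desc_self _ _) Hroot.
- split=> //.
  + apply/tree_onP; split.
    * by move=> u uV; rewrite ffunE (negbTE uV).
    * move=> u x; rewrite ffunE inE => uVD; rewrite uVD => pu.
      have /andP[uD uV] := uVD; rewrite inE (H2 _ _ uV pu) andbT.
      rewrite /D -(@desc_step p v u x) //.
      by apply: contraNneq uD => ->; exact: desc_self.
    * exists r; first by rewrite inE rV /D desc_root // eq_sym (negbTE vr).
      by move=> u; rewrite ffunE => uVD; rewrite uVD Hr //; move: uVD; rewrite inE => /andP[].
    * by apply: acyclic_weaken ac => u; rewrite ffunE; case: ifP; [right|left].
  + by rewrite inE wD (H2 _ _ vV pv).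
  + apply/tree_onP; split.
    * by move=> u uV; rewrite ffunE (negbTE uV).
    * move=> u x uD; rewrite ffunE uD /=; case: ifP => // uv.
      by have [y -> yD [<-]] := inD_some u uD uv.
    * by exists v; [exact: desc_self|].
    * by apply: acyclic_weaken ac => u; rewrite ffunE; case: ifP; [right|left].
- apply/ffunP => u; rewrite !ffunE.
  case uD: (u \in D) => /=.
    case: (eqVneq u v) => [-> //|uv] /=.
    by have [x -> _] := inD_some u uD uv.
  by rewrite inE uD /=; case: ifP => // /negbT /H1.
Qed.

Lemma glue_tree V W p w q : W \subset V -> tree_on (V :\: W) p -> w \in V :\: W ->
  tree_on W q ->
  let g := glue W p w q in let r := root_of W q w in
  [/\ tree_on V g, r \in nonroots V g & g r = Some w] /\
  [/\ desc g r = W, restr g (V :\: W) = p & subtree g W r = q].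
Proof.
move=> /subsetP WV tp wVW tq g r0.
have [P1 P2 [s sV Hs] acp] := tree_onP _ _ tp.
have [Q1 Q2 [r rW Hr] acq] := tree_onP _ _ tq.
have -> : r0 = r by exact: root_ofE.
have qr : q r = None by apply/eqP; rewrite Hr.
have gr : g r = Some w by rewrite ffunE rW qr.
have gout u : u \notin W -> g u = p u by move=> uW; rewrite ffunE (negbTE uW).
have gin u x : u \in W -> q u = Some x -> g u = Some x by move=> uW E; rewrite ffunE uW E.
have pout u x : p u = Some x -> x \in V :\: W.
  move=> pu; apply: P2 (pu); apply: contraT => /P1.
  by rewrite pu.
have itout k u : u \notin W -> iter k (up_step g) (Some u) = iter k (up_step p) (Some u).
  elim: k u => // k IH u uW; rewrite !iterSr /= gout //.
  case pu: (p u) => [x|]; last by rewrite !iter_up_None.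
  by apply: IH; have := pout _ _ pu; rewrite inE => /andP[].
have wW : w \notin W by move: wVW; rewrite inE => /andP[].
(* Inside W a walk follows q to its root and then steps to w; outside W it is a walk of p. Both
   reach [None]. *)
have acg : acyclic g.
  move=> u; case uW: (u \in W); last first.
    by have [k Hk] := acp u; exists k; rewrite itout ?uW.
  have [k] := acq u; elim: k u uW => // k IH u uW; rewrite iterSr /=.
  case qu: (q u) => [x|].
    move=> /(IH _ (Q2 _ _ uW qu)) [m Hm]; exists m.+1.
    by rewrite iterSr /= (gin _ _ uW qu).
  move=> _; have [m Hm] := acp w; exists m.+1.
  by rewrite iterSr /= ffunE uW qu /= itout.
have dg : desc g r = W.
  apply/setP => u; apply/(descP _ _ acg)/idP => [[k]|uW].
    move=> Hk; apply: contraT => uW; move: Hk; rewrite itout //.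
    case: k => [[e]|k]; first by rewrite e rW in uW.
    rewrite iterS; case: (iter _ _ _) => //= x /pout.
    by rewrite inE rW.
  have [k] := acq u; elim: k u uW => // k IH u uW; rewrite iterSr /=.
  case qu: (q u) => [x|].
    move=> /(IH _ (Q2 _ _ uW qu)) [m Hm]; exists m.+1.
    by rewrite iterSr /= (gin _ _ uW qu).
  by exists 0%nat; move/eqP: qu; rewrite Hr // => /eqP ->.
split; split=> //.
- apply/tree_onP; split=> //.
  + move=> u uV; rewrite ffunE; case: ifP => [/WV|_]; first by rewrite (negbTE uV).
    by apply: P1; rewrite inE (negbTE uV) andbF.
  + move=> u x uV; rewrite ffunE; case: ifP => [uW [<-]|uW /pout].
      case qu: (q u) => [y|] /=; first exact/WV/(Q2 _ _ uW).
      by move: wVW; rewrite inE => /andP[].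
    by rewrite inE => /andP[].
  + move: (sV); rewrite inE => /andP[sW sV']; exists s => // u uV.
    rewrite ffunE; case: ifP => [uW|/negbT uW]; last by rewrite Hs // inE uW.
    by apply/esym/eqP => e; rewrite -e uW in sW.
- by rewrite inE (WV _ rW) gr.
- apply/ffunP => u; rewrite ffunE; case: ifP => [|/negbT /P1 ->//].
  by rewrite inE => /andP[uW _]; exact: gout.
- apply/ffunP => u; rewrite ffunE; case uW: (u \in W) => /=; last first.
    by rewrite Q1 ?uW.
  rewrite -Hr //; case qu: (q u) => [x|//] /=.
  exact: gin.
Qed.

Definition num_trees W := #|[set q | tree_on W q]|.

Lemma sum_trees_const W c :
  \big[Rplus/0%R]_(p | tree_on W p) c = (INR (num_trees W) * c)%R.
Proof. by rewrite -Rsum_const; apply: eq_bigl => q; rewrite inE. Qed.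

(** Double counting along the bijection. As [phi] sees only the cut-off set and the remaining tree,
    the attachment vertex and the tree on W contribute the factors [#|V :\: W|] and
    [num_trees W]. *)
Lemma tree_cut_sum V (phi : {set 'I_n} -> parent_fun n -> R) :
  \big[Rplus/0%R]_(p | tree_on V p) \big[Rplus/0%R]_(v in nonroots V p)
    phi (desc p v) (restr p (V :\: desc p v)) =
  \big[Rplus/0%R]_(W : {set 'I_n} | W \subset V)
    \big[Rplus/0%R]_(p | tree_on (V :\: W) p)
      (INR #|V :\: W| * (INR (num_trees W) * phi W p))%R.
Proof.
(* Admissible quadruples ((W, p), (w, q)); both sides are rewritten as sums over them. *)
pose QJ (i : ({set 'I_n} * parent_fun n) * ('I_n * parent_fun n)) :=
  (i.1.1 \subset V) && tree_on (V :\: i.1.1) i.1.2 &&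
  ((i.2.1 \in V :\: i.1.1) && tree_on i.1.1 i.2.2).
transitivity (\big[Rplus/0%R]_(i | QJ i) phi i.1.1 i.1.2); last first.
  rewrite pair_big_dep /=.
  rewrite [RHS](eq_bigr (fun i : {set 'I_n} * parent_fun n =>
      \big[Rplus/0%R]_(j : 'I_n * parent_fun n | (j.1 \in V :\: i.1) && tree_on i.1 j.2)
        phi i.1 i.2)).
    by rewrite pair_big_dep.
  move=> [W p] _ /=.
  transitivity (\big[Rplus/0%R]_(w in V :\: W) \big[Rplus/0%R]_(q | tree_on W q) phi W p).
    by rewrite Rsum_const sum_trees_const.
  exact: pair_big.
rewrite pair_big_dep /=.
pose h (i : ({set 'I_n} * parent_fun n) * ('I_n * parent_fun n)) :=
  (glue i.1.1 i.1.2 i.2.1 i.2.2, root_of i.1.1 i.2.2 i.2.1).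
pose h' (j : parent_fun n * 'I_n) :=
  ((desc j.1 j.2, restr j.1 (V :\: desc j.1 j.2)),
   (odflt j.2 (j.1 j.2), subtree j.1 (desc j.1 j.2) j.2)).
rewrite (reindex_onto h h') /=; last first.
  move=> [p v] /= /andP[tp vE]; case pv: (p v) (vE) => [w|]; last by rewrite inE pv andbF.
  by have [_ e1 e2] := split_tree tp vE pv; rewrite /h /= pv /= e1 e2.
apply: eq_big => [[[W p] [w q]]|[[W p] [w q]]].
  apply/idP/idP => [/andP[/andP[tp vE] /eqP e]|/andP[/andP[/= WV tp] /andP[wV tq]]].
    rewrite -e {e}; move: tp vE; rewrite /h' /h /=.
    move: (glue _ _ _ _) (root_of _ _ _) => {p w q W} p v tp vE.
    case pv: (p v) (vE) => [w|]; last by rewrite inE pv andbF.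
    by have [[s1 s2 s3 s4] _ _] := split_tree tp vE pv; rewrite /QJ /= s1 s2 s3 s4.
  have [[g1 g2 g3] [g4 g5 g6]] := glue_tree WV tp wV tq.
  by rewrite /h /h' /= g1 g2 g3 g4 g5 g6 eqxx.
move=> /andP[_ /eqP]; rewrite /h /h' /= => e.
by case: e => -> -> _ _.
Qed.

(** * The cutting procedure on a fixed tree *)

Definition closed_up V p := forall v w, v \in V -> p v = Some w -> w \in V.

Lemma iter_up_agree V p q k u : closed_up V p -> {in V, p =1 q} -> u \in V ->
  iter k (up_step p) (Some u) = iter k (up_step q) (Some u).
Proof.
move=> cl e; elim: k u => // k IH u uV; rewrite !iterSr /= -e //.
case pu: (p u) => [x|]; last by rewrite !iter_up_None.
by apply: IH; apply: cl pu.
Qed.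

Lemma desc_agree V p q v : closed_up V p -> {in V, p =1 q} ->
  desc p v :&: V = desc q v :&: V.
Proof.
move=> cl e; apply/setP => u; rewrite !inE; case uV: (u \in V); rewrite ?andbF ?andbT //.
by apply: eq_existsb => k; rewrite (iter_up_agree k cl e uV).
Qed.

Lemma setD_desc V p v : V :\: desc p v = V :\: (desc p v :&: V).
Proof. by apply/setP => u; rewrite !inE; case: (u \in V); rewrite ?andbF ?andbT. Qed.

Lemma closed_up_cut V p v : acyclic p -> closed_up V p -> closed_up (V :\: desc p v) p.
Proof.
move=> ac cl u w; rewrite !in_setD => /andP[uD uV] pu; rewrite (cl _ _ uV pu) andbT.
rewrite -(desc_step ac pu) //.
by apply: contraNneq uD => ->; exact: desc_self.
Qed.

(** [cut_pmf] keeps the original parent function while the vertex set shrinks. This allows its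
    replacement by the restriction to the current tree, which is what an induction over trees can
    use. *)
Lemma cut_pmf_agree j f V p q k : acyclic p -> closed_up V p -> {in V, p =1 q} ->
  cut_pmf p j f V k = cut_pmf q j f V k.
Proof.
move=> ac; elim: f V k => //= f IH V k cl e.
have -> : [set v in V | q v != None] = [set v in V | p v != None].
  by apply/setP => v; rewrite !inE; case vV: (v \in V) => //=; rewrite e.
case: ifP => // _; apply: eq_bigr => v _.
rewrite -(desc_agree _ cl e) [V :\: desc q v]setD_desc -(desc_agree _ cl e) -setD_desc.
have cl' := closed_up_cut (v:=v) ac cl.
have e' : {in V :\: desc p v, p =1 q} by move=> u; rewrite inE => /andP[_ /e].
by case: ifP => _; [case: k => // k|]; rewrite IH.
Qed.

Lemma cut_pmf_gt j f V p k : (f < k)%nat -> cut_pmf p j f V k = 0%R.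
Proof.
elim: f V k => [|f IH] V k /=; first by case: k.
move=> fk; case: ifP => [_|_]; first by case: k fk.
rewrite big1 // => v _; case: ifP => _; last by rewrite IH ?Rmult_0_r // ltnW.
by case: k fk => [|k] fk; rewrite ?IH ?Rmult_0_r.
Qed.

(** The range covers the support by [cut_pmf_gt]: each unit of fuel is one cut and adds at most one
    counted subtree. *)
Definition cut_expect p j f V (g : nat -> R) : R :=
  \big[Rplus/0%R]_(k < f.+1) (g k * cut_pmf p j f V k)%R.

Lemma cut_expect0 p j V g : cut_expect p j 0 V g = g 0%nat.
Proof. by rewrite /cut_expect big_ord1 /=; ring. Qed.

Lemma cut_expect_trivial p j f V g : #|nonroots V p| = 0%nat ->
  cut_expect p j f V g = g 0%nat.
Proof.
move=> E0; rewrite /cut_expect big_ord_recl big1 => [|i _].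
  case: f => [|f] /=; first by ring.
  by rewrite -/(nonroots V p) E0 /=; ring.
case: f i => [|f] i /=; first by ring.
by rewrite -/(nonroots V p) E0 /=; ring.
Qed.

Lemma cut_expectS p j f V g : #|nonroots V p| <> 0%nat ->
  cut_expect p j f.+1 V g =
  \big[Rplus/0%R]_(v in nonroots V p)
    (/ INR #|nonroots V p| *
     cut_expect p j f (V :\: desc p v)
       (if #|desc p v :&: V| == j then fun k => g k.+1 else g))%R.
Proof.
move=> /eqP/negbTE E0; rewrite /cut_expect /= -/(nonroots V p) E0.
under eq_bigr => k _ do rewrite big_distrr /=.
rewrite exchange_big /=; apply: eq_bigr => v _.
(* A counted cut shifts k by one, so the term k = 0 drops out; otherwise the top term k = f + 1
   drops out by [cut_pmf_gt]. *)
case: ifP => _.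
  rewrite big_ord_recl /= big_distrr /= !Rmult_0_r Rplus_0_l.
  by apply: eq_bigr => i _; rewrite /bump leq0n add1n add0n; ring.
rewrite big_ord_recr /= cut_pmf_gt // big_distrr /= !Rmult_0_r Rplus_0_r.
by apply: eq_bigr => i _; ring.
Qed.
End ParentFunctions.

(** * Cayley's formula *)

Lemma INR0 : INR 0 = 0%R. Proof. by []. Qed.
Lemma INR1 : INR 1 = 1%R. Proof. by []. Qed.

Lemma INRD m n : INR (m + n)%nat = (INR m + INR n)%R.
Proof. exact: plus_INR. Qed.

Lemma INRM m n : INR (m * n)%nat = (INR m * INR n)%R.
Proof. exact: mult_INR. Qed.

Lemma is_derive_big (I : Type) (r : seq I) (F F' : I -> R -> R) (x : R) :
  (forall i, is_derive (F i) x (F' i x)) ->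
  is_derive (fun y => \big[Rplus/0%R]_(i <- r) F i y) x (\big[Rplus/0%R]_(i <- r) F' i x).
Proof.
move=> H; elim: r => [|i r IH].
  rewrite big_nil; apply: is_derive_ext => [y|]; first by rewrite big_nil.
  exact: is_derive_const.
rewrite big_cons; apply: (is_derive_ext (fun y => plus (F i y) (\big[Rplus/0%R]_(k <- r) F k y))).
  by move=> y; rewrite big_cons.
exact: is_derive_plus.
Qed.

Lemma eq_of_derive_eq (f g d : R -> R) :
  (forall x, is_derive f x (d x)) -> (forall x, is_derive g x (d x)) ->
  f 0%R = g 0%R -> forall x, f x = g x.
Proof.
move=> Hf Hg e x.
have [c [_ H]] := @MVT_gen (fun y => minus (f y) (g y)) 0 x (fun _ => 0%R)
  (fun y _ => eq_rect _ (fun l => is_derive (fun y => minus (f y) (g y)) y l)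
     (is_derive_minus _ _ _ _ _ (Hf y) (Hg y)) _ (minus_eq_zero (d y)))
  (fun y _ => ltac:(apply: continuity_pt_minus; apply/continuity_pt_filterlim;
     apply: ex_derive_continuous; eexists; [exact: Hf|exact: Hg])).
by move: H; rewrite /minus /plus /opp /=; lra.
Qed.

Lemma sum_bin_sign r : \big[Rplus/0%R]_(k < r.+2) ((-1) ^ k * INR 'C(r.+1, k))%R = 0%R.
Proof.
rewrite big_ord_recl bin0.
transitivity ((1 + \big[Rplus/0%R]_(k < r.+1) ((-1) ^ k.+1 * INR 'C(r, k.+1))) +
  \big[Rplus/0%R]_(k < r.+1) ((-1) ^ k.+1 * INR 'C(r, k)))%R.
  rewrite Rplus_assoc -big_split /=; congr Rplus; first by rewrite INR1 /=; ring.
  by apply: eq_bigr => i _; rewrite /bump leq0n add1n add0n binS INRD /=; ring.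
have -> : (1 + \big[Rplus/0%R]_(k < r.+1) ((-1) ^ k.+1 * INR 'C(r, k.+1)) =
  \big[Rplus/0%R]_(k < r.+1) ((-1) ^ k * INR 'C(r, k)))%R.
  rewrite [RHS]big_ord_recl big_ord_recr /= (@bin_small r r.+1) // bin0.
  rewrite (eq_bigr (fun i : 'I_r => (-1) ^ (bump 0 i) * INR 'C(r, bump 0 i))%R) /=.
    by rewrite INR1 INR0; ring.
  by move=> i _; rewrite /bump leq0n add1n.
rewrite -big_split big1 // => i _ /=; ring.
Qed.

(** The r-th finite difference annihilates polynomials of degree below r. One factor [INR k + x] is
    split off, and the absorption identity for k times the binomial lowers r and d together, at the
    price of shifting x by one. *)
Lemma sum_bin_sign_pow d r x : (d < r)%nat ->
  \big[Rplus/0%R]_(k < r.+1) ((-1) ^ k * INR 'C(r, k) * (INR k + x) ^ d)%R = 0%R.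
Proof.
elim: d r x => [|d IH] [//|r] x dr.
  by rewrite -[RHS](sum_bin_sign r); apply: eq_bigr => k _ /=; ring.
transitivity (\big[Rplus/0%R]_(k < r.+2) ((-1) ^ k * INR 'C(r.+1, k) * (INR k + x) ^ d * INR k)
  + x * \big[Rplus/0%R]_(k < r.+2) ((-1) ^ k * INR 'C(r.+1, k) * (INR k + x) ^ d))%R.
  rewrite big_distrr -big_split /=; apply: eq_bigr => k _ /=; ring.
rewrite (IH r.+1) ?(ltn_trans _ dr) // big_ord_recl /= Rmult_0_r Rmult_0_r !Rplus_0_l Rplus_0_r.
transitivity (- INR r.+1 * \big[Rplus/0%R]_(k < r.+1) ((-1) ^ k * INR 'C(r, k) * (INR k + (1 + x)) ^ d))%R.
  rewrite big_distrr /=; apply: eq_bigr => k _; rewrite /bump leq0n add1n add0n.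
  have E : (INR 'C(r.+1, k.+1) * INR k.+1 = INR r.+1 * INR 'C(r, k))%R.
    by rewrite -!INRM [X in INR X = _]mulnC -(mul_bin_diag r.+1).
  transitivity ((-1) ^ k.+1 * (INR k.+1 + x) ^ d * (INR 'C(r.+1, k.+1) * INR k.+1))%R.
    by rewrite /=; ring.
  rewrite E (_ : (INR k.+1 + x = INR k + (1 + x))%R); last by rewrite S_INR; ring.
  rewrite /=; ring.
by rewrite IH ?Rmult_0_r.
Qed.

(* The limit case x -> 0 of Abel's binomial identity
   (x + y)^n = sum_k C(n,k) x (x + k)^(k-1) (y - k)^(n-k): both sides have
   proportional derivatives in y, and at y = 0 the left side is a finite difference. *)
Lemma abel_identity n y :
  \big[Rplus/0%R]_(k < n.+1)
    (INR 'C(n.+1, k.+1) * INR k.+1 ^ k * (y - INR k.+1) ^ (n - k))%R = (INR n.+1 * y ^ n)%R.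
Proof.
elim: n y => [|n IH] y.
  by rewrite big_ord1 /= INR1; ring.
move: y; apply: (@eq_of_derive_eq _ _ (fun y => INR n.+2 * (INR n.+1 * y ^ n)))%R.
- move=> y; rewrite -IH.
  have -> : (INR n.+2 * \big[Rplus/0]_(k < n.+1)
     (INR 'C(n.+1, k.+1) * INR k.+1 ^ k * (y - INR k.+1) ^ (n - k)) =
    \big[Rplus/0]_(k < n.+2)
     (INR 'C(n.+2, k.+1) * INR k.+1 ^ k * (INR (n.+1 - k) * (y - INR k.+1) ^ (n - k))))%R.
    rewrite [RHS]big_ord_recr /= subnn /= Rmult_0_l Rmult_0_r Rplus_0_r big_distrr /=.
    apply: eq_bigr => k _.
    have E : (INR 'C(n.+2, k.+1) * INR (n.+1 - k) = INR n.+2 * INR 'C(n.+1, k.+1))%R.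
      by rewrite -!INRM [X in INR X = _]mulnC (mul_bin_down n.+2) subSS.
    transitivity ((INR n.+2 * INR 'C(n.+1, k.+1)) * INR k.+1 ^ k * (y - INR k.+1) ^ (n - k))%R.
      by ring.
    by rewrite -E; ring.
  apply: (@is_derive_big _ _
    (fun (k : 'I_n.+2) z => INR 'C(n.+2, k.+1) * INR k.+1 ^ k * (z - INR k.+1) ^ (n.+1 - k))%R
    (fun (k : 'I_n.+2) z => INR 'C(n.+2, k.+1) * INR k.+1 ^ k *
      (INR (n.+1 - k) * (z - INR k.+1) ^ (n - k)))%R) => k.
  have -> : (n - k = (n.+1 - k).-1)%nat by lia.
  by auto_derive => //; rewrite Rmult_1_l.
- by move=> y; auto_derive => //; rewrite Rmult_1_l.
rewrite (_ : _ * 0 ^ n.+1 = 0)%R; last by rewrite /=; ring.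
have := @sum_bin_sign_pow n.+1 n.+2 0 (leqnn _).
rewrite big_ord_recl /= Rplus_0_l Rmult_0_l Rmult_0_r Rplus_0_l => E.
transitivity ((-1) ^ n * \big[Rplus/0]_(k < n.+2)
  ((-1) ^ k.+1 * INR 'C(n.+2, k.+1) * (INR k.+1 + 0) ^ n.+1))%R; last first.
  rewrite (_ : \big[_/_]_(k < _) _ = 0%R); first by rewrite Rmult_0_r.
  by rewrite -[RHS]E; apply: eq_bigr => k _; rewrite /bump leq0n add1n add0n.
rewrite big_distrr /=; apply: eq_bigr => k _.
have pw x : (x ^ n.+1 = x ^ k * x ^ (n.+1 - k))%R.
  by rewrite -pow_add; congr pow; have := ltn_ord k; lia.
have sq : ((-1) ^ k * (-1) ^ k = 1)%R.
  by rewrite -Rpow_mult_distr (_ : -1 * -1 = 1)%R ?pow1 //; ring.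
rewrite Rplus_0_r -[(INR k.+1 * _)%R]/(INR k.+1 ^ n.+1)%R pw Rminus_0_l.
rewrite (_ : - INR k.+1 = -1 * INR k.+1)%R; last by ring.
rewrite Rpow_mult_distr.
have -> : ((-1) ^ (n.+1 - k) = (-1) ^ n * (-1 * (-1) ^ k))%R.
  transitivity ((-1) ^ n.+1 * (-1) ^ k)%R; last by rewrite /=; ring.
  by rewrite pw Rmult_comm -Rmult_assoc sq Rmult_1_l.
ring.
Qed.

Section CayleyCount.
Variable n : nat.
Implicit Types (p q : parent_fun n) (V W : {set 'I_n}).

Lemma num_trees0 : num_trees (set0 : {set 'I_n}) = 0%nat.
Proof.
apply/eqP; rewrite cards_eq0; apply/eqP/setP => q; rewrite !inE.
by apply/negP => /tree_onP[_ _ [r]]; rewrite inE.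
Qed.

Lemma num_trees1 (v : 'I_n) : num_trees [set v] = 1%nat.
Proof.
apply/eqP/cards1P; exists [ffun=> None]; apply/setP => q; rewrite !inE.
apply/tree_onP/eqP => [[H1 H2 [r /set1P -> Hr] _]|->].
  apply/ffunP => u; rewrite ffunE; case: (eqVneq u v) => [->|uv].
    by apply/eqP; rewrite Hr ?set11.
  by apply: H1; rewrite inE.
split.
- by move=> u _; rewrite ffunE.
- by move=> u w _; rewrite ffunE.
- by exists v; rewrite ?set11 // => u /set1P ->; rewrite ffunE !eqxx.
- by move=> u; exists 1%nat; rewrite /= ffunE.
Qed.

Lemma sum_subsets V (f : nat -> R) :
  \big[Rplus/0%R]_(W : {set 'I_n} | W \subset V) f #|W| =
  \big[Rplus/0%R]_(i < #|V|.+1) (INR 'C(#|V|, i) * f i)%R.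
Proof.
have H W : W \subset V -> (#|W| < #|V|.+1)%nat by rewrite ltnS; exact: subset_leq_card.
rewrite (partition_big (fun W => inord #|W| : 'I_#|V|.+1) xpredT) //=.
apply: eq_bigr => i _; rewrite -cards_draws -Rsum_const.
apply: eq_big => [W|W /andP[WV /eqP <-]]; last by rewrite inordK // H.
rewrite inE; case WV: (W \subset V) => //=.
by rewrite -val_eqE /= inordK ?H.
Qed.

Lemma card_setD_sub V W : W \subset V -> #|V :\: W| = (#|V| - #|W|)%nat.
Proof. by move=> WV; rewrite cardsD (setIidPr WV). Qed.

(* Counting pairs (tree, edge) on m+1 vertices gives the convolution recurrence
   that Abel's identity solves. *)
Theorem cayley m V : #|V| = m.+1 -> INR (num_trees V) = (INR m.+1 ^ m)%R.
Proof.
elim/ltn_ind: m V => m IH V Vm; case: (posnP m) => [m0|mpos].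
  by move: Vm; rewrite m0 => /eqP/cards1P [v ->]; rewrite num_trees1 INR1.
have IH' W i : #|W| = i -> (0 < i <= m)%nat -> INR (num_trees W) = (INR i ^ i.-1)%R.
  by case: i => // i Wi im; apply: IH Wi.
have := tree_cut_sum V (fun _ _ => 1%R).
rewrite (eq_bigr (fun _ => INR m)); last first.
  by move=> p tp; rewrite Rsum_const card_nonroots // Vm /=; ring.
rewrite sum_trees_const.
pose f i := (if (0 < i <= m)%nat then INR i ^ i.-1 * INR (m.+1 - i) ^ (m.+1 - i) else 0)%R.
rewrite [X in _ = X](eq_bigr (fun W : {set 'I_n} => f #|W|)); last first.
  move=> W WV.
  rewrite sum_trees_const /f.
  have := card_setD_sub WV; have := subset_leq_card WV; rewrite Vm.
  case: (posnP #|W|) => [W0|W0] Wm cD.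
    by rewrite (cards0_eq W0) num_trees0 cards0 INR0 /=; ring.
  case: (leqP #|W| m) => /= [Wm'|Wm']; last first.
    have D0 : #|V :\: W| = 0%nat by apply/eqP; rewrite cD subn_eq0.
    rewrite D0 INR0; ring.
  rewrite (IH' W _ erefl) ?W0 // (IH' (V :\: W) _ cD); last first.
    by rewrite subn_gt0 ltnS Wm' /= leq_subLR -add1n leq_add2r.
  rewrite cD subSn //.
  rewrite /=; ring.
rewrite sum_subsets Vm big_ord_recl /= {1}/f /= Rmult_0_r Rplus_0_l => E.
(* At y = m + 1 the last term of Abel's identity is (m+1)^m, so the others add up to m (m+1)^m, to
   be compared with m times the number of trees. *)
have := abel_identity m (INR m.+1); rewrite big_ord_recr /= subnn binn INR1.
rewrite (eq_bigr (fun i : 'I_m => INR 'C(m.+1, bump 0 i) * f (bump 0 i))%R); last first.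
  move=> i _; rewrite /bump leq0n add1n /f ltnS /= ltn_ord -minus_INR; last by apply/leP; have := ltn_ord i; lia.
  by rewrite Rmult_assoc subSS.
move: E; rewrite big_ord_recr /= {2}/f /bump leq0n add1n ltnn andbF Rmult_0_r Rplus_0_r => <-.
have : (0 < INR m)%R by apply: lt_0_INR; apply/ltP.
rewrite S_INR; move: (_ ^ m)%R (INR (num_trees V)) => x y mp H.
by apply: (Rmult_eq_reg_r (INR m)); [lra|lra].
Qed.
End CayleyCount.

(** * Reduction to a recursion on sizes *)

(** Pairs of a tree on m vertices and an edge that cuts off i vertices, divided by all such pairs.
    The exponent m - i, not m - i - 1, includes the choice of the attachment vertex. *)
Definition cut_prob (m i : nat) : R :=
  (INR 'C(m, i) * INR i ^ i.-1 * INR (m - i) ^ (m - i) / (INR m.-1 * INR m ^ m.-1))%R.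

(** Expectation for the Markov chain of tree sizes. A counted cut is recorded by shifting g, as in
    [cut_expectS], so the recursion carries no counter. *)
Fixpoint size_expect (j f m : nat) (g : nat -> R) : R :=
  match f with
  | O => g 0%nat
  | S f' =>
    if (m <= 1)%nat then g 0%nat
    else \big[Rplus/0%R]_(1 <= i < m)
           (cut_prob m i * size_expect j f' (m - i) (if i == j then fun k => g k.+1 else g))%R
  end.

(** Uniformity of the remaining tree enters here: after [tree_cut_sum] the inner sum runs over all
    trees on [V :\: W], and the induction hypothesis makes it depend on the size of W alone. *)
Lemma tree_expect n (V : {set 'I_n}) j f m g : #|V| = m.+1 ->
  \big[Rplus/0%R]_(p | tree_on V p) cut_expect p j f V g =
  (INR m.+1 ^ m * size_expect j f m.+1 g)%R.
Proof.
elim: f V m g => [|f IH] V m g Vm.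
  rewrite (eq_bigr (fun _ => g 0%nat)); last by move=> p _; exact: cut_expect0.
  by rewrite sum_trees_const (cayley Vm).
have nrE p : tree_on V p -> #|nonroots V p| = m by move=> /card_nonroots; rewrite Vm.
case: (posnP m) => [m0|mpos].
  rewrite (eq_bigr (fun _ => g 0%nat)); last first.
    by move=> p tp; apply: cut_expect_trivial; rewrite nrE.
  by rewrite sum_trees_const (cayley Vm) m0.
pose G (i : nat) := if i == j then fun k => g k.+1 else g.
pose phi (W : {set 'I_n}) p := (/ INR m * cut_expect p j f (V :\: W) (G #|W|))%R.
transitivity (\big[Rplus/0%R]_(p | tree_on V p) \big[Rplus/0%R]_(v in nonroots V p)
    phi (desc p v) (restr p (V :\: desc p v))).
  apply: eq_bigr => p tp; have [H1 H2 _ ac] := tree_onP _ _ tp.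
  rewrite cut_expectS (nrE p tp); last by lia.
  apply: eq_bigr => v; rewrite inE => /andP[vV _].
  rewrite (setIidPl (desc_sub tp vV)) /phi /G; congr Rmult.
  apply: eq_bigr => k _; congr Rmult; apply: cut_pmf_agree => //.
    exact: closed_up_cut.
  by move=> u uV; rewrite ffunE uV.
rewrite (tree_cut_sum V phi).
pose F i := (if (0 < i <= m)%nat then
   INR i ^ i.-1 * INR (m.+1 - i) ^ (m.+1 - i) * (/ INR m * size_expect j f (m.+1 - i) (G i)) else 0)%R.
rewrite (eq_bigr (fun W : {set 'I_n} => F #|W|)); last first.
  move=> W WV; rewrite /F /phi.
  have := card_setD_sub WV; have := subset_leq_card WV; rewrite Vm => Wm cD.
  case: (posnP #|W|) => [W0|W0] /=.
    rewrite big1 // => p _; rewrite (cards0_eq W0) num_trees0 INR0; ring.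
  case: (leqP #|W| m) => /= [Wm'|Wm']; last first.
    have D0 : #|V :\: W| = 0%nat by apply/eqP; rewrite cD subn_eq0.
    by rewrite big1 // => p _; rewrite D0 INR0; ring.
  have cD' : #|V :\: W| = (m - #|W|).+1 by rewrite cD subSn.
  have NW : INR (num_trees W) = (INR #|W| ^ #|W|.-1)%R.
    by rewrite (@cayley _ #|W|.-1) prednK.
  rewrite -!big_distrr /= (IH _ _ _ cD') NW cD' subSn //=; ring.
have mm : INR m <> 0%R by apply: not_0_INR; lia.
have F0 : F 0%nat = 0%R by [].
have FS : F m.+1 = 0%R by rewrite /F ltnn.
rewrite sum_subsets Vm big_ord_recl F0 Rmult_0_r Rplus_0_l.
rewrite big_ord_recr [F (lift _ _)]FS Rmult_0_r /= Rplus_0_r.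
rewrite ltnS leqNgt mpos /= big_add1 /= big_mkord big_distrr /=.
apply: eq_bigr => i _; rewrite /bump leq0n add1n /F /= ltn_ord /cut_prob /G.
have im := ltn_ord i.
have mp : (INR m.+1 ^ m <> 0)%R by apply/pow_nonzero/not_0_INR.
by rewrite subSS /=; field.
Qed.

Lemma tree_on_setT n (p : parent_fun n) : tree_on setT p = is_cayley_tree p.
Proof.
rewrite /tree_on /is_cayley_tree.
have -> : [forall v, (v \notin [set: 'I_n]) ==> (p v == None)].
  by apply/forallP => v; rewrite inE.
have -> : [forall v in [set: 'I_n], forall w, (p v == Some w) ==> (w \in [set: 'I_n])].
  by apply/forall_inP => v _; apply/forallP => w; rewrite inE implybT.
by congr ((_ == _) && _); apply: eq_card => v; rewrite !inE.
Qed.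

Lemma C_expectE n j g : (0 < n)%nat -> C_expect n j g = size_expect j n n g.
Proof.
case: n => // n _.
have tE : forall p, (p \in cayley_trees n.+1) = tree_on setT p.
  by move=> p; rewrite inE tree_on_setT.
have cE : INR #|cayley_trees n.+1| = (INR n.+1 ^ n)%R.
  rewrite -(@cayley _ n [set: 'I_n.+1]) ?cardsT ?card_ord //.
  by congr INR; apply: eq_card => p; rewrite tE inE.
rewrite /C_expect /C_pmf cE.
under eq_bigr => k _ do rewrite !big_distrr /=.
rewrite exchange_big /= (eq_bigl _ _ tE).
transitivity (/ INR n.+1 ^ n * \big[Rplus/0%R]_(p | tree_on setT p)
   cut_expect p j n.+1 [set: 'I_n.+1] g)%R.
  rewrite big_distrr; apply: eq_bigr => p _; rewrite /cut_expect big_distrr /=.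
  by apply: eq_bigr => k _; ring.
rewrite (@tree_expect _ _ _ _ n) ?cardsT ?card_ord //.
rewrite -Rmult_assoc Rinv_l ?Rmult_1_l //; exact/pow_nonzero/not_0_INR.
Qed.

Lemma size_expect_fuel j f f' m g : (m <= f.+1)%nat -> (m <= f'.+1)%nat ->
  size_expect j f m g = size_expect j f' m g.
Proof.
have H0 f0 m0 g0 : (m0 <= 1)%nat -> size_expect j f0 m0 g0 = g0 0%nat.
  by case: f0 => //= f0 ->.
elim: f f' m g => [|f IH] f' m g mf mf'; first by rewrite !H0.
case: f' mf' => [|f'] mf'; first by rewrite !H0.
rewrite /=; case: ifP => // m1; rewrite big_nat [RHS]big_nat; apply: eq_bigr => i /andP[i0 im].
by rewrite (IH f') //; lia.
Qed.

Lemma size_expect_lin j f m g h c :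
  size_expect j f m (fun k => g k + c * h k)%R =
  (size_expect j f m g + c * size_expect j f m h)%R.
Proof.
elim: f m g h => //= f IH m g h; case: ifP => // _.
rewrite big_distrr -big_split /=; apply: eq_bigr => i _.
case: ifP => _; rewrite IH; ring.
Qed.

Lemma cut_prob_ge0 m i : (0 <= cut_prob m i)%R.
Proof.
apply: Rmult_le_pos; first by do !apply: Rmult_le_pos; try apply: pow_le; apply: pos_INR.
case: (Req_dec (INR m.-1 * INR m ^ m.-1) 0) => [->|H]; first by rewrite Rinv_0; lra.
apply/Rlt_le/Rinv_0_lt_compat; have : (0 <= INR m.-1 * INR m ^ m.-1)%R; last by lra.
by apply: Rmult_le_pos; [exact: pos_INR|apply: pow_le; exact: pos_INR].
Qed.

Lemma size_expect_ge0 j f m g : (forall k, 0 <= g k)%R -> (0 <= size_expect j f m g)%R.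
Proof.
elim: f m g => //= f IH m g g0; case: ifP => // _.
apply: (big_ind (fun x => 0 <= x)%R) => [|x y|i _]; [lra|exact: Rplus_le_le_0_compat|].
apply: Rmult_le_pos; first exact: cut_prob_ge0.
by apply: IH => k; case: ifP.
Qed.

Open Scope R_scope.

(** * Convolution algebra *)

Definition conv (x y : nat -> R) (n : nat) : R := \big[Rplus/0]_(k < n.+1) (x k * y (n - k)%nat).
Definition delta (n : nat) : R := if n is 0%nat then 1 else 0.
Definition shift (j : nat) (x : nat -> R) (n : nat) : R := if (j <= n)%nat then x (n - j)%nat else 0.

Lemma Rsum_le (I : Type) (r : seq I) (P : pred I) (F G : I -> R) :
  (forall i, P i -> F i <= G i) ->
  \big[Rplus/0]_(i <- r | P i) F i <= \big[Rplus/0]_(i <- r | P i) G i.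
Proof. by move=> H; elim/big_ind2: _ => //; [lra|move=> *; lra]. Qed.

Lemma Rsum_ge0 (I : Type) (r : seq I) (P : pred I) (F : I -> R) :
  (forall i, P i -> 0 <= F i) -> 0 <= \big[Rplus/0]_(i <- r | P i) F i.
Proof. by move=> H; elim/big_ind: _ => //; [lra|move=> *; lra]. Qed.

Lemma convC x y n : conv x y n = conv y x n.
Proof.
rewrite /conv (reindex_inj rev_ord_inj) /=; apply: eq_bigr => k _.
by rewrite subSS subKn -1?ltnS // Rmult_comm.
Qed.

Lemma eq_conv x x' y y' n : (forall k, (k <= n)%nat -> x k = x' k) ->
  (forall k, (k <= n)%nat -> y k = y' k) -> conv x y n = conv x' y' n.
Proof.
move=> ex ey; apply: eq_bigr => k _; rewrite ex ?ey ?leq_subr //.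
by rewrite -ltnS.
Qed.

Lemma convA x y z n : conv (conv x y) z n = conv x (conv y z) n.
Proof.
rewrite /conv.
transitivity (\big[Rplus/0]_(0 <= k < n.+1) \big[Rplus/0]_(0 <= i < n.+1 | (i < k.+1)%nat)
   (x i * (y (k - i)%nat * z (n - k)%nat))).
  rewrite big_mkord; apply: eq_bigr => k _.
  rewrite big_distrl /= -(big_mkord xpredT (fun i => x i * y (k - i)%nat * z (n - k)%nat)).
  rewrite (big_nat_widen _ _ n.+1) //; apply: eq_bigr => i _; ring.
rewrite (exchange_big_dep xpredT) //= big_mkord; apply: eq_bigr => i _.
rewrite big_distrr /= -(big_mkord xpredT (fun k => x i * (y k * z (n - i - k)%nat))).
have -> : (n - i).+1 = (n.+1 - i)%nat by rewrite subSn // -ltnS.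
rewrite (eq_bigl (fun k => xpredT k && (i <= k)%nat)) // -(big_nat_widenl i 0) //.
rewrite -{1}[i : nat]add0n big_addn.
by apply: eq_bigr => k _; rewrite addnK -subnDA addnC.
Qed.

Lemma conv_delta x n : conv x delta n = x n.
Proof.
rewrite /conv big_ord_recr big1 /= ?subnn => [|i _]; first by rewrite /delta; ring.
by have := ltn_ord i; rewrite -subn_gt0; case: (n - i)%nat => //= *; ring.
Qed.

Lemma conv_add x y z n : conv x (fun k => y k + z k) n = conv x y n + conv x z n.
Proof. by rewrite /conv -big_split; apply: eq_bigr => k _ /=; ring. Qed.

Lemma conv_sub x y z n : conv x (fun k => y k - z k) n = conv x y n - conv x z n.
Proof.
suff : conv x (fun k => y k - z k) n + conv x z n = conv x y n by lra.
by rewrite -conv_add; apply: eq_conv => // k _; ring.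
Qed.

Lemma conv_scal c x y n : conv x (fun k => c * y k) n = c * conv x y n.
Proof. by rewrite /conv big_distrr; apply: eq_bigr => k _ /=; ring. Qed.

Lemma conv_le x y z n : (forall k, 0 <= x k) -> (forall k, (k <= n)%nat -> y k <= z k) ->
  conv x y n <= conv x z n.
Proof.
move=> x0 yz; apply: Rsum_le => k _; apply: Rmult_le_compat_l => //.
by apply: yz; exact: leq_subr.
Qed.

Lemma conv_ge0 x y n : (forall k, 0 <= x k) -> (forall k, 0 <= y k) -> 0 <= conv x y n.
Proof. by move=> x0 y0; apply: Rsum_ge0 => k _; apply: Rmult_le_pos. Qed.

Lemma conv_shift j x y n : conv x (shift j y) n = shift j (conv x y) n.
Proof.
rewrite /shift; case: leqP => jn; last first.
  by rewrite /conv big1 // => k _; rewrite leqNgt (leq_ltn_trans (leq_subr _ _)) //= Rmult_0_r.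
rewrite convC /conv.
rewrite -(big_mkord xpredT (fun k => (if (j <= k)%nat then y (k - j)%nat else 0) * x (n - k)%nat)).
rewrite (big_cat_nat (n := j)) //=; last exact: leqW.
rewrite big_nat big1 ?Rplus_0_l => [|k /andP[_ kj]]; last by rewrite leqNgt kj Rmult_0_l.
rewrite -{1}[j]add0n big_addn subSn // -/(conv x y (n - j)) convC /conv big_mkord.
by apply: eq_bigr => k _; rewrite leq_addl addnK addnC subnDA.
Qed.

Lemma shift_shift i j x n : shift i (shift j x) n = shift (i + j) x n.
Proof.
rewrite /shift; case: (leqP i n) => ni; last first.
  by rewrite leqNgt (leq_trans ni) ?leq_addr.
by rewrite leq_subRL // subnDA.
Qed.

Lemma shift_le j x y n : (forall k, x k <= y k) -> shift j x n <= shift j y n.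
Proof. by move=> H; rewrite /shift; case: ifP => //; lra. Qed.

Lemma shift_scal c j x n : shift j (fun k => c * x k) n = c * shift j x n.
Proof. by rewrite /shift; case: ifP => // _; ring. Qed.

Lemma shift_add j x y n : shift j (fun k => x k + y k) n = shift j x n + shift j y n.
Proof. by rewrite /shift; case: ifP => // _; ring. Qed.

(** The Euler operator z d/dz on coefficients, a derivation for [conv]. *)
Definition deriv (x : nat -> R) (n : nat) : R := INR n * x n.

Lemma deriv_conv x y n : deriv (conv x y) n = conv (deriv x) y n + conv x (deriv y) n.
Proof.
rewrite /deriv /conv big_distrr -big_split; apply: eq_bigr => k _ /=.
have -> : INR n = INR k + INR (n - k) by rewrite -INRD subnKC // -ltnS.
ring.
Qed.

Definition bb (n : nat) : R := INR n ^ n * exp (- INR n) / INR n`!.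
(* [theta 0 = 0] because [/ 0 = 0] *)
Definition theta (n : nat) : R := bb n / INR n.

Lemma fact_pos n : 0 < INR n`!.
Proof. by apply: lt_0_INR; apply/ltP; exact: fact_gt0. Qed.

Lemma INR_pos n : (0 < n)%nat -> 0 < INR n.
Proof. by move=> n0; apply: lt_0_INR; apply/ltP. Qed.

Lemma bb0 : bb 0 = 1.
Proof. by rewrite /bb fact0 INR0 INR1 /= Ropp_0 exp_0; field. Qed.

Lemma bb_pos n : 0 < bb n.
Proof.
case: n => [|n]; first by rewrite bb0; lra.
apply: Rdiv_lt_0_compat; last exact: fact_pos.
by apply: Rmult_lt_0_compat; [apply/pow_lt/INR_pos|exact: exp_pos].
Qed.

Lemma theta0 : theta 0 = 0.
Proof. by rewrite /theta INR0 /Rdiv Rinv_0 Rmult_0_r. Qed.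

Lemma theta_pos n : (0 < n)%nat -> 0 < theta n.
Proof. by move=> n0; apply: Rdiv_lt_0_compat; [exact: bb_pos|exact: INR_pos]. Qed.

Lemma deriv_theta n : deriv theta n = bb n - delta n.
Proof.
rewrite /deriv; case: n => [|n]; first by rewrite theta0 bb0 /=; ring.
rewrite /theta /=; field; exact: not_0_INR.
Qed.

(** The power series identity b (1 - theta) = 1. Its coefficient at n + 1 is Abel's identity at y =
    n + 1 divided by (n+1)! e^(n+1). *)
Lemma conv_bb_theta n : conv bb theta n = bb n - delta n.
Proof.
rewrite convC; case: n => [|n].
  by rewrite /conv big_ord1 theta0 bb0 /=; ring.
rewrite /conv big_ord_recl theta0 Rmult_0_l Rplus_0_l /= Rminus_0_r /bb.
rewrite -[INR n.+1 ^ n.+1]/(INR n.+1 * INR n.+1 ^ n) -abel_identity /Rdiv Rmult_assoc big_distrl /=.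
apply: eq_bigr => k _; rewrite /bump leq0n add1n subSS /theta /bb.
have kn : (k <= n)%nat by rewrite -ltnS.
have n1 : INR n.+1 = INR k.+1 + INR (n - k) by rewrite -INRD addSn subnKC.
have -> : INR n.+1 - INR k.+1 = INR (n - k) by lra.
have fE : INR n.+1`! = INR 'C(n.+1, k.+1) * (INR k.+1`! * INR (n - k)`!).
  by rewrite -!INRM -(bin_fact (m := k.+1) (n := n.+1)) // subSS.
rewrite n1 Ropp_plus_distr exp_plus fE.
have := fact_pos k.+1; have := fact_pos (n - k)%nat.
have : 0 < INR 'C(n.+1, k.+1) by apply: INR_pos; rewrite bin_gt0.
have := INR_pos (ltn0Sn k).
rewrite -[INR k.+1 ^ k.+1]/(INR k.+1 * INR k.+1 ^ k) => *; field; lra.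
Qed.

Fixpoint cc (r : nat) : nat -> R :=
  match r with O => delta | S r' => conv bb (cc r') end.

Lemma cc1 n : cc 1 n = bb n. Proof. exact: conv_delta. Qed.

Lemma cc_add r s n : conv (cc r) (cc s) n = cc (r + s) n.
Proof.
elim: r n => [|r IH] n; first by rewrite convC conv_delta.
by rewrite /= convA; apply: eq_conv.
Qed.

(* With b = 1/(1 - theta) as power series, D theta = b - 1 and D b = b^2 D theta = b^3 - b^2. *)
Lemma deriv_bb n : deriv bb n = cc 3 n - cc 2 n.
Proof.
have E k : bb k = delta k + conv bb theta k by rewrite conv_bb_theta; ring.
have D k : deriv bb k = conv (deriv bb) theta k + conv bb (fun k => bb k - delta k) k.
  rewrite {1}/deriv E Rmult_plus_distr_l -/(deriv (conv bb theta) k) deriv_conv.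
  have -> : INR k * delta k = 0 by case: k => /= *; rewrite ?INR0; ring.
  by rewrite Rplus_0_l; congr Rplus; apply: eq_conv => // i _; exact: deriv_theta.
have B : conv bb (deriv bb) n =
  conv bb (conv (deriv bb) theta) n + conv bb (conv bb (fun k => bb k - delta k)) n.
  by rewrite -conv_add; apply: eq_conv.
have e1 : conv bb (conv (deriv bb) theta) n = conv (deriv bb) bb n - deriv bb n.
  rewrite -convA (@eq_conv _ (conv (deriv bb) bb) _ theta) //; last by move=> k _; exact: convC.
  rewrite convA (@eq_conv _ (deriv bb) _ (fun k => bb k - delta k)) //; last by move=> k _; exact: conv_bb_theta.
  by rewrite conv_sub conv_delta.
have e2 : conv bb (conv bb (fun k => bb k - delta k)) n = cc 3 n - cc 2 n.
  rewrite /= -conv_sub; apply: eq_conv => // k _; rewrite -conv_sub.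
  by apply: eq_conv => // i _; rewrite conv_delta.
by move: B; rewrite e1 e2 convC; lra.
Qed.

(** Product rule: D b^r = r b^(r-1) D b = r (b^(r+2) - b^(r+1)). *)
Lemma deriv_cc r n : deriv (cc r.+1) n = INR r.+1 * (cc r.+3 n - cc r.+2 n).
Proof.
elim: r n => [|r IH] n; first by rewrite INR1 Rmult_1_l -deriv_bb /deriv cc1.
rewrite {1}[cc r.+2]/= deriv_conv.
rewrite (@eq_conv (deriv bb) (fun k => cc 3 k - cc 2 k) _ (cc r.+1)) //; last by move=> k _; exact: deriv_bb.
rewrite (@eq_conv _ bb (deriv _) (fun k => INR r.+1 * (cc r.+3 k - cc r.+2 k))) // conv_scal conv_sub.
by rewrite convC conv_sub ![conv (cc r.+1) _ n]convC !cc_add [INR r.+2]S_INR -!/(cc _.+1 n) /=; ring.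
Qed.

Lemma cc_rec r n : cc r.+3 n = INR n * cc r.+1 n / INR r.+1 + cc r.+2 n.
Proof.
have := deriv_cc r n; rewrite /deriv => ->; field.
exact: not_0_INR.
Qed.

(** * Stirling and Wallis asymptotics *)

Lemma exp_le x y : x <= y -> exp x <= exp y.
Proof. by case=> [/exp_increasing|->]; lra. Qed.

Lemma exp_ge1 x : 0 <= x -> 1 <= exp x.
Proof. by rewrite -exp_0; exact: exp_le. Qed.

Lemma exp_le1 x : x <= 0 -> exp x <= 1.
Proof. by rewrite -exp_0; exact: exp_le. Qed.

Lemma nonneg_of_derive (f df : R -> R) x :
  (forall t, 0 <= t -> is_derive f t (df t)) -> (forall t, 0 <= t -> 0 <= df t) ->
  0 <= f 0 -> 0 <= x -> 0 <= f x.
Proof.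
move=> Hd Hp f0 x0.
have [||c [[c0 _] H]] := MVT_gen f 0 x df.
- by move=> t; rewrite Rmin_left // => -[t0 _]; apply: Hd; lra.
- move=> t; rewrite Rmin_left // => -[t0 _].
  by apply/continuity_pt_filterlim/ex_derive_continuous; eexists; apply: Hd.
rewrite Rmin_left // in c0.
have := Hp _ c0; nra.
Qed.

(** At y = 1/n it says that (n + 1/2) ln(1 + 1/n) >= 1, which makes n b_n^2 increasing in
    [bb_rt_lim]. *)
Lemma ln1p_lower y : 0 <= y -> 2 * y / (2 + y) <= ln (1 + y).
Proof.
move=> y0; suff : 0 <= ln (1 + y) - 2 * y / (2 + y) by lra.
apply: (@nonneg_of_derive (fun y => ln (1 + y) - 2 * y / (2 + y))
  (fun t => t ^ 2 / ((1 + t) * (2 + t) ^ 2))) => // [t t0|t t0|].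
- by auto_derive; [lra|rewrite ?S_INR ?INR0; field; lra].
- by apply: Rmult_le_pos; [nra|apply/Rlt_le/Rinv_0_lt_compat; nra].
- by rewrite Rplus_0_r ln_1; lra.
Qed.

(** In its use at y = 1/n the terms of order 1/n cancel and the sign is decided at order 1/n^2,
    hence the cubic remainder. *)
Lemma ln1p_upper y : 0 <= y -> ln (1 + y) <= y - y ^ 2 / 2 + y ^ 3 / 3.
Proof.
move=> y0; suff : 0 <= y - y ^ 2 / 2 + y ^ 3 / 3 - ln (1 + y) by lra.
apply: (@nonneg_of_derive (fun y => y - y ^ 2 / 2 + y ^ 3 / 3 - ln (1 + y))
  (fun t => t ^ 3 / (1 + t))) => // [t t0|t t0|].
- by auto_derive; [lra|rewrite ?S_INR ?INR0; field; lra].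
- by apply: Rmult_le_pos; [apply: pow_le|apply/Rlt_le/Rinv_0_lt_compat; nra].
- by rewrite Rplus_0_r ln_1; lra.
Qed.

Lemma ln1p_le y : 0 <= y -> ln (1 + y) <= y.
Proof.
move=> y0; suff : 0 <= y - ln (1 + y) by lra.
apply: (@nonneg_of_derive (fun y => y - ln (1 + y)) (fun t => t / (1 + t))) => // [t t0|t t0|].
- by auto_derive; [lra|rewrite ?S_INR ?INR0; field; lra].
- by apply: Rmult_le_pos => //; apply/Rlt_le/Rinv_0_lt_compat; nra.
- by rewrite Rplus_0_r ln_1; lra.
Qed.

Lemma pow_exp_ln x n : 0 < x -> x ^ n = exp (INR n * ln x).
Proof. by move=> x0; rewrite -Rpower_pow. Qed.

Lemma bbS n : (0 < n)%nat -> bb n.+1 = bb n * exp (INR n * ln (1 + / INR n) - 1).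
Proof.
move=> n0; have np := INR_pos n0.
have ip : 0 < / INR n by exact: Rinv_0_lt_compat.
have E : INR n.+1 = INR n * (1 + / INR n) by rewrite S_INR; field; lra.
rewrite /Rminus exp_plus -pow_exp_ln; last by lra.
rewrite /bb factS INRM [INR n.+1 ^ n.+1]/= {2}E Rpow_mult_distr.
rewrite (_ : - INR n.+1 = - INR n + - (1)); last by rewrite S_INR; ring.
rewrite exp_plus; have := fact_pos n; have := INR_pos (ltn0Sn n) => *; field; lra.
Qed.

(** Taken at n + 1 so that it is at least 1 everywhere and may always be divided by; [rt_sqrt_lim]
    changes back to sqrt n. *)
Definition rt (n : nat) : R := sqrt (INR n.+1).

Lemma rt_sqr n : rt n ^ 2 = INR n.+1.
Proof. by rewrite /rt -Rsqr_pow2 Rsqr_sqrt //; exact: pos_INR. Qed.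

Lemma rt_ge1 n : 1 <= rt n.
Proof. by rewrite -sqrt_1; apply: sqrt_le_1_alt; rewrite S_INR; have := pos_INR n; lra. Qed.

Lemma rt_pos n : 0 < rt n. Proof. by have := rt_ge1 n; lra. Qed.

Lemma rt_le m n : (m <= n)%nat -> rt m <= rt n.
Proof. by move=> mn; apply: sqrt_le_1_alt; apply: le_INR; lia. Qed.

Lemma rt_pow_pos n s : 0 < rt n ^ s. Proof. exact/pow_lt/rt_pos. Qed.
Lemma rt_pow_ge1 n s : 1 <= rt n ^ s. Proof. exact/pow_R1_Rle/rt_ge1. Qed.
Lemma rt_pow_le m n s : (m <= n)%nat -> rt m ^ s <= rt n ^ s.
Proof. by move=> mn; apply: pow_incr; split; [exact/Rlt_le/rt_pos|exact: rt_le]. Qed.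

Lemma is_lim_seq_invS : is_lim_seq (fun n => / INR n.+1) 0.
Proof.
have -> : Finite 0 = Rbar_inv p_infty by [].
by apply: is_lim_seq_inv => //; apply/(is_lim_seq_incr_1 INR)/is_lim_seq_INR.
Qed.

Lemma rt_infty : is_lim_seq rt p_infty.
Proof.
apply: (filterlim_comp _ _ _ (fun n => INR n.+1) sqrt _ (Rbar_locally p_infty)).
  exact/(is_lim_seq_incr_1 INR)/is_lim_seq_INR.
exact: filterlim_sqrt_p.
Qed.

Lemma rt_inv_lim : is_lim_seq (fun n => / rt n) 0.
Proof.
have -> : Finite 0 = Rbar_inv p_infty by [].
by apply: is_lim_seq_inv => //; exact: rt_infty.
Qed.

Lemma is_lim_seq_bounded_abs (u : nat -> R) (l : R) :
  is_lim_seq u l -> exists2 K, 0 < K & forall n, Rabs (u n) <= K.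
Proof.
move=> /is_lim_seq_Reals ul.
by have [K [K0 HK]] := maj_by_pos u (exist _ l ul); exists K.
Qed.

(** Stirling's formula without the value of the constant: n b_n^2 increases, and the larger (n+1)
    b_n^2 decreases from n = 2 on, so the latter has a positive limit. *)
Lemma bb_rt_lim : exists2 beta, 0 < beta & is_lim_seq (fun n => bb n * rt n) beta.
Proof.
pose V n := (bb n * rt n) ^ 2.
pose U n := bb n ^ 2 * INR n.
have VE n : V n = bb n ^ 2 * INR n.+1 by rewrite /V Rpow_mult_distr rt_sqr.
have Uinc n : (0 < n)%nat -> U n <= U n.+1.
  move=> n0; have np := INR_pos n0; have ip := Rinv_0_lt_compat _ np.
  have -> : U n.+1 = U n * exp ((2 * INR n + 1) * ln (1 + / INR n) - 2).
    rewrite /U bbS // (_ : (2 * INR n + 1) * ln (1 + / INR n) - 2 =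
      (INR n * ln (1 + / INR n) - 1) + (INR n * ln (1 + / INR n) - 1) + ln (1 + / INR n)); last by ring.
    rewrite !exp_plus exp_ln; last by lra.
    rewrite S_INR; field; lra.
  rewrite -[X in X <= _]Rmult_1_r; apply: Rmult_le_compat_l.
    by apply: Rmult_le_pos; [exact: pow2_ge_0|lra].
  apply: exp_ge1.
  have := ln1p_lower (Rlt_le _ _ ip).
  rewrite (_ : 2 * / INR n / (2 + / INR n) = 2 / (2 * INR n + 1)); last by field; lra.
  move=> H; suff : (2 * INR n + 1) * (2 / (2 * INR n + 1)) <= (2 * INR n + 1) * ln (1 + / INR n).
    by rewrite (_ : (2 * INR n + 1) * (2 / (2 * INR n + 1)) = 2); [lra|field; lra].
  by apply: Rmult_le_compat_l => //; lra.
have Vdec n : (2 <= n)%nat -> V n.+1 <= V n.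
  move=> n2; have n0 : (0 < n)%nat by lia.
  have np := INR_pos n0; have ip := Rinv_0_lt_compat _ np.
  have n2' : 2 <= INR n by apply: (le_INR 2); lia.
  have -> : V n.+1 = V n * exp (2 * (INR n * ln (1 + / INR n)) - 2 + ln (1 + / (INR n + 1))).
    have i1 : 0 < / (INR n + 1) by apply: Rinv_0_lt_compat; lra.
    rewrite !VE bbS // exp_plus exp_ln; last by lra.
    rewrite (_ : 2 * (INR n * ln (1 + / INR n)) - 2 =
      (INR n * ln (1 + / INR n) - 1) + (INR n * ln (1 + / INR n) - 1)); last by ring.
    rewrite exp_plus !S_INR; field; lra.
  rewrite -[X in _ <= X]Rmult_1_r; apply: Rmult_le_compat_l; first exact: pow2_ge_0.
  apply: exp_le1.
  have H1 := ln1p_upper (Rlt_le _ _ ip).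
  have H2 : ln (1 + / (INR n + 1)) <= / (INR n + 1).
    by apply: ln1p_le; apply/Rlt_le/Rinv_0_lt_compat; lra.
  have : INR n * ln (1 + / INR n) <= INR n * (/ INR n - (/ INR n) ^ 2 / 2 + (/ INR n) ^ 3 / 3).
    by apply: Rmult_le_compat_l => //; lra.
  rewrite (_ : INR n * (/ INR n - (/ INR n) ^ 2 / 2 + (/ INR n) ^ 3 / 3) =
    1 - / INR n / 2 + (/ INR n) ^ 2 / 3); last by field; lra.
  suff : 2 * (/ INR n) ^ 2 / 3 + / (INR n + 1) <= / INR n by lra.
  have : 0 <= / INR n - / (INR n + 1) - 2 * (/ INR n) ^ 2 / 3; last by lra.
  rewrite (_ : / INR n - / (INR n + 1) - 2 * (/ INR n) ^ 2 / 3 =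
     (INR n - 2) / (3 * INR n ^ 2 * (INR n + 1))); last by field; lra.
  by apply: Rmult_le_pos; [lra|apply/Rlt_le/Rinv_0_lt_compat; nra].
have U1 : 0 < U 1%nat by rewrite /U INR1 Rmult_1_r; apply/pow_lt/bb_pos.
have UV n : U n <= V n.
  by rewrite VE; apply: Rmult_le_compat_l; [exact: pow2_ge_0|rewrite S_INR; lra].
have Vlow n : U 1%nat <= V n.+1.
  by apply: Rle_trans (UV _); elim: n => [|n IH]; [lra|have := Uinc n.+1 isT; lra].
have [L HL] : ex_finite_lim_seq (fun n => V n.+2).
  apply: (ex_finite_lim_seq_decr _ (U 1%nat)) => n.
    exact: Vdec.
  exact: Vlow.
have L0 : 0 < L.
  apply: (Rlt_le_trans _ (U 1%nat)) => //.
  apply: (is_lim_seq_le _ _ (Finite _) (Finite _) _ (is_lim_seq_const _) HL) => n.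
  exact: Vlow.
exists (sqrt L); first exact: sqrt_lt_R0.
apply: (is_lim_seq_ext (fun n => sqrt (V n))).
  move=> n; rewrite /V sqrt_pow2 //; apply: Rmult_le_pos; [exact/Rlt_le/bb_pos|exact/Rlt_le/rt_pos].
apply: is_lim_seq_continuous; first exact/continuity_pt_sqrt/Rlt_le.
by apply/is_lim_seq_incr_1/is_lim_seq_incr_1.
Qed.

Definition ww (n : nat) : R := INR (n.*2)`! / (INR n`! ^ 2 * 4 ^ n).

Lemma ww_pos n : 0 < ww n.
Proof.
apply: Rdiv_lt_0_compat; first exact: fact_pos.
by apply: Rmult_lt_0_compat; [apply/pow_lt/fact_pos|apply: pow_lt; lra].
Qed.

Lemma wwS n : INR n.+1 * ww n.+1 = (INR n + / 2) * ww n.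
Proof.
rewrite /ww doubleS !factS !INRM !S_INR -addnn INRD.
have := fact_pos n; have : 0 < 4 ^ n by apply: pow_lt; lra.
have := pos_INR n => n0 p4 fp.
rewrite [4 ^ n.+1]/=; field; lra.
Qed.

(** Powers and exponentials cancel exactly, so the asymptotics of central binomial coefficients
    follow from those of b. *)
Lemma wwE n : (0 < n)%nat -> ww n = bb n ^ 2 / bb n.*2.
Proof.
move=> n0; have np := INR_pos n0.
rewrite /ww /bb -addnn INRD !pow_add (_ : - (INR n + INR n) = - INR n + - INR n); last by ring.
rewrite exp_plus (_ : INR n + INR n = 2 * INR n); last by ring.
rewrite (Rpow_mult_distr 2 (INR n)).
have -> : 4 ^ n = 2 ^ n * 2 ^ n by rewrite -Rpow_mult_distr; congr pow; ring.
have := fact_pos n; have := fact_pos (n + n)%nat; have : 0 < 2 ^ n by apply: pow_lt; lra.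
have := exp_pos (- INR n); have : 0 < INR n ^ n by exact: pow_lt.
by move=> *; field; lra.
Qed.

(** [ww] lists the coefficients of (1 - z)^(-1/2). By [wwS] its convolution square u satisfies (n+1)
    u_(n+1) = n u_n + u_n, hence is constant. *)
Lemma conv_ww n : conv ww ww n = 1.
Proof.
elim: n => [|n IH].
  by rewrite /conv big_ord1 /ww double0 fact0 INR1 /=; field.
have np := INR_pos (ltn0Sn n).
have D : deriv (conv ww ww) n.+1 = 2 * conv (deriv ww) ww n.+1.
  by rewrite deriv_conv [conv ww (deriv ww) _]convC; ring.
have E : conv (deriv ww) ww n.+1 = conv (fun k => (INR k + / 2) * ww k) ww n.
  rewrite /conv big_ord_recl {1}/deriv INR0 Rmult_0_l Rmult_0_l Rplus_0_l.
  by apply: eq_bigr => k _; rewrite lift0 subSS /deriv wwS.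
have E2 : conv (fun k => (INR k + / 2) * ww k) ww n =
    conv (deriv ww) ww n + / 2 * conv ww ww n.
  rewrite !(convC _ ww) -conv_scal -conv_add; apply: eq_conv => // k _.
  by rewrite /deriv; ring.
have D2 : INR n * conv ww ww n = 2 * conv (deriv ww) ww n.
  by rewrite -/(deriv (conv ww ww) n) deriv_conv [conv ww (deriv ww) _]convC; ring.
move: D; rewrite E E2 {1}/deriv IH => D; move: D2; rewrite IH => D2.
by apply: (Rmult_eq_reg_l (INR n.+1)); [rewrite D S_INR; lra|lra].
Qed.

Lemma is_lim_seq_big (I : Type) (r : seq I) (F : I -> nat -> R) (l : I -> R) :
  (forall i, is_lim_seq (F i) (l i)) ->
  is_lim_seq (fun n => \big[Rplus/0]_(i <- r) F i n) (\big[Rplus/0]_(i <- r) l i).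
Proof.
move=> H; elim: r => [|i r IH].
  rewrite big_nil; apply: is_lim_seq_ext (is_lim_seq_const 0) => n.
  by rewrite big_nil.
rewrite big_cons; apply: is_lim_seq_ext (is_lim_seq_plus' _ _ _ _ (H i) IH) => n.
by rewrite big_cons.
Qed.

(* The terms with k < N vanish in the limit because g does; in the remaining ones h is small. *)
Lemma conv_small (f g h G : nat -> R) M :
  (forall k, 0 <= f k) -> (forall k, 0 <= g k) -> (forall k, 1 <= G k) ->
  is_lim_seq h 0 -> is_lim_seq g 0 -> (forall n, conv f g n <= M * G n) ->
  is_lim_seq (fun n => conv (fun k => h k * f k) g n / G n) 0.
Proof.
move=> f0 g0 G1 h0 gl HM; apply/is_lim_seq_spec => eps.
have M0 : 0 <= M.
  have := HM 0%nat; have := G1 0%nat; have := @conv_ge0 f g 0 f0 g0; nra.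
have e1 : 0 < eps / (2 * (M + 1)).
  by apply: Rdiv_lt_0_compat; [exact: cond_pos|lra].
move/is_lim_seq_spec: (h0) => /(_ (mkposreal _ e1)) [N HN].
have L : is_lim_seq (fun n => \big[Rplus/0]_(k <- seq.iota 0 N) (Rabs (h k) * f k * g (n - k)%nat)) 0.
  have -> : Finite 0 = \big[Rplus/0%R]_(k <- seq.iota 0 N) 0%R by rewrite big1.
  apply: is_lim_seq_big => k.
  have -> : Finite 0 = Rabs (h k) * f k * 0 by rewrite Rmult_0_r.
  apply: is_lim_seq_mult'; first exact: is_lim_seq_const.
  apply/(is_lim_seq_incr_n _ k); apply: is_lim_seq_ext gl => n.
  by rewrite (_ : ((n + k)%coq_nat - k)%nat = n) //; lia.
have e2 : 0 < eps / 2 by have := cond_pos eps; lra.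
move/is_lim_seq_spec: L => /(_ (mkposreal _ e2)) [N' HN'].
exists (maxn N N') => n /leP nN; rewrite Rminus_0_r Rabs_div; last by have := G1 n; lra.
rewrite (Rabs_pos_eq (G n)); last by have := G1 n; lra.
have Gn := G1 n.
apply: (Rmult_lt_reg_r (G n)); first by lra.
rewrite /Rdiv Rmult_assoc Rinv_l ?Rmult_1_r; last by lra.
have A : Rabs (conv (fun k => h k * f k) g n) <= conv (fun k => Rabs (h k) * f k) g n.
  apply: Rle_trans (_ : \big[Rplus/0]_(k < n.+1) Rabs (h k * f k * g (n - k)%nat) <= _).
    rewrite /conv; elim/big_ind2: _ => [|a b c d H1 H2|k _]; [rewrite Rabs_R0; lra| |lra].
    by move=> /=; have := Rabs_triang b d; lra.
  by apply: Rsum_le => k _; rewrite !Rabs_mult (Rabs_pos_eq (f k)) // (Rabs_pos_eq (g _)) //; lra.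
apply: Rle_lt_trans A _.
have nN1 : (N <= n.+1)%nat by lia.
have B : conv (fun k => Rabs (h k) * f k) g n <=
   \big[Rplus/0]_(k <- seq.iota 0 N) (Rabs (h k) * f k * g (n - k)%nat) + eps / (2 * (M + 1)) * conv f g n.
  rewrite /conv -(big_mkord xpredT (fun k => Rabs (h k) * f k * g (n - k)%nat)).
  rewrite (big_cat_nat (n := N)) //=; apply: Rplus_le_compat.
    by rewrite /index_iota subn0; lra.
  rewrite big_distrr /= -(big_mkord xpredT (fun k => eps / (2 * (M + 1)) * (f k * g (n - k)%nat))).
  rewrite [X in _ <= X](big_cat_nat (n := N)) //=.
  rewrite -[X in X <= _]Rplus_0_l; apply: Rplus_le_compat.
    by apply: Rsum_ge0 => k _; apply: Rmult_le_pos; [lra|apply: Rmult_le_pos].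
  rewrite big_nat [X in _ <= X]big_nat; apply: Rsum_le => k /andP[Nk _].
  rewrite Rmult_assoc; apply: Rmult_le_compat_r; first exact: Rmult_le_pos.
  by have := HN k ltac:(lia); rewrite Rminus_0_r /=; lra.
have C : \big[Rplus/0]_(k <- seq.iota 0 N) (Rabs (h k) * f k * g (n - k)%nat) < eps / 2.
  have := HN' n ltac:(lia); rewrite Rminus_0_r /=; apply: Rle_lt_trans.
  exact: Rle_abs.
have D : eps / (2 * (M + 1)) * conv f g n <= eps / 2 * G n.
  apply: Rle_trans (_ : eps / (2 * (M + 1)) * (M * G n) <= _).
    by apply: Rmult_le_compat_l => //; lra.
  rewrite (_ : eps / 2 * G n = eps / (2 * (M + 1)) * ((M + 1) * G n)); last by field; lra.
  by apply: Rmult_le_compat_l; [lra|apply: Rmult_le_compat_r; lra].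
by have := cond_pos eps; nra.
Qed.

(** * Convolution powers and a renewal inequality *)

(** The Rayleigh moments, with the first one left as a parameter. *)
Fixpoint rmom (m1 : R) (s : nat) : R :=
  match s with
  | O => 1
  | S O => m1
  | S (S t) => INR t.+2 * rmom m1 t
  end.

Lemma nat_ind2 (P : nat -> Prop) :
  P 0%nat -> P 1%nat -> (forall s, P s -> P s.+1 -> P s.+2) -> forall s, P s.
Proof.
move=> P0 P1 PS s; suff : P s /\ P s.+1 by case.
by elim: s => [|s [H1 H2]]; split=> //; apply: PS.
Qed.

Lemma rmom_pos m1 s : 0 < m1 -> 0 < rmom m1 s.
Proof.
move=> m0; elim/nat_ind2: s => [|//|s H _] /=; first lra.
exact/Rmult_lt_0_compat/H/INR_pos.
Qed.

Lemma is_lim_seq_lower (u : nat -> R) (l : R) : (forall n, 0 < u n) -> 0 < l ->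
  is_lim_seq u l -> exists2 k, 0 < k & forall n, k <= u n.
Proof.
move=> u0 l0 ul.
have : is_lim_seq (fun n => / u n) (Finite (/ l)).
  by apply: (is_lim_seq_inv _ (Finite l)) => // -[]; lra.
move=> /is_lim_seq_bounded_abs [K K0 HK]; exists (/ K); first exact: Rinv_0_lt_compat.
move=> n; rewrite -(Rinv_inv (u n)); apply: Rinv_le_contravar; first exact/Rinv_0_lt_compat.
by apply: Rle_trans (HK n); exact: Rle_abs.
Qed.

Section BbLimits.
Variable beta : R.
Hypothesis beta0 : 0 < beta.
Hypothesis Hb : is_lim_seq (fun n => bb n * rt n) beta.

Lemma bb_rt_pos n : 0 < bb n * rt n.
Proof. by apply: Rmult_lt_0_compat; [exact: bb_pos|exact: rt_pos]. Qed.

Lemma bb_upper : exists2 K, 0 < K & forall n, bb n <= K / rt n.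
Proof.
have [K K0 HK] := is_lim_seq_bounded_abs Hb; exists K => // n.
have rn := rt_pos n; apply: (Rmult_le_reg_r (rt n)) => //.
rewrite /Rdiv Rmult_assoc Rinv_l ?Rmult_1_r; last by lra.
by apply: Rle_trans (HK n); exact: Rle_abs.
Qed.

Lemma bb_lower : exists2 k, 0 < k & forall n, k / rt n <= bb n.
Proof.
have [k k0 Hk] := is_lim_seq_lower bb_rt_pos beta0 Hb; exists k => // n.
have rn := rt_pos n; apply: (Rmult_le_reg_r (rt n)) => //.
by rewrite /Rdiv Rmult_assoc Rinv_l ?Rmult_1_r //; lra.
Qed.

Lemma bb_lim0 : is_lim_seq bb 0.
Proof.
have -> : Finite 0 = beta * 0 by rewrite Rmult_0_r.
apply: is_lim_seq_ext (is_lim_seq_mult' _ _ _ _ Hb rt_inv_lim) => n.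
by have := rt_pos n => *; field; lra.
Qed.

Lemma ww_rt_lim : is_lim_seq (fun n => ww n * rt n) (sqrt 2 * beta).
Proof.
have bn0 : beta <> 0 by lra.
have Hb2 : is_lim_seq (fun n => bb n.*2 * rt n.*2) beta.
  apply: (is_lim_seq_subseq _ _ (fun n => n.*2)) Hb.
  by move=> P [N HN]; exists N => n Nn; apply: HN; lia.
have Hr : is_lim_seq (fun n => rt n.*2 / rt n) (sqrt 2).
  apply: (is_lim_seq_ext (fun n => sqrt (2 - / INR n.+1))).
    move=> n; rewrite /rt -sqrt_div_alt; last exact: INR_pos.
    congr sqrt; rewrite !S_INR -addnn INRD; field.
    by have := pos_INR n; lra.
  have E : 2 = 2 - 0 by ring.
  rewrite {2}E; apply: is_lim_seq_continuous; first by apply: continuity_pt_sqrt; lra.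
  apply: is_lim_seq_minus'; [exact: is_lim_seq_const|exact: is_lim_seq_invS].
have -> : Finite (sqrt 2 * beta) = beta * beta / beta * sqrt 2 by congr Finite; field.
have H := is_lim_seq_mult' _ _ _ _ (is_lim_seq_div' _ _ _ _ (is_lim_seq_mult' _ _ _ _ Hb Hb) Hb2 bn0) Hr.
apply: is_lim_seq_ext_loc H; exists 1%nat => n /leP n1.
rewrite wwE //; have := bb_pos n.*2; have := rt_pos n; have := rt_pos n.*2 => *.
field; lra.
Qed.

Lemma bb_ww_lim : is_lim_seq (fun n => bb n / ww n) (/ sqrt 2).
Proof.
have s2 : 0 < sqrt 2 by apply: sqrt_lt_R0; lra.
have -> : Finite (/ sqrt 2) = beta / (sqrt 2 * beta) by congr Finite; field; lra.
have N0 : sqrt 2 * beta <> 0 by nra.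
apply: is_lim_seq_ext (is_lim_seq_div' _ _ _ _ Hb ww_rt_lim N0) => n.
by have := rt_pos n; have := ww_pos n => *; field; lra.
Qed.

(** b_n is close to q w_n with q = 1 / sqrt 2, and w * w = 1, so b * b tends to q^2. Writing b = h w
    + q w with h -> 0 in each factor, [conv_small] removes the terms with h. *)
Lemma cc2_lim : is_lim_seq (cc 2) (/ 2).
Proof.
pose q := / sqrt 2.
have qq : q * q = / 2 by rewrite /q -Rinv_mult sqrt_sqrt //; lra.
pose h n := bb n / ww n - q.
have hl : is_lim_seq h 0.
  rewrite (_ : Finite 0 = q - q); last by congr Finite; ring.
  by apply: is_lim_seq_minus'; [exact: bb_ww_lim|exact: is_lim_seq_const].
have bE n : bb n = h n * ww n + q * ww n.
  by rewrite /h; have := ww_pos n => *; field; lra.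
have [K K0 HK] := is_lim_seq_bounded_abs bb_ww_lim.
have bK n : bb n <= K * ww n.
  have wp := ww_pos n; have := HK n.
  rewrite Rabs_pos_eq => [H|]; last by apply/Rlt_le/Rdiv_lt_0_compat => //; exact: bb_pos.
  by rewrite (_ : bb n = bb n / ww n * ww n); [apply: Rmult_le_compat_r; lra|field; lra].
have w0 k : 0 <= ww k by exact/Rlt_le/ww_pos.
have b0 k : 0 <= bb k by exact/Rlt_le/bb_pos.
have wl : is_lim_seq ww 0.
  have -> : Finite 0 = sqrt 2 * beta * 0 by rewrite Rmult_0_r.
  apply: is_lim_seq_ext (is_lim_seq_mult' _ _ _ _ ww_rt_lim rt_inv_lim) => n.
  by have := rt_pos n => *; field; lra.
have H1 : is_lim_seq (fun n => conv (fun k => h k * ww k) bb n / 1) 0.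
  apply: (@conv_small ww bb h (fun _ => 1) K) => //; first by move=> *; lra.
    exact: bb_lim0.
  move=> n; rewrite -(conv_ww n) -conv_scal; apply: conv_le => // k _; exact: bK.
have H2 : is_lim_seq (fun n => conv (fun k => h k * ww k) ww n / 1) 0.
  apply: (@conv_small ww ww h (fun _ => 1) 1) => //; first by move=> *; lra.
  move=> n; rewrite conv_ww; lra.
have -> : Finite (/ 2) = 0 + q * (0 + q * 1) by congr Finite; rewrite -qq; ring.
have H3 := is_lim_seq_plus' _ _ _ _ H1 (is_lim_seq_mult' _ _ _ _ (is_lim_seq_const q)
  (is_lim_seq_plus' _ _ _ _ H2 (is_lim_seq_const (q * 1)))).
apply: is_lim_seq_ext H3 => n; rewrite /Rdiv Rinv_1 !Rmult_1_r.
have -> : cc 2 n = conv bb bb n by apply: eq_conv => // k _; exact: cc1.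
have E y : conv y bb n = conv y (fun k => h k * ww k) n + q * conv y ww n.
  by rewrite -conv_scal -conv_add; apply: eq_conv.
rewrite (E bb) (convC bb ww) (E ww) conv_ww (convC bb) (convC ww); ring.
Qed.

Let m1 := / (2 * beta).

(** On this scale [cc_rec] turns into M_(s+2) = (s+2) M_s, its second term being smaller by a factor
    [rt n]. The start s = 0 is the limit beta; the start s = 1 is the limit 1/2 of c_2 = beta m1,
    which dictates the local value of [m1]. *)
Lemma cc_lim s :
  is_lim_seq (fun n => cc s.+1 n * rt n / rt n ^ s) (beta * rmom m1 s / INR s`!).
Proof.
elim/nat_ind2: s => [||s H1 H2].
- rewrite fact0 INR1 /= (_ : beta * 1 / 1 = beta); last by field.
  apply: is_lim_seq_ext Hb => n; rewrite -[conv bb delta n]/(cc 1 n) cc1; field.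
- rewrite (_ : 1`! = 1%nat) // INR1 (_ : beta * rmom m1 1 / 1 = / 2); last by rewrite /= /m1; field; lra.
  apply: is_lim_seq_ext cc2_lim => n.
  by have := rt_pos n => *; rewrite pow_1; field; lra.
have ni : is_lim_seq (fun n => 1 - / INR n.+1) (1 - 0).
  by apply: is_lim_seq_minus'; [exact: is_lim_seq_const|exact: is_lim_seq_invS].
have s1 : INR s.+1 <> 0 by exact: not_0_INR.
have s2 : INR s.+2 <> 0 by exact: not_0_INR.
have -> : Finite (beta * rmom m1 s.+2 / INR s.+2`!) =
   (1 - 0) * (beta * rmom m1 s / INR s`!) * / INR s.+1 + (beta * rmom m1 s.+1 / INR s.+1`!) * 0.
  congr Finite; rewrite !factS !INRM -[rmom m1 s.+2]/(INR s.+2 * rmom m1 s).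
  by field; have := fact_pos s; lra.
have H := is_lim_seq_plus' _ _ _ _ (is_lim_seq_mult' _ _ _ _ (is_lim_seq_mult' _ _ _ _ ni H1)
  (is_lim_seq_const (/ INR s.+1))) (is_lim_seq_mult' _ _ _ _ H2 rt_inv_lim).
apply: is_lim_seq_ext H => n; rewrite cc_rec.
have -> : rt n ^ s.+2 = INR n.+1 * rt n ^ s by rewrite -rt_sqr /=; ring.
have -> : INR n.+1 = INR n + 1 by rewrite S_INR.
have E : rt n * rt n = INR n + 1 by rewrite -S_INR -rt_sqr /=; ring.
have rn := rt_pos n; have rs := rt_pow_pos n s; have n0 := pos_INR n.
rewrite [rt n ^ s.+1]/= -E; have -> : INR n = rt n * rt n - 1 by lra.
field; lra.
Qed.

Lemma cc_upper s : exists2 K, 0 < K & forall n, cc s.+1 n <= K * (rt n ^ s / rt n).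
Proof.
have [K K0 HK] := is_lim_seq_bounded_abs (@cc_lim s); exists K => // n.
have rn := rt_pos n; have rs := rt_pow_pos n s.
have := Rle_trans _ _ _ (Rle_abs _) (HK n) => H.
rewrite (_ : cc s.+1 n = cc s.+1 n * rt n / rt n ^ s * (rt n ^ s / rt n)); last by field; lra.
by apply: Rmult_le_compat_r => //; apply/Rlt_le/Rdiv_lt_0_compat.
Qed.

Lemma conv_bb1_upper : exists2 K, 0 < K & forall n, conv bb (fun _ => 1) n <= K * rt n.
Proof.
have [K K0 HK] := bb_upper; exists (2 * K); first lra.
move=> n; have -> : conv bb (fun _ => 1) n = \big[Rplus/0]_(0 <= k < n.+1) bb k.
  by rewrite big_mkord; apply: eq_bigr => k _; rewrite Rmult_1_r.
elim: n => [|n IH].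
  by rewrite big_nat1; have := HK 0%nat; rewrite /rt INR1 sqrt_1; lra.
rewrite big_nat_recr //=.
have rn := rt_pos n; have rn1 := rt_pos n.+1.
have E : rt n.+1 ^ 2 = rt n ^ 2 + 1 by rewrite !rt_sqr S_INR.
(* With a = [rt n.+1], b = [rt n] and a^2 = b^2 + 1 this is (a - b)^2 >= 0; it makes the sum
   telescope. *)
suff : / rt n.+1 <= 2 * rt n.+1 - 2 * rt n by have := HK n.+1; rewrite /Rdiv; nra.
apply: (Rmult_le_reg_l (rt n.+1)) => //; rewrite Rinv_r; last by lra.
by have := pow2_ge_0 (rt n.+1 - rt n); nra.
Qed.

(** For s = 0 the second factor is 1 / rt, at most a constant times b, and the bounded c_2 takes
    over. For s > 0 the factor rt^(s-1) is monotone and leaves the sum. *)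
Lemma conv_bb_pow s :
  exists2 K, 0 < K & forall n, conv bb (fun k => rt k ^ s / rt k) n <= K * rt n ^ s.
Proof.
have b0 k : 0 <= bb k by exact/Rlt_le/bb_pos.
case: s => [|s].
  have [k k0 Hk] := bb_lower; have [K K0 HK] := cc_upper 1.
  exists (/ k * K); first exact/Rmult_lt_0_compat/K0/Rinv_0_lt_compat.
  move=> n; apply: Rle_trans (_ : / k * cc 2 n <= _); last first.
    have ik := Rinv_0_lt_compat _ k0.
    have := HK n; rewrite pow_1 /= Rmult_1_r /Rdiv Rinv_r ?Rmult_1_r; last by have := rt_pos n; lra.
    by move=> H; apply: Rmult_le_compat_l; lra.
  rewrite -conv_scal; apply: conv_le => // i _.
  rewrite -[conv bb delta i]/(cc 1 i) cc1 -[X in X <= _]Rmult_1_l.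
  rewrite -{1}(Rinv_l k); last by lra.
  rewrite Rmult_assoc; apply: Rmult_le_compat_l; first exact/Rlt_le/Rinv_0_lt_compat.
  by have := Hk i; rewrite /= /Rdiv Rmult_1_l.
have [K K0 HK] := conv_bb1_upper; exists K => // n.
apply: Rle_trans (_ : rt n ^ s * conv bb (fun _ => 1) n <= _).
  rewrite -conv_scal; apply: conv_le => // i im.
  have ri := rt_pos i; rewrite (_ : rt i ^ s.+1 / rt i = rt i ^ s); last by rewrite /=; field; lra.
  by rewrite Rmult_1_r; exact: rt_pow_le.
rewrite /= (_ : K * (rt n * rt n ^ s) = rt n ^ s * (K * rt n)); last by ring.
by apply: Rmult_le_compat_l => //; exact/Rlt_le/rt_pow_pos.
Qed.

(** 1/m = h_m b_m with h_m of order 1 / sqrt m, so the convolution is the bounded b * b with one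
    factor damped by a null sequence. *)
Lemma conv_bb_inv : is_lim_seq (conv bb (fun m => / INR m)) 0.
Proof.
have b0 k : 0 <= bb k by exact/Rlt_le/bb_pos.
have [K K0 HK] := cc_upper 1; have [k k0 Hk] := bb_lower.
pose h m := / (INR m * bb m).
have hl : is_lim_seq h 0.
  apply: (is_lim_seq_le_le (fun _ => 0) _ (fun m => 2 / k * / rt m)).
  - move=> m; have rm := rt_pos m; have ik := Rinv_0_lt_compat _ k0.
    have irm := Rinv_0_lt_compat _ rm.
    case: m rm irm => [|m] rm irm; rewrite /h.
      by rewrite INR0 Rmult_0_l Rinv_0; split; [lra|apply: Rmult_le_pos; nra].
    have mp := INR_pos (ltn0Sn m); have bp := bb_pos m.+1.
    have mb : 0 < INR m.+1 * bb m.+1 by exact: Rmult_lt_0_compat.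
    split; first exact/Rlt_le/Rinv_0_lt_compat.
    rewrite (_ : 2 / k * / rt m.+1 = / (k / 2 * rt m.+1)); last by field; lra.
    apply: Rinv_le_contravar; first by nra.
    apply: Rle_trans (_ : INR m.+1 * (k / rt m.+1) <= _); last first.
      by apply: Rmult_le_compat_l; [lra|exact: Hk].
    have E := rt_sqr m.+1.
    have E2 : INR m.+1 = rt m.+1 ^ 2 - 1 by rewrite E [INR m.+2]S_INR; ring.
    have r2 : 2 <= rt m.+1 ^ 2 by rewrite E S_INR S_INR; have := pos_INR m; lra.
    apply: (Rmult_le_reg_r (rt m.+1)) => //.
    rewrite (_ : INR m.+1 * (k / rt m.+1) * rt m.+1 = INR m.+1 * k); last by field; lra.
    by rewrite E2; nra.
  - exact: is_lim_seq_const.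
  rewrite (_ : Finite 0 = 2 / k * 0); last by congr Finite; ring.
  by apply: is_lim_seq_mult'; [exact: is_lim_seq_const|exact: rt_inv_lim].
have := @conv_small bb bb h (fun _ => 1) K b0 b0 (fun _ => Rle_refl 1) hl bb_lim0.
have cK n : conv bb bb n <= K * 1.
  have := HK n; rewrite pow_1 /Rdiv Rinv_r; last by have := rt_pos n; lra.
  by rewrite (_ : cc 2 n = conv bb bb n) //; apply: eq_conv => // i _; exact: cc1.
move=> /(_ cK); apply: is_lim_seq_ext => n.
rewrite /Rdiv Rinv_1 Rmult_1_r convC; apply: eq_conv => // i _.
rewrite /h; case: i => [|i]; first by rewrite INR0 Rmult_0_l Rinv_0; ring.
by have := bb_pos i.+1; have := INR_pos (ltn0Sn i) => *; field; lra.
Qed.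

(** The diagonal term of the convolution is x n / n. From n = 2 on it is at most x n / 2 and can be
    absorbed; at n = 1 it is x 1 itself and bounds nothing, hence the prescribed initial values. *)
Definition renewal_ineq (x g : nat -> R) :=
  [/\ forall n, 0 <= x n, forall n, 0 <= g n, forall m n, (m <= n)%nat -> g m <= g n,
      x 0%nat = 0 /\ x 1%nat = 0 &
      forall n, x n <= conv bb (fun m => x m / INR m) n + g n].

(* The kernel bb_(n-m) / m has row sums tending to 0, so for large n it is absorbed
   by the left-hand side; the finitely many small n only enlarge the constant. *)
Lemma renewal_bound :
  exists2 K, 0 < K & forall x g, renewal_ineq x g -> forall n, x n <= K * g n.
Proof.
have b0 k : 0 <= bb k by exact/Rlt_le/bb_pos.
pose e := conv bb (fun m => / INR m).
have [E E0 HE] := is_lim_seq_bounded_abs conv_bb_inv.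
(* A constant K valid below n yields 2 (K e_n + 1) at n; the factor 2 pays for absorbing the
   diagonal term. *)
have step x g K n : renewal_ineq x g -> 0 <= K ->
    (forall m, (m < n)%nat -> x m <= K * g m) -> x n <= 2 * (K * e n + 1) * g n.
  move=> [x0 g0 gm [x00 x1] H] K0 IH.
  have e0 : 0 <= e n.
    apply: conv_ge0 => // k; case: k => [|k]; first by rewrite INR0 Rinv_0; lra.
    exact/Rlt_le/Rinv_0_lt_compat/INR_pos.
  have r0 : 0 <= 2 * (K * e n + 1) * g n.
    by have H1 := Rmult_le_pos _ _ K0 e0; apply: Rmult_le_pos => //; lra.
  case: n IH e0 r0 => [|[|n]] IH e0 r0; [by rewrite x00|by rewrite x1|].
  set N := n.+2 in IH e0 r0 *.
  have Hc : conv bb (fun m => x m / INR m) N <= K * g N * e N + x N / INR N.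
    rewrite /e -conv_scal !(convC bb) /conv big_ord_recr [X in _ <= X + _]big_ord_recr /=.
    rewrite subnn bb0 !Rmult_1_r; apply: Rplus_le_compat; last by lra.
    rewrite -[X in X <= _]Rplus_0_r; apply: Rplus_le_compat; last first.
      apply: Rmult_le_pos; first by apply: Rmult_le_pos.
      exact/Rlt_le/Rinv_0_lt_compat/INR_pos.
    apply: Rsum_le => i _; apply: Rmult_le_compat_r => //.
    case: (posnP i) => [->|i0]; first by rewrite INR0 /Rdiv Rinv_0; lra.
    apply: Rmult_le_compat_r; first exact/Rlt_le/Rinv_0_lt_compat/INR_pos.
    apply: Rle_trans (IH i (ltn_ord i)) _; apply: Rmult_le_compat_l => //.
    exact/gm/ltnW.
  have N2 : / INR N <= / 2.
    apply: Rinv_le_contravar; first lra.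
    by rewrite /N !S_INR; have := pos_INR n; lra.
  have := H N; have := x0 N; have := g0 N; rewrite /Rdiv in Hc.
  nra.
have small N : exists2 K, 0 < K & forall x g, renewal_ineq x g -> forall n, (n <= N)%nat -> x n <= K * g n.
  elim: N => [|N [K K0 IH]].
    exists 1; first lra; move=> x g [x0 g0 _ [x00 _] _] [] // _; rewrite x00.
    by have := g0 0%nat; lra.
  exists (K + 2 * (K * E + 1)); first by nra.
  move=> x g Hx n; have [x0 g0 _ _ _] := Hx; have gn := g0 n.
  have KE := Rmult_lt_0_compat _ _ K0 E0.
  have Kg : 0 <= K * g n by apply: Rmult_le_pos; lra.
  have p : 0 <= 2 * (K * E + 1) * g n by apply: Rmult_le_pos; lra.
  rewrite leq_eqVlt ltnS => /orP[/eqP nN|nN]; last first.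
    by have := IH x g Hx n nN; lra.
  have IH' m : (m < n)%nat -> x m <= K * g m by rewrite nN ltnS; exact: IH.
  have := step x g K n Hx (Rlt_le _ _ K0) IH'.
  have := Rle_trans _ _ _ (Rle_abs _) (HE n); rewrite -/(e n) => en.
  have : 0 <= K * g n * (E - e n) by apply: Rmult_le_pos; lra.
  lra.
(* Once e_n < 1/4, the new constant 2 ((K + 4) / 4 + 1) = K / 2 + 4 does not exceed K + 4, so K + 4
   reproduces itself. *)
move/is_lim_seq_spec: conv_bb_inv => /(_ (mkposreal _ (ltac:(lra) : 0 < / 4))) [N HN].
have [K K0 HK] := small N; exists (K + 4); first lra.
move=> x g Hx; have [x0 g0 _ _ _] := Hx.
elim/ltn_ind=> n IH; case: (leqP n N) => [/(HK _ _ Hx)|Nn].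
  by have := g0 n; lra.
have := step x g (K + 4) n Hx ltac:(lra) IH.
have := HN n ltac:(lia); rewrite Rminus_0_r => /(Rle_lt_trans _ _ _ (Rle_abs _)) /= en.
have gn := g0 n; rewrite -/(e n) in en.
have : 0 <= (K + 4) * g n * (/ 4 - e n) by apply: Rmult_le_pos; [apply: Rmult_le_pos|]; lra.
have : 0 <= K * g n by apply: Rmult_le_pos; lra.
lra.
Qed.
End BbLimits.

(** * Asymptotics of the factorial moments *)

Lemma ffact_pow_nat k s : ffact (INR k) s = INR (k ^_ s).
Proof.
elim: s => [|s IH] /=; first by rewrite ffactn0.
rewrite IH ffactnSr INRM; case: (leqP s k) => sk; first by rewrite -minus_INR //; lia.
by rewrite ffact_small // INR0; ring.
Qed.

Lemma ffact_ge0 k s : 0 <= ffact (INR k) s.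
Proof. by rewrite ffact_pow_nat; exact: pos_INR. Qed.

Lemma ffact_succl x s : ffact (x + 1) s.+1 = (x + 1) * ffact x s.
Proof.
elim: s => [|s IH]; first by rewrite /= INR0; ring.
rewrite -[LHS]/(ffact (x + 1) s.+1 * (x + 1 - INR s.+1)) IH -[ffact x s.+1]/(ffact x s * (x - INR s)).
rewrite S_INR; ring.
Qed.

Lemma ffact_succ k s :
  ffact (INR k.+1) s.+1 = ffact (INR k) s.+1 + INR s.+1 * ffact (INR k) s.
Proof. by rewrite !S_INR ffact_succl /=; ring. Qed.

Definition fmom (j s m : nat) : R := size_expect j m m (fun k => ffact (INR k) s).
(** The value 0 at m = 0 restricts [conv theta] to genuine cuts 1 <= i < m; it is the origin of the
    [delta] in [aseq0]. *)
Definition aseq (j s m : nat) : R := if m is 0%nat then 0 else bb m * fmom j s m.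

Lemma aseq_ge0 j s m : 0 <= aseq j s m.
Proof.
case: m => [|m] /=; first lra.
apply: Rmult_le_pos; first exact/Rlt_le/bb_pos.
by apply: size_expect_ge0 => k; exact: ffact_ge0.
Qed.

(** Under the weight b_m the splitting law becomes a convolution kernel. The remaining factor m /
    (m-1), due to the m - 1 edges, is the source of the term a_s / m. *)
Lemma cut_prob_bb m i : (0 < i < m)%nat ->
  bb m * cut_prob m i = INR m / INR m.-1 * (theta i * bb (m - i)).
Proof.
move=> /andP[i0 im]; rewrite /cut_prob /theta /bb.
have fE : INR m`! = INR 'C(m, i) * (INR i`! * INR (m - i)`!).
  by rewrite -!INRM bin_fact // ltnW.
have mE : INR m = INR i + INR (m - i) by rewrite -INRD subnKC // ltnW.
have -> : INR m ^ m = INR m * INR m ^ m.-1 by case: m im {fE mE}.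
have -> : INR i ^ i = INR i * INR i ^ i.-1 by case: i i0 {im fE mE}.
have -> : exp (- INR m) = exp (- INR i) * exp (- INR (m - i)).
  by rewrite -exp_plus mE; congr exp; ring.
rewrite fE; have := fact_pos i; have := fact_pos (m - i)%nat.
have : 0 < INR 'C(m, i) by apply: INR_pos; rewrite bin_gt0 ltnW.
have := INR_pos i0; have : 0 < INR m.-1 by apply: INR_pos; lia.
have m0 : 0 < INR m by apply: INR_pos; lia.
have : 0 < INR m ^ m.-1 by exact: pow_lt.
by move=> *; field; lra.
Qed.

Lemma conv_theta_split x m : (0 < m)%nat -> x 0%nat = 0 ->
  conv theta x m = \big[Rplus/0]_(1 <= i < m) (theta i * x (m - i)%nat).
Proof.
move=> m0 x0; rewrite /conv -(big_mkord xpredT (fun k => theta k * x (m - k)%nat)).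
rewrite big_nat_recr //= subnn x0 Rmult_0_r Rplus_0_r big_ltn // theta0.
by rewrite Rmult_0_l Rplus_0_l.
Qed.

Lemma sum_cut_prob m : (1 < m)%nat -> \big[Rplus/0]_(1 <= i < m) cut_prob m i = 1.
Proof.
move=> m1; have m0 : (0 < m)%nat by lia.
have mp : 0 < INR m by exact: INR_pos.
have mp1 : 0 < INR m.-1 by apply: INR_pos; lia.
have mE : INR m = INR m.-1 + 1 by rewrite -S_INR prednK.
have bp := bb_pos m.
have H : bb m * \big[Rplus/0]_(1 <= i < m) cut_prob m i =
    INR m / INR m.-1 * \big[Rplus/0]_(1 <= i < m) (theta i * (bb (m - i) - delta (m - i))).
  rewrite !big_distrr big_nat [RHS]big_nat; apply: eq_bigr => i im /=.
  rewrite cut_prob_bb //; have : (0 < m - i)%nat by lia.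
  by case: (m - i)%nat => //= k _; ring.
have C : conv theta (fun k => bb k - delta k) m = bb m - theta m.
  rewrite conv_sub (convC theta bb) conv_delta conv_bb_theta.
  by case: m m0 {m1 mp mp1 mE bp H} => //= *; ring.
have H2 := @conv_theta_split (fun k => bb k - delta k) m m0.
rewrite -H2 in H; last by rewrite bb0 /=; ring.
rewrite C /theta in H.
apply: (Rmult_eq_reg_l (bb m)); last by lra.
by rewrite H {2}mE mE; field; lra.
Qed.

Lemma fmom0 j m : fmom j 0 m = 1.
Proof.
rewrite /fmom; elim: m {2}m => //= f IH m; case: ifP => // /negbT; rewrite -ltnNge => m1.
rewrite -[RHS](sum_cut_prob m1); apply: eq_bigr => i _.
by rewrite (_ : (if i == j then _ else _) = fun=> 1) ?IH ?Rmult_1_r //; case: ifP.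
Qed.

Lemma aseq0 j m : aseq j 0 m = bb m - delta m.
Proof. by case: m => [|m] /=; rewrite ?bb0 ?fmom0; ring. Qed.

(** Conditioning on the first cut. A counted cut replaces k by k + 1, and [ffact_succ] splits the
    falling factorial of k + 1, which gives the extra term at i = j. *)
Lemma fmomS j s m : (1 < m)%nat -> (0 < j)%nat ->
  fmom j s.+1 m = \big[Rplus/0]_(1 <= i < m) (cut_prob m i * fmom j s.+1 (m - i)) +
    (if (j < m)%nat then cut_prob m j * (INR s.+1 * fmom j s (m - j)) else 0).
Proof.
move=> m1 j0; rewrite {1}/fmom; case: m m1 => // m m1 /=; rewrite leqNgt m1 /=.
have fu i g : (0 < i < m.+1)%nat ->
    size_expect j m (m.+1 - i) g = size_expect j (m.+1 - i) (m.+1 - i) g.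
  by move=> im; apply: size_expect_fuel; lia.
have -> : (if (j < m.+1)%nat then cut_prob m.+1 j * (INR s.+1 * fmom j s (m.+1 - j)) else 0) =
    \big[Rplus/0]_(1 <= i < m.+1) (if i == j then cut_prob m.+1 j * (INR s.+1 * fmom j s (m.+1 - j)) else 0).
  case: ltnP => jm; last first.
    by rewrite big_nat big1 // => i im; case: eqP => // ij; lia.
  rewrite (bigD1_seq j) ?iota_uniq ?mem_index_iota ?j0 //= eqxx big1 ?Rplus_0_r //.
  by move=> i /negbTE ->.
rewrite -big_split big_nat [RHS]big_nat; apply: eq_bigr => i im /=.
case: eqP => [E|_]; last by rewrite fu // Rplus_0_r.
rewrite E in im *.
rewrite -Rmult_plus_distr_l fu // -size_expect_lin; congr Rmult.
by congr size_expect; apply: functional_extensionality => k; exact: ffact_succ.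
Qed.

Lemma fmomS1 j s : fmom j s.+1 1 = 0.
Proof. by rewrite -[LHS]/(ffact (INR 0) s.+1) ffact_pow_nat ffact_small. Qed.

(** For m >= 2, a = (m / (m-1)) X, where X is the sum of convolution and source term; this is the
    same as a = X + a / m. *)
Lemma aseq_rec j s m : (0 < j)%nat ->
  aseq j s.+1 m = conv theta (aseq j s.+1) m + aseq j s.+1 m / INR m +
    INR s.+1 * theta j * shift j (aseq j s) m.
Proof.
move=> j0; case: m => [|[|m]].
- by rewrite /conv big_ord1 /shift leqNgt j0 /= /Rdiv; ring.
- have F1 := fmomS1 j s.
  rewrite conv_theta_split // big_geq //= F1 /shift; case: j j0 {F1} => // -[|j] _ /=; rewrite /Rdiv; ring.
set M := m.+2.
have mp : 0 < INR M by exact: INR_pos.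
have mp1 : 0 < INR M.-1 by exact: INR_pos.
have mE : INR M = INR M.-1 + 1 by rewrite -S_INR.
have H : aseq j s.+1 M = INR M / INR M.-1 *
   (conv theta (aseq j s.+1) M + INR s.+1 * theta j * shift j (aseq j s) M).
  rewrite conv_theta_split // -[LHS]/(bb M * fmom j s.+1 M) fmomS // Rmult_plus_distr_l.
  rewrite [RHS]Rmult_plus_distr_l; congr Rplus.
    rewrite !big_distrr big_nat [RHS]big_nat; apply: eq_bigr => i im /=.
    rewrite -Rmult_assoc cut_prob_bb //; have : (0 < M - i)%nat by lia.
    by case: (M - i)%nat => //= k _; ring.
  rewrite /shift; case: ltngtP => [jM|jM|->]; [|ring|rewrite subnn /=; ring].
  rewrite -Rmult_assoc cut_prob_bb ?j0 //; have : (0 < M - j)%nat by lia.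
  by case: (M - j)%nat => //= k _; ring.
have E : conv theta (aseq j s.+1) M + INR s.+1 * theta j * shift j (aseq j s) M =
   aseq j s.+1 M * INR M.-1 / INR M by rewrite H; field; lra.
rewrite -[RHS]/(_ + _ + _) Rplus_assoc (Rplus_comm (_ / _)) -Rplus_assoc E mE.
by field; lra.
Qed.

(* Convolving with b = 1/(1 - theta) solves [aseq_rec] for its theta-term. *)
Lemma aseq_renewal j s n : (0 < j)%nat ->
  aseq j s.+1 n = conv bb (fun m => aseq j s.+1 m / INR m) n +
    INR s.+1 * theta j * shift j (conv bb (aseq j s)) n.
Proof.
move=> j0.
have E : conv bb (aseq j s.+1) n = conv bb (conv theta (aseq j s.+1)) n +
   (conv bb (fun m => aseq j s.+1 m / INR m) n +
    INR s.+1 * theta j * shift j (conv bb (aseq j s)) n).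
  rewrite -conv_shift -conv_scal -!conv_add; apply: eq_conv => // k _.
  by rewrite {1}aseq_rec //; ring.
move: E; rewrite -convA (@eq_conv (conv bb theta) (fun k => bb k - delta k) _ (aseq j s.+1)) //; last first.
  by move=> k _; exact: conv_bb_theta.
rewrite (convC bb) (convC (fun k => bb k - delta k)) conv_sub conv_delta; lra.
Qed.

Lemma conv_big (I : Type) (r : seq I) x (F : I -> nat -> R) n :
  conv x (fun k => \big[Rplus/0]_(i <- r) F i k) n = \big[Rplus/0]_(i <- r) conv x (F i) n.
Proof.
rewrite /conv exchange_big; apply: eq_bigr => k _.
by rewrite big_distrr.
Qed.

Lemma shift_big (I : Type) (r : seq I) j (F : I -> nat -> R) n :
  shift j (fun k => \big[Rplus/0]_(i <- r) F i k) n = \big[Rplus/0]_(i <- r) shift j (F i) n.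
Proof. by rewrite /shift; case: ifP => // _; rewrite big1. Qed.

Lemma eq_shift j x y n : (forall k, x k = y k) -> shift j x n = shift j y n.
Proof. by move=> E; rewrite /shift E. Qed.

Section AseqAsymptotics.
Variable beta : R.
Hypothesis beta0 : 0 < beta.
Hypothesis Hb : is_lim_seq (fun n => bb n * rt n) beta.

Let b0 k : 0 <= bb k. Proof. exact/Rlt_le/bb_pos. Qed.

(** Uniform in j because the constant of [renewal_bound] serves all x and g: the powers of theta_j
    go into g, and the shift only lowers the argument of an increasing bound. *)
Lemma aseq_upper s : exists2 K, 0 < K &
  forall j n, (0 < j)%nat -> aseq j s n <= K * theta j ^ s * (rt n ^ s / rt n).
Proof.
elim: s => [|s [K K0 IH]].
  have [K K0 HK] := bb_upper Hb; exists K => // j n j0.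
  rewrite aseq0 /= Rmult_1_r (_ : K * (1 / rt n) = K / rt n); last by field; have := rt_pos n; lra.
  have : 0 <= delta n by case: n => /= *; lra.
  by have := HK n; lra.
have [B B0 HB] := @renewal_bound beta beta0 Hb.
have [C C0 HC] := @conv_bb_pow beta beta0 Hb s.
have s0 : 0 < INR s.+1 by exact: INR_pos.
exists (B * (INR s.+1 * (K * C))); first by do !apply: Rmult_lt_0_compat.
move=> j n j0; have tp := theta_pos j0; have tps := pow_lt _ s tp.
have rn := rt_pos n.
have Kt : 0 < K * theta j ^ s by exact: Rmult_lt_0_compat.
have st : 0 < INR s.+1 * theta j by exact: Rmult_lt_0_compat.
have c0 : 0 < INR s.+1 * theta j * (K * theta j ^ s * C).
  by apply: Rmult_lt_0_compat => //; exact: Rmult_lt_0_compat.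
pose g n := INR s.+1 * theta j * (K * theta j ^ s * C) * rt n ^ s.
suff /HB /(_ n) H : renewal_ineq (aseq j s.+1) g.
  apply: Rle_trans H _; rewrite /g /= /Rdiv; right; field; lra.
split.
- by move=> k; exact: aseq_ge0.
- by move=> k; apply: Rmult_le_pos; [lra|exact/Rlt_le/rt_pow_pos].
- by move=> k m km; apply: Rmult_le_compat_l; [lra|exact: rt_pow_le].
- by split; rewrite //= fmomS1; ring.
move=> m; rewrite {1}aseq_renewal //; apply: Rplus_le_compat_l.
rewrite /g (_ : INR s.+1 * theta j * (K * theta j ^ s * C) * rt m ^ s =
  INR s.+1 * theta j * (K * theta j ^ s * (C * rt m ^ s))); last by ring.
apply: Rmult_le_compat_l; first lra.
rewrite /shift; case: leqP => jm; last first.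
  apply: Rmult_le_pos; first lra.
  by apply: Rmult_le_pos; [lra|exact/Rlt_le/rt_pow_pos].
apply: Rle_trans (_ : conv bb (fun k => K * theta j ^ s * (rt k ^ s / rt k)) (m - j) <= _).
  by apply: conv_le => // k _; exact: IH.
rewrite conv_scal; apply: Rmult_le_compat_l; first lra.
apply: Rle_trans (HC _) _; apply: Rmult_le_compat_l; first lra.
exact/rt_pow_le/leq_subr.
Qed.

(** The nonnegative term b * (a_s / m) is dropped. From a_0 = b - 1 each step convolves with b and
    shifts by j, which leaves c_(s+1) - c_s. *)
Lemma aseq_lower j s n : (0 < j)%nat ->
  INR s`! * theta j ^ s * shift (s * j) (fun m => cc s.+1 m - cc s m) n <= aseq j s n.
Proof.
move=> j0; have tp := theta_pos j0.
elim: s n => [|s IH] n.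
  by rewrite aseq0 /shift mul0n leq0n subn0 fact0 INR1 cc1 /=; lra.
rewrite aseq_renewal //.
have p0 : 0 <= conv bb (fun m => aseq j s.+1 m / INR m) n.
  apply: conv_ge0 => // k; case: k => [|k]; first by rewrite /Rdiv Rmult_0_l; lra.
  by apply: Rmult_le_pos; [exact: aseq_ge0|exact/Rlt_le/Rinv_0_lt_compat/INR_pos].
suff : INR s.+1`! * theta j ^ s.+1 * shift (s.+1 * j) (fun m => cc s.+2 m - cc s.+1 m) n
   <= INR s.+1 * theta j * shift j (conv bb (aseq j s)) n by lra.
have -> : shift (s.+1 * j) (fun m => cc s.+2 m - cc s.+1 m) n =
   shift j (conv bb (shift (s * j) (fun m => cc s.+1 m - cc s m))) n.
  rewrite mulSn -shift_shift; apply: eq_shift => k.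
  by rewrite conv_shift; apply: eq_shift => i; rewrite conv_sub.
rewrite factS INRM (_ : _ * _ = INR s.+1 * theta j * (INR s`! * theta j ^ s *
   shift j (conv bb (shift (s * j) (fun m => cc s.+1 m - cc s m))) n)); last by rewrite /=; ring.
apply: Rmult_le_compat_l; first by apply: Rmult_le_pos; [exact: pos_INR|lra].
by rewrite -shift_scal; apply: shift_le => k; rewrite -conv_scal; apply: conv_le.
Qed.

(** Nonnegative and of smaller order than c_(s+1), which grows like rt^(s-1). *)
Definition small_o s (H : nat -> R) :=
  (forall n, 0 <= H n) /\ is_lim_seq (fun n => H n * rt n / rt n ^ s) 0.

Lemma conv_bb_small_o s H : small_o s.+1 H -> small_o s.+2 (conv bb H).
Proof.
move=> [H0 Hl]; split; first by move=> n; exact: conv_ge0.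
have [M M0 HM] := @conv_bb_pow beta beta0 Hb s.+1.
have L : is_lim_seq (fun n => H n / rt n ^ s) 0.
  apply: is_lim_seq_ext Hl => n; have := rt_pos n; have := rt_pow_pos n s => * /=; field; lra.
have f0 k : 0 <= rt k ^ s by exact/Rlt_le/rt_pow_pos.
have HM' n : conv (fun k => rt k ^ s) bb n <= M * rt n ^ s.+1.
  apply: Rle_trans (HM n); rewrite convC; right; apply: eq_conv => // k _ /=.
  by have := rt_pos k => *; field; lra.
have := conv_small f0 b0 (fun k => rt_pow_ge1 k s.+1) L (bb_lim0 Hb) HM'.
apply: is_lim_seq_ext => n; rewrite convC.
rewrite (@eq_conv bb bb (fun k => H k / rt k ^ s * rt k ^ s) H) //; last first.
  by move=> k _; have := rt_pow_pos k s => *; field; lra.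
by rewrite /=; have := rt_pos n; have := rt_pow_pos n s => *; field; lra.
Qed.

Lemma conv_bb_inv_small_o s K : 0 <= K ->
  small_o s.+1 (conv bb (fun m => K * (rt m ^ s / INR m))).
Proof.
move=> K0.
have i0 k : 0 <= / INR k.
  case: k => [|k]; first by rewrite INR0 Rinv_0; lra.
  exact/Rlt_le/Rinv_0_lt_compat/INR_pos.
have p0 n : 0 <= conv bb (fun m => K * (rt m ^ s / INR m)) n.
  apply: conv_ge0 => // k; apply: Rmult_le_pos => //; apply: Rmult_le_pos => //.
  exact/Rlt_le/rt_pow_pos.
split=> //.
apply: (is_lim_seq_le_le (fun _ => 0) _ (fun n => K * conv bb (fun m => / INR m) n)).
- move=> n; have rn := rt_pos n; have rs := rt_pow_pos n s.
  rewrite (_ : _ * rt n / rt n ^ s.+1 = conv bb (fun m => K * (rt m ^ s / INR m)) n / rt n ^ s); last first.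
    by rewrite /=; field; lra.
  split; first by apply: Rmult_le_pos => //; exact/Rlt_le/Rinv_0_lt_compat.
  apply: (Rmult_le_reg_r (rt n ^ s)) => //.
  rewrite /Rdiv Rmult_assoc Rinv_l ?Rmult_1_r; last by lra.
  rewrite Rmult_comm -!conv_scal; apply: conv_le => // k kn.
  rewrite (_ : rt n ^ s * (K * / INR k) = K * (rt n ^ s * / INR k)); last by ring.
  apply: Rmult_le_compat_l => //; apply: Rmult_le_compat_r => //; exact: rt_pow_le.
- exact: is_lim_seq_const.
rewrite (_ : Finite 0 = K * 0); last by congr Finite; ring.
by apply: is_lim_seq_mult'; [exact: is_lim_seq_const|exact: (@conv_bb_inv beta)].
Qed.

(** The errors [H i] are chosen before j, which acts only through theta_j^s and the shifts by i j;
    one family thus serves every sequence j(n). A step convolves and shifts the old errors and adds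
    an unshifted one from b * (a / m), controlled by the cruder [aseq_upper]. *)
Lemma aseq_sharp s : exists2 H : nat -> nat -> R,
  (forall i, (i < s)%nat -> small_o s (H i)) &
  forall j n, (0 < j)%nat -> aseq j s n <=
    theta j ^ s * (INR s`! * shift (s * j) (cc s.+1) n +
      \big[Rplus/0]_(i < s) shift (i * j) (H i) n).
Proof.
elim: s => [|s [H Ho HH]].
  exists (fun _ _ => 0) => // j n j0.
  rewrite aseq0 big_ord0 /shift mul0n leq0n subn0 cc1 fact0 INR1 /=.
  by have : 0 <= delta n by [case: n => /= *; lra]; lra.
have [K K0 HK] := aseq_upper s.+1.
(* Index 0 holds the new error, index i + 1 the image of the old error i. *)
exists (fun i => if i is i'.+1 then fun n => INR s.+1 * conv bb (H i') n
                 else conv bb (fun m => K * (rt m ^ s / INR m))).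
  case=> [|i] is'; first exact/conv_bb_inv_small_o/Rlt_le.
  case: s H Ho HH HK is' => // s H Ho HH HK is'.
  have [C0 Cl] := conv_bb_small_o (Ho i is'); split.
    by move=> n; apply: Rmult_le_pos => //; exact: pos_INR.
  have -> : Finite 0 = INR s.+2 * 0 by congr Finite; ring.
  apply: is_lim_seq_ext (is_lim_seq_mult' _ _ _ _ (is_lim_seq_const (INR s.+2)) Cl) => n.
  rewrite /Rdiv; ring.
move=> j n j0; have tp := theta_pos j0; have tps := pow_lt _ s tp.
rewrite aseq_renewal // big_ord_recl /=.
have A : conv bb (fun m => aseq j s.+1 m / INR m) n <=
    theta j ^ s.+1 * shift (0 * j) (conv bb (fun m => K * (rt m ^ s / INR m))) n.
  rewrite /shift mul0n leq0n subn0 -conv_scal; apply: conv_le => // k _.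
  case: k => [|k]; first by rewrite INR0 /Rdiv Rinv_0 /=; lra.
  have ik := Rinv_0_lt_compat _ (INR_pos (ltn0Sn k)); have rk := rt_pos k.+1.
  apply: Rle_trans (_ : K * theta j ^ s.+1 * (rt k.+1 ^ s.+1 / rt k.+1) / INR k.+1 <= _).
    by apply: Rmult_le_compat_r; [lra|exact: HK].
  right; rewrite /=; field; split; [have := INR_pos (ltn0Sn k); lra|lra].
have B : INR s.+1 * theta j * shift j (conv bb (aseq j s)) n <=
    theta j ^ s.+1 * (INR s.+1`! * shift (s.+1 * j) (cc s.+2) n +
      \big[Rplus/0]_(i < s) shift (i.+1 * j) (fun n => INR s.+1 * conv bb (H i) n) n).
  apply: Rle_trans (_ : INR s.+1 * theta j * shift j (conv bb (fun k =>
      theta j ^ s * (INR s`! * shift (s * j) (cc s.+1) k +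
      \big[Rplus/0]_(i < s) shift (i * j) (H i) k))) n <= _).
    apply: Rmult_le_compat_l; first by apply: Rmult_le_pos; [exact: pos_INR|lra].
    by apply: shift_le => k; apply: conv_le => // i _; exact: HH.
  right.
  have E k : conv bb (fun k => theta j ^ s * (INR s`! * shift (s * j) (cc s.+1) k +
      \big[Rplus/0]_(i < s) shift (i * j) (H i) k)) k =
    theta j ^ s * (INR s`! * shift (s * j) (cc s.+2) k +
      \big[Rplus/0]_(i < s) shift (i * j) (conv bb (H i)) k).
    rewrite conv_scal conv_add conv_scal conv_shift conv_big; congr (_ * (_ + _)).
    by apply: eq_bigr => i _; rewrite conv_shift.
  rewrite (eq_shift _ _ E) shift_scal shift_add shift_scal shift_big shift_shift mulSn factS INRM.
  rewrite -[theta j ^ s.+1]/(theta j * theta j ^ s).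
  have -> : \big[Rplus/0]_(i < s) shift (i.+1 * j) (fun n => INR s.+1 * conv bb (H i) n) n =
     INR s.+1 * \big[Rplus/0]_(i < s) shift j (shift (i * j) (conv bb (H i))) n.
    by rewrite big_distrr; apply: eq_bigr => i _; rewrite mulSn shift_scal shift_shift.
  transitivity (INR s.+1 * theta j * (theta j ^ s * (INR s`! * shift (j + s * j) (cc s.+2) n +
    \big[Rplus/0]_(i < s) shift j (shift (i * j) (conv bb (H i))) n))); [by []|ring].
apply: Rle_trans (Rplus_le_compat _ _ _ _ A B) _; right; rewrite /=.
by rewrite -Rmult_plus_distr_l -!Rplus_assoc (Rplus_comm (shift (0 * j) _ _)).
Qed.

(** * Limits along sequences j(n) = o(n) *)

Definition mom_const s := rmom (/ (2 * beta)) s.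

Lemma rt_sub_ratio (j : nat -> nat) s :
  is_lim_seq (fun n => INR (j n) / INR n) 0 ->
  is_lim_seq (fun n => rt (n - s * j n) / rt n) 1.
Proof.
move=> jl.
(* This is (n + 1 - s j) / (n + 1), with n / (n + 1) written as 1 - 1 / (n + 1). *)
have L : is_lim_seq (fun n => 1 - INR s * (INR (j n) / INR n * (1 - / INR n.+1))) (1 - INR s * (0 * (1 - 0))).
  apply: is_lim_seq_minus'; first exact: is_lim_seq_const.
  apply: is_lim_seq_mult'; first exact: is_lim_seq_const.
  apply: is_lim_seq_mult' => //.
  by apply: is_lim_seq_minus'; [exact: is_lim_seq_const|exact: is_lim_seq_invS].
have -> : Finite 1 = sqrt (1 - INR s * (0 * (1 - 0))).
  by rewrite (_ : 1 - _ = 1) ?sqrt_1 //; ring.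
have P : 0 <= 1 - INR s * (0 * (1 - 0)) by lra.
apply: is_lim_seq_ext_loc (is_lim_seq_continuous sqrt _ _ (continuity_pt_sqrt _ P) L).
have ev : eventually (fun n => (0 < n)%nat /\ INR s * (INR (j n) / INR n) < 1).
  have L3 : is_lim_seq (fun n => INR s * (INR (j n) / INR n)) (INR s * 0).
    by apply: is_lim_seq_mult' => //; exact: is_lim_seq_const.
  rewrite Rmult_0_r in L3; move/is_lim_seq_spec: L3 => /(_ (mkposreal _ Rlt_0_1)) [N HN].
  exists (maxn N 1) => n /leP nN; split; first lia.
  by have := HN n ltac:(lia); rewrite Rminus_0_r => /(Rle_lt_trans _ _ _ (Rle_abs _)).
move: ev; apply: filter_imp => n [n0 nj].
have np := INR_pos n0.
have sj : (s * j n <= n)%nat.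
  apply/leP/INR_le; rewrite INRM; apply: Rlt_le.
  have := Rmult_lt_compat_r _ _ _ np nj; rewrite Rmult_1_l.
  by rewrite (_ : INR s * (INR (j n) / INR n) * INR n = INR s * INR (j n)) //; field; lra.
rewrite /rt -sqrt_div_alt; last exact: INR_pos.
congr sqrt; rewrite !S_INR minus_INR; last exact/leP.
by rewrite INRM; field; lra.
Qed.

Lemma sub_eventually (j : nat -> nat) s :
  is_lim_seq (fun n => INR (j n) / INR n) 0 ->
  filterlim (fun n => (n - s * j n)%nat) eventually eventually.
Proof.
move=> jl P [M HM].
move/is_lim_seq_spec: (rt_sub_ratio s jl) => /(_ (mkposreal _ (ltac:(lra) : 0 < / 2))) [N1 H1].
move/is_lim_seq_spec: rt_infty => /(_ (2 * rt M)) [N2 H2].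
exists (maxn N1 N2) => n /leP nN; apply/HM/leP.
have := H1 n ltac:(lia); have := H2 n ltac:(lia) => h2 /Rabs_def2 /= [_ h1].
have rn := rt_pos n; case: (leqP M (n - s * j n)) => // /ltnW /rt_le h3.
have h4 : rt (n - s * j n) / rt n * rt n > / 2 * rt n by apply: Rmult_lt_compat_r; lra.
by move: h4; rewrite /Rdiv Rmult_assoc Rinv_l; lra.
Qed.

(** Subtraction being truncated, n - s j >= 1 for large n already implies s j <= n. *)
Lemma eventually_mul_le (j : nat -> nat) s :
  is_lim_seq (fun n => INR (j n) / INR n) 0 -> eventually (fun n => (s * j n <= n)%nat).
Proof.
move=> jl; have [N HN] := sub_eventually s jl (ex_intro _ 1%nat (fun n Hn => Hn) :
  eventually (fun n => (1 <= n)%coq_nat)).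
by exists N => n /HN /leP; lia.
Qed.

(** The shifted index n - i j(n) tends to infinity and the two power scales have ratio tending to
    1. *)
Lemma scaled_shift_lim (j : nat -> nat) i s x (l : R) :
  is_lim_seq (fun n => INR (j n) / INR n) 0 ->
  is_lim_seq (fun n => x n * rt n / rt n ^ s) l ->
  is_lim_seq (fun n => shift (i * j n) x n * rt n / rt n ^ s) (Finite l).
Proof.
move=> jl xl.
have L1 : is_lim_seq (fun n => x (n - i * j n)%nat * rt (n - i * j n) / rt (n - i * j n) ^ s) l.
  exact: (is_lim_seq_subseq _ _ _ (sub_eventually i jl) xl).
have L2 := rt_sub_ratio i jl.
have L2s : is_lim_seq (fun n => (rt (n - i * j n) / rt n) ^ s) 1.
  elim: s {xl L1} => [|s IH]; first exact: is_lim_seq_const.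
  have -> : Finite 1 = 1 * 1 by rewrite Rmult_1_r.
  exact: is_lim_seq_mult'.
have L3 : is_lim_seq (fun n => / (rt (n - i * j n) / rt n)) (Finite (/ 1)).
  by apply: (is_lim_seq_inv _ (Finite 1)) => // -[]; lra.
have -> : Finite l = l * (/ 1 * 1) by congr Finite; field.
have L4 := is_lim_seq_mult' _ _ _ _ L1 (is_lim_seq_mult' _ _ _ _ L3 L2s).
apply: is_lim_seq_ext_loc L4.
have := eventually_mul_le i jl; apply: filter_imp => n ijn.
rewrite /shift ijn Rpow_mult_distr pow_inv.
have := rt_pos n; have := rt_pos (n - i * j n); have := rt_pow_pos n s.
by have := rt_pow_pos (n - i * j n) s => *; field; lra.
Qed.

Lemma cc_small s : is_lim_seq (fun n => cc s n * rt n / rt n ^ s) 0.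
Proof.
case: s => [|s].
  apply: is_lim_seq_ext_loc (is_lim_seq_const 0); exists 1%nat => -[|n] //= H; first lia.
  by rewrite Rmult_0_l /Rdiv Rmult_0_l.
have -> : Finite 0 = beta * rmom (/ (2 * beta)) s / INR s`! * 0 by rewrite Rmult_0_r.
apply: is_lim_seq_ext (is_lim_seq_mult' _ _ _ _ (@cc_lim beta beta0 Hb s) rt_inv_lim) => n.
by rewrite /=; have := rt_pos n; have := rt_pow_pos n s => *; field; lra.
Qed.

Lemma lambdaE n j : (0 < j)%nat -> lambda n j = sqrt (INR n) * theta j.
Proof.
move=> j0; rewrite /lambda /theta /bb exp_Ropp subn1.
have -> : INR j ^ j = INR j * INR j ^ j.-1 by case: j j0.
have := INR_pos j0; have := fact_pos j; have := exp_pos (INR j) => *.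
by field; lra.
Qed.

Lemma rt_sqrt_lim s : is_lim_seq (fun n => (rt n / sqrt (INR n)) ^ s) 1.
Proof.
have L : is_lim_seq (fun n => rt n / sqrt (INR n)) 1.
  have L1 : is_lim_seq (fun n => sqrt (1 + / INR n)) (sqrt (1 + 0)).
    apply: is_lim_seq_continuous; first by apply: continuity_pt_sqrt; lra.
    apply: is_lim_seq_plus'; first exact: is_lim_seq_const.
    by apply/is_lim_seq_incr_1; exact: is_lim_seq_invS.
  rewrite Rplus_0_r sqrt_1 in L1; apply: is_lim_seq_ext_loc L1.
  exists 1%nat => n /leP n0; have np := INR_pos n0.
  by rewrite /rt -sqrt_div_alt //; congr sqrt; rewrite S_INR; field; lra.
elim: s => [|s IH]; first exact: is_lim_seq_const.
have -> : Finite 1 = 1 * 1 by rewrite Rmult_1_r.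
exact: is_lim_seq_mult'.
Qed.

Lemma fmom_lim (j : nat -> nat) s :
  eventually (fun n => (0 < j n)%nat) ->
  is_lim_seq (fun n => INR (j n) / INR n) 0 ->
  is_lim_seq (fun n => fmom (j n) s n / lambda n (j n) ^ s) (mom_const s).
Proof.
move=> jp jl; pose c := beta * mom_const s / INR s`!.
have ccl : is_lim_seq (fun n => cc s.+1 n * rt n / rt n ^ s) c := @cc_lim beta beta0 Hb s.
have [H Ho HH] := aseq_sharp s.
have bn : beta <> 0 by lra.
have sf := fact_pos s.
(* Squeezed between [aseq_lower] and [aseq_sharp], whose main terms agree up to the lower-order c_s
   and the errors [H]. *)
have A : is_lim_seq (fun n => aseq (j n) s n * rt n / (theta (j n) ^ s * rt n ^ s)) (INR s`! * c).
  have Lo := is_lim_seq_mult' _ _ _ _ (is_lim_seq_const (INR s`!))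
    (is_lim_seq_minus' _ _ _ _ (scaled_shift_lim s jl ccl) (scaled_shift_lim s jl (cc_small s))).
  have Ls : is_lim_seq (fun n => \big[Rplus/0]_(i < s) (shift (i * j n) (H i) n * rt n / rt n ^ s)) 0.
    have -> : Finite 0 = \big[Rplus/0%R]_(i < s) 0%R by rewrite big1.
    apply: is_lim_seq_big => i; apply: scaled_shift_lim => //.
    by case: (Ho i (ltn_ord i)).
  have Up := is_lim_seq_plus' _ _ _ _ (is_lim_seq_mult' _ _ _ _ (is_lim_seq_const (INR s`!))
    (scaled_shift_lim s jl ccl)) Ls.
  rewrite Rminus_0_r in Lo; rewrite Rplus_0_r in Up.
  apply: is_lim_seq_le_le_loc Lo Up.
  move: jp; apply: filter_imp => n jn.
  have tp := pow_lt _ s (theta_pos jn); have rn := rt_pos n; have rs := rt_pow_pos n s.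
  have q0 : 0 < rt n / (theta (j n) ^ s * rt n ^ s).
    by apply: Rdiv_lt_0_compat => //; exact: Rmult_lt_0_compat.
  have qE y : y * rt n / (theta (j n) ^ s * rt n ^ s) = y * (rt n / (theta (j n) ^ s * rt n ^ s)).
    by rewrite /Rdiv; ring.
  split.
    rewrite qE; apply: Rle_trans (Rmult_le_compat_r _ _ _ (Rlt_le _ _ q0) (aseq_lower s n jn)).
    rewrite (_ : shift (s * j n) (fun m => cc s.+1 m - cc s m) n =
      shift (s * j n) (cc s.+1) n - shift (s * j n) (cc s) n); last first.
      by rewrite /shift; case: ifP => // _; ring.
    by right; field; lra.
  rewrite qE; apply: Rle_trans (Rmult_le_compat_r _ _ _ (Rlt_le _ _ q0) (HH _ n jn)) _.
  have -> : \big[Rplus/0]_(i < s) (shift (i * j n) (H i) n * rt n / rt n ^ s) =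
     \big[Rplus/0]_(i < s) shift (i * j n) (H i) n * (rt n / rt n ^ s).
    by rewrite big_distrl; apply: eq_bigr => i _; rewrite /Rdiv /=; ring.
  by right; field; lra.
have -> : Finite (mom_const s) = INR s`! * c / beta * 1.
  by congr Finite; rewrite /c; field; split; lra.
have L := is_lim_seq_mult' _ _ _ _ (is_lim_seq_div' _ _ _ _ A Hb bn) (rt_sqrt_lim s).
apply: is_lim_seq_ext_loc L.
have [N HN] := jp; exists (maxn N 1) => n /leP nN.
have jn : (0 < j n)%nat by apply: HN; lia.
have n1 : (0 < n)%nat by lia.
rewrite lambdaE // Rpow_mult_distr [(rt n / _) ^ s]Rpow_mult_distr pow_inv.
have -> : aseq (j n) s n = bb n * fmom (j n) s n by case: n n1 {jn nN}.
have sp : 0 < sqrt (INR n) ^ s by apply/pow_lt/sqrt_lt_R0/INR_pos.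
have := pow_lt _ s (theta_pos jn); have := rt_pos n; have := rt_pow_pos n s; have := bb_pos n => *.
by field; lra.
Qed.

Lemma fmom_upper s : exists2 K, 0 < K &
  forall n j, (0 < j)%nat -> (0 < n)%nat -> fmom j s n <= K * lambda n j ^ s.
Proof.
have [K K0 HK] := aseq_upper s; have [k k0 Hk] := bb_lower beta0 Hb.
have p2 : 0 < 2 ^ s by apply: pow_lt; lra.
(* The power of 2 pays for [rt n] <= 2 sqrt n. *)
exists (K / k * 2 ^ s); first by apply: Rmult_lt_0_compat => //; exact: Rdiv_lt_0_compat.
move=> n j j0 n0; have np := INR_pos n0; have rn := rt_pos n.
have tp := pow_lt _ s (theta_pos j0); have bp := bb_pos n.
have aE : aseq j s n = bb n * fmom j s n by case: n n0 {np rn bp}.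
have f0 : 0 <= fmom j s n by apply: size_expect_ge0 => i; exact: ffact_ge0.
have h1 : k / rt n * fmom j s n <= K * theta j ^ s * (rt n ^ s / rt n).
  by apply: Rle_trans (HK j n j0); rewrite aE; apply: Rmult_le_compat_r.
have h2 : fmom j s n <= K / k * (theta j ^ s * rt n ^ s).
  apply: (Rmult_le_reg_l (k / rt n)); first exact: Rdiv_lt_0_compat.
  by apply: Rle_trans h1 _; right; field; lra.
apply: Rle_trans h2 _; rewrite Rmult_assoc; apply: Rmult_le_compat_l.
  exact/Rlt_le/Rdiv_lt_0_compat.
rewrite lambdaE // Rpow_mult_distr.
rewrite (_ : 2 ^ s * (_ * _) = theta j ^ s * (2 * sqrt (INR n)) ^ s); last by rewrite Rpow_mult_distr; ring.
apply: Rmult_le_compat_l; first lra.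
apply: pow_incr; split; first lra.
have -> : 2 = sqrt (2 * 2) by rewrite sqrt_square //; lra.
rewrite -sqrt_mult_alt; last lra.
apply: sqrt_le_1_alt; rewrite S_INR.
have : 1 <= INR n by apply: (le_INR 1); lia.
lra.
Qed.
End AseqAsymptotics.

(** * Rayleigh integrals *)

(** Continuity on the whole line is built in so that every proper integral exists without side
    conditions. *)
Definition improper (h : R -> R) (l : R) : Prop :=
  (forall x, continuous h x) /\ is_lim (fun A => RInt h 0 A) p_infty l.

Lemma continuous_ex_RInt (h : R -> R) a b : (forall x, continuous h x) -> ex_RInt h a b.
Proof. by move=> hc; apply: (ex_RInt_continuous (V := R_CompleteNormedModule)). Qed.

Lemma improper_is_RInt_gen h l : improper h l ->
  is_RInt_gen h (at_point 0) (Rbar_locally p_infty) l.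
Proof.
move=> [hc hl] P HP; have [M HM] := hl P HP.
apply: (Filter_prod _ _ _ (fun x => x = 0) (fun A => M < A)) => //; first by exists M.
move=> x A /= -> MA; exists (RInt h 0 A); split; last exact: HM.
exact/(RInt_correct (V := R_CompleteNormedModule))/continuous_ex_RInt.
Qed.

Lemma improper_ext h k l : (forall x, h x = k x) -> improper h l -> improper k l.
Proof. by move=> e; have -> : k = h by apply: functional_extensionality => x; rewrite e. Qed.

Lemma improper_plus h k l m : improper h l -> improper k m ->
  improper (fun x => h x + k x) (l + m).
Proof.
move=> [hc hl] [kc kl]; split.
  by move=> x; apply: (continuous_plus (V := R_NormedModule)).
have L := is_lim_plus' _ _ _ _ _ hl kl.
apply: is_lim_ext L => A; apply: esym; apply: (RInt_plus (V := R_CompleteNormedModule)); exact: continuous_ex_RInt.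
Qed.

Lemma improper_scal c h l : improper h l -> improper (fun x => c * h x) (c * l).
Proof.
move=> [hc hl]; split.
  by move=> x; apply: (continuous_scal_r (V := R_NormedModule)).
have L := is_lim_scal_l _ c _ _ hl.
apply: is_lim_ext L => A; apply: esym; apply: (RInt_scal (V := R_CompleteNormedModule)); exact: continuous_ex_RInt.
Qed.

Lemma improper_le h k l m : improper h l -> improper k m ->
  (forall x, 0 <= x -> h x <= k x) -> l <= m.
Proof.
move=> [hc hl] [kc kl] hk.
apply: (is_lim_le_loc _ _ p_infty (Finite l) (Finite m) _ hl kl).
exists 0 => A A0; apply: RInt_le; [lra|exact: continuous_ex_RInt|exact: continuous_ex_RInt|].
by move=> x x0; apply: hk; lra.
Qed.

Lemma improper0 : improper (fun _ => 0) 0.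
Proof.
split; first by move=> x; exact: continuous_const.
apply: (is_lim_ext (fun _ => 0)); last exact: is_lim_const.
by move=> A; rewrite RInt_const /scal /= /mult /=; ring.
Qed.

Lemma improper_big (I : Type) (r : seq I) (h : I -> R -> R) (l : I -> R) :
  (forall i, improper (h i) (l i)) ->
  improper (fun x => \big[Rplus/0]_(i <- r) h i x) (\big[Rplus/0]_(i <- r) l i).
Proof.
move=> H; elim: r => [|i r IH].
  rewrite big_nil; apply: improper_ext improper0 => x.
  by rewrite big_nil.
rewrite big_cons; apply: (improper_ext _ (improper_plus (H i) IH)) => x.
by rewrite big_cons.
Qed.

Lemma RInt_ge0 h a b : (forall x, continuous h x) -> a <= b ->
  (forall x, a <= x -> 0 <= h x) -> 0 <= RInt h a b.
Proof.
move=> hc ab h0; apply: RInt_ge_0 => //; first exact: continuous_ex_RInt.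
by move=> x xab; apply: h0; lra.
Qed.

Lemma RInt_split h a b c : (forall x, continuous h x) ->
  RInt h a c = RInt h a b + RInt h b c.
Proof.
move=> hc; apply: esym; apply: (RInt_Chasles (V := R_CompleteNormedModule)); exact: continuous_ex_RInt.
Qed.

Lemma improper_exists h M : (forall x, continuous h x) -> (forall x, 0 <= x -> 0 <= h x) ->
  (forall A, 0 <= A -> RInt h 0 A <= M) -> exists l, improper h l.
Proof.
move=> hc h0 hM.
have mono A B : 0 <= A -> A <= B -> RInt h 0 A <= RInt h 0 B.
  move=> A0 AB; rewrite (@RInt_split h 0 A B hc).
  suff : 0 <= RInt h A B by lra.
  by apply: RInt_ge0 => // x Ax; apply: h0; lra.
have [l Hl] : ex_finite_lim_seq (fun n => RInt h 0 (INR n)).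
  apply: (ex_finite_lim_seq_incr _ M) => n; last exact/hM/pos_INR.
  by apply: mono; [exact: pos_INR|rewrite S_INR; lra].
exists l; split=> //; apply/is_lim_spec => eps.
move/is_lim_seq_spec: (Hl) => /(_ eps) [N HN].
exists (INR N) => A NA.
have lo := mono _ _ (pos_INR N) (Rlt_le _ _ NA).
have hi : RInt h 0 A <= l.
  apply: (is_lim_seq_le_loc (fun _ => RInt h 0 A) _ (Finite _) (Finite _) _ (is_lim_seq_const _) Hl).
  have [K HK] := nfloor_ex A ltac:(have := pos_INR N; lra).
  exists K.+1 => n /leP Kn; apply: mono; first by have := pos_INR N; lra.
  have : INR K.+1 <= INR n by apply: le_INR; exact/leP.
  by rewrite S_INR; lra.
by have /Rabs_def2 := HN N (le_n N); move=> *; apply: Rabs_def1; lra.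
Qed.

Notation ray := rayleigh_density.

Lemma ray_ge0 x : 0 <= x -> 0 <= ray x.
Proof. by move=> x0; apply: Rmult_le_pos => //; exact/Rlt_le/exp_pos. Qed.

Lemma cont_pow_ray s x : continuous (fun x => x ^ s * ray x) x.
Proof. by apply: ex_derive_continuous; rewrite /ray; auto_derive. Qed.

Lemma RInt_ray A : RInt ray 0 A = 1 - exp (- (A ^ 2) / 2).
Proof.
have H : is_RInt ray 0 A (minus (- exp (- (A ^ 2) / 2)) (- exp (- (0 ^ 2) / 2))).
  apply: (is_RInt_derive (fun x => - exp (- (x ^ 2) / 2))) => x _.
    by rewrite /ray; auto_derive => //; rewrite !S_INR INR0 /Rdiv /=; field.
  by apply: ex_derive_continuous; rewrite /ray; auto_derive.
rewrite (is_RInt_unique _ _ _ _ H) /minus /plus /opp /= (_ : - (0 * (0 * 1)) / 2 = 0); last by field.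
by rewrite exp_0; ring.
Qed.

Lemma pow_le_exp k y : 0 <= y -> y ^ k / INR k`! <= exp y.
Proof.
elim: k y => [|k IH] y y0.
  by rewrite fact0 INR1 /=; have := exp_ge1 y0; lra.
suff : 0 <= exp y - y ^ k.+1 / INR k.+1`! by lra.
apply: (@nonneg_of_derive (fun y => exp y - y ^ k.+1 / INR k.+1`!) (fun t => exp t - t ^ k / INR k`!)) => //.
- move=> t t0; auto_derive => //; rewrite factS INRM /=.
  by field; split; [have := fact_pos k; lra|exact: not_0_INR].
- by move=> t t0; have := IH t t0; lra.
- by rewrite exp_0 /= /Rdiv !Rmult_0_l; lra.
Qed.

(** By [pow_le_exp] at A^2 / 2 the product is at most k! 2^k / A^k. *)
Lemma pow_gauss_lim k : (0 < k)%nat ->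
  is_lim (fun A => A ^ k * exp (- (A ^ 2) / 2)) p_infty 0.
Proof.
case: k => // k _.
have Z : is_lim (fun A => INR k.+1`! * 2 ^ k.+1 * / A) p_infty 0.
  have -> : Finite 0 = Rbar_mult (INR k.+1`! * 2 ^ k.+1) 0 by rewrite /= Rmult_0_r.
  apply: is_lim_scal_l; have -> : Finite 0 = Rbar_inv p_infty by [].
  by apply: is_lim_inv => //; exact: is_lim_id.
apply: (is_lim_le_le_loc (fun _ => 0) _ _ _ _ _ (is_lim_const 0 _) Z).
exists 1 => A A1; have Ap : 0 < A ^ k by apply: pow_lt; lra.
split; first by apply: Rmult_le_pos; [apply: pow_le; lra|exact/Rlt_le/exp_pos].
have fp := fact_pos k.+1; have p2 : 0 < 2 ^ k.+1 by apply: pow_lt; lra.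
have Apk : 0 < A ^ k.+1 by apply: pow_lt; lra.
have H : (A ^ 2 / 2) ^ k.+1 / INR k.+1`! <= exp (A ^ 2 / 2) by apply: pow_le_exp; nra.
have E : exp (- (A ^ 2) / 2) = / exp (A ^ 2 / 2) by rewrite -exp_Ropp; congr exp; field.
have H2 : exp (- (A ^ 2) / 2) <= / ((A ^ 2 / 2) ^ k.+1 / INR k.+1`!).
  rewrite E; apply: Rinv_le_contravar => //.
  by apply: Rdiv_lt_0_compat => //; apply: pow_lt; nra.
apply: Rle_trans (Rmult_le_compat_l _ _ _ (Rlt_le _ _ Apk) H2) _.
rewrite Rpow_mult_distr pow_inv (_ : (A ^ 2) ^ k.+1 = A ^ k.+1 * A ^ k.+1); last first.
  by rewrite -Rpow_mult_distr; congr pow; ring.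
rewrite (_ : A ^ k.+1 * / _ = INR k.+1`! * 2 ^ k.+1 * / A ^ k.+1); last by field; lra.
apply: Rmult_le_compat_l; first by apply: Rmult_le_pos; lra.
apply: Rinv_le_contravar; first lra.
rewrite /=; have : 1 <= A ^ k by apply: pow_R1_Rle; lra.
nra.
Qed.

(** Integration by parts, read off from the derivative of - x^(s+2) exp(- x^2 / 2). *)
Lemma RInt_pow_ray s A :
  RInt (fun x => x ^ s.+2 * ray x) 0 A =
  INR s.+2 * RInt (fun x => x ^ s * ray x) 0 A - A ^ s.+2 * exp (- (A ^ 2) / 2).
Proof.
have H : is_RInt (fun x => x ^ s.+2 * ray x + (- INR s.+2) * (x ^ s * ray x)) 0 A
   (minus (- (A ^ s.+2 * exp (- (A ^ 2) / 2))) (- (0 ^ s.+2 * exp (- (0 ^ 2) / 2)))).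
  apply: (is_RInt_derive (fun x => - (x ^ s.+2 * exp (- (x ^ 2) / 2)))) => x _.
    rewrite /ray; auto_derive => //; rewrite (_ : INR 2 = 2) // /Rdiv /=; field.
  apply: (continuous_plus (V := R_NormedModule)); first exact: cont_pow_ray.
  by apply: (continuous_scal_r (V := R_NormedModule)); exact: cont_pow_ray.
have E := is_RInt_unique _ _ _ _ H.
have I1 : ex_RInt (fun x => x ^ s.+2 * ray x) 0 A by apply: continuous_ex_RInt; exact: cont_pow_ray.
have I2 : ex_RInt (fun x => x ^ s * ray x) 0 A by apply: continuous_ex_RInt; exact: cont_pow_ray.
have := RInt_plus (V := R_CompleteNormedModule) _ _ _ _ I1 (ex_RInt_scal _ _ _ (- INR s.+2) I2).
have := RInt_scal (V := R_CompleteNormedModule) _ _ _ (- INR s.+2) I2.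
rewrite /plus /scal /= /mult /= => e1 e2.
rewrite e2 e1 in E; move: E; rewrite /minus /plus /opp /= !Rmult_0_l; lra.
Qed.

Lemma ray_moments : exists m1, forall s, improper (fun x => x ^ s * ray x) (rmom m1 s).
Proof.
have R0 A : RInt (fun x => x ^ 0 * ray x) 0 A = 1 - exp (- (A ^ 2) / 2).
  by rewrite -RInt_ray; apply: RInt_ext => x _; rewrite /= Rmult_1_l.
have I0 : improper (fun x => x ^ 0 * ray x) 1.
  split; first exact: cont_pow_ray.
  apply: (is_lim_ext (fun A => 1 - exp (- (A ^ 2) / 2))); first by move=> A; rewrite R0.
  have L := pow_gauss_lim (ltn0Sn 0).
  have Z : is_lim (fun A => exp (- (A ^ 2) / 2)) p_infty 0.
    apply: (is_lim_le_le_loc (fun _ => 0) _ _ _ _ _ (is_lim_const 0 _) L).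
    exists 1 => A A1; have := exp_pos (- (A ^ 2) / 2); rewrite pow_1; nra.
  have -> : Finite 1 = 1 - 0 by rewrite Rminus_0_r.
  by apply: is_lim_minus' Z; exact: is_lim_const.
have [m1 I1] : exists m1, improper (fun x => x ^ 1 * ray x) m1.
  (* x <= (1 + x^2) / 2, and the integrals of orders 0 and 2 are at most 1 and 2. *)
  apply: (@improper_exists _ (3 / 2)) => [|x x0|A A0]; first exact: cont_pow_ray.
    by rewrite pow_1; apply: Rmult_le_pos => //; exact: ray_ge0.
  apply: Rle_trans (_ : RInt (fun x => / 2 * (x ^ 0 * ray x + x ^ 2 * ray x)) 0 A <= _).
    apply: RInt_le => //; first by apply: continuous_ex_RInt; exact: cont_pow_ray.
      apply: continuous_ex_RInt => x; apply: (continuous_scal_r (V := R_NormedModule)).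
      by apply: (continuous_plus (V := R_NormedModule)); exact: cont_pow_ray.
    move=> x x0; have := ray_ge0 (Rlt_le _ _ (proj1 x0)); move=> r0; have := Rmult_le_pos _ _ (pow2_ge_0 (x - 1)) r0; rewrite /=; lra.
  have I1 : ex_RInt (fun x => x ^ 0 * ray x) 0 A by apply: continuous_ex_RInt; exact: cont_pow_ray.
  have I2 : ex_RInt (fun x => x ^ 2 * ray x) 0 A by apply: continuous_ex_RInt; exact: cont_pow_ray.
  have -> : RInt (fun x => / 2 * (x ^ 0 * ray x + x ^ 2 * ray x)) 0 A =
    / 2 * (RInt (fun x => x ^ 0 * ray x) 0 A + RInt (fun x => x ^ 2 * ray x) 0 A).
    have := RInt_scal (V := R_CompleteNormedModule) _ _ _ (/ 2) (ex_RInt_plus _ _ _ _ I1 I2).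
    rewrite (RInt_plus (V := R_CompleteNormedModule) _ _ _ _ I1 I2).
    by rewrite /plus /scal /= /mult /=.
  rewrite RInt_pow_ray R0; have := exp_pos (- (A ^ 2) / 2); rewrite !S_INR INR0 => e0; nra.
exists m1; elim/nat_ind2 => // s Hs _; split; first exact: cont_pow_ray.
apply: (is_lim_ext _ _ _ _ (fun A => esym (RInt_pow_ray s A))).
rewrite -[rmom m1 s.+2]/(INR s.+2 * rmom m1 s) -(Rminus_0_r (_ * _)).
apply: is_lim_minus'; last exact: pow_gauss_lim.
by have [_ L] := Hs; apply: (is_lim_scal_l _ (INR s.+2) _ _ L).
Qed.

(** * Moments of the Rayleigh law; Taylor and Poisson bounds *)

Section Wallis.
Variable m1 : R.
Hypothesis Hm : forall s, improper (fun x => x ^ s * ray x) (rmom m1 s).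

(** The integral of x^s (x - t)^2 against the density. *)
Lemma rmom_log_convex s t : 0 <= rmom m1 s.+2 - 2 * t * rmom m1 s.+1 + t ^ 2 * rmom m1 s.
Proof.
have H := improper_plus (improper_plus (Hm s.+2) (improper_scal (- 2 * t) (Hm s.+1)))
  (improper_scal (t ^ 2) (Hm s)).
have := improper_le improper0 H; rewrite (_ : _ + _ = rmom m1 s.+2 - 2 * t * rmom m1 s.+1 + t ^ 2 * rmom m1 s); last by ring.
apply=> x x0.
rewrite (_ : _ + _ = x ^ s * ray x * (x - t) ^ 2); last by rewrite /=; ring.
apply: Rmult_le_pos; last exact: pow2_ge_0.
by apply: Rmult_le_pos; [exact: pow_le|exact: ray_ge0].
Qed.

Lemma first_moment_pos : 0 < m1.
Proof.
(* With M_2 = 2 and M_3 = 3 m1, the case s = t = 1 reads 4 m1 - 4 >= 0. *)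
by have := rmom_log_convex 0 (/ 2); have := rmom_log_convex 1 1; rewrite /= !S_INR INR0; nra.
Qed.

Let Mp s : 0 < rmom m1 s. Proof. exact/rmom_pos/first_moment_pos. Qed.

Lemma rmom_sqr_le s : rmom m1 s.+1 ^ 2 <= rmom m1 s * rmom m1 s.+2.
Proof.
have p := Mp s; have := rmom_log_convex s (rmom m1 s.+1 / rmom m1 s).
rewrite (_ : _ - _ + _ = (rmom m1 s * rmom m1 s.+2 - rmom m1 s.+1 ^ 2) / rmom m1 s); last by field; lra.
move=> H; have := Rmult_le_pos _ _ H (Rlt_le _ _ p).
by rewrite /Rdiv Rmult_assoc Rinv_l; lra.
Qed.

(* Since M_(s+2) = (s+2) M_s, log-convexity squeezes (M_(s+1) / M_s)^2 between s+1 and s+2. *)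
Lemma rmom_ratio s :
  INR s.+1 * rmom m1 s ^ 2 <= rmom m1 s.+1 ^ 2 <= INR s.+2 * rmom m1 s ^ 2.
Proof.
have p := Mp s; have p1 := Mp s.+1; have E : rmom m1 s.+2 = INR s.+2 * rmom m1 s by [].
split; last by have := rmom_sqr_le s; rewrite E /=; lra.
case: s p p1 E => [|s] p p1 E.
  have := rmom_sqr_le 0; have := rmom_sqr_le 1; have := first_moment_pos.
  have -> : rmom m1 3 = 3 * m1 by rewrite -[rmom m1 3]/(INR 3 * m1) !S_INR INR0; ring.
  have -> : rmom m1 2 = 2 by rewrite -[rmom m1 2]/(INR 2 * 1) !S_INR INR0; ring.
  rewrite -[rmom m1 1]/m1 -[rmom m1 0]/1 INR1; nra.
have := rmom_sqr_le s; rewrite -[rmom m1 s.+2]/(INR s.+2 * rmom m1 s).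
have s2 := INR_pos (ltn0Sn s.+1); have q := Mp s => H.
have := Rmult_le_compat_l _ _ _ (Rlt_le _ _ s2) H; lra.
Qed.

(** Odd and even moments obey the same two-step recursion from different starts; their quotient is a
    Wallis product, expressed by [ww]. *)
Lemma rmom_odd k : rmom m1 k.*2.+1 = m1 * INR k.*2.+1 * ww k * rmom m1 k.*2.
Proof.
elim: k => [|k IH].
  by rewrite double0 /ww fact0 INR1 /=; field.
rewrite doubleS -[LHS]/(INR k.*2.+3 * rmom m1 k.*2.+1) IH -[rmom m1 k.*2.+2]/(INR k.*2.+2 * rmom m1 k.*2).
have -> : INR k.*2.+2 = 2 * INR k.+1 by rewrite !S_INR -addnn INRD; ring.
have := wwS k => w; rewrite (_ : m1 * INR k.*2.+3 * ww k.+1 * (2 * INR k.+1 * rmom m1 k.*2) =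
  m1 * INR k.*2.+3 * 2 * rmom m1 k.*2 * (INR k.+1 * ww k.+1)); last by ring.
rewrite w (_ : INR k.*2.+1 = 2 * INR k + 1); last by rewrite !S_INR -addnn INRD; ring.
by field.
Qed.

(** Identifies the constant of the trees with that of the integral. The square of M_(2k+1) / M_(2k),
    divided by 2k + 1, tends to 1 by [rmom_ratio]; by [rmom_odd] and the asymptotics of [ww] it
    tends to (2 m1 beta)^2. *)
Lemma wallis beta : 0 < beta -> is_lim_seq (fun n => bb n * rt n) beta -> m1 = / (2 * beta).
Proof.
move=> beta0 Hb; have m0 := first_moment_pos.
pose u k := m1 ^ 2 * (ww k * rt k) ^ 2 * (2 - / INR k.+1).
have L1 : is_lim_seq u (m1 ^ 2 * (sqrt 2 * beta) ^ 2 * (2 - 0)).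
  apply: is_lim_seq_mult'.
    apply: is_lim_seq_mult'; first exact: is_lim_seq_const.
    rewrite /pow; have W := ww_rt_lim beta0 Hb.
    apply: is_lim_seq_mult' => //; apply: is_lim_seq_mult' => //; exact: is_lim_seq_const.
  by apply: is_lim_seq_minus'; [exact: is_lim_seq_const|exact: is_lim_seq_invS].
have uE k : u k = m1 ^ 2 * INR k.*2.+1 * ww k ^ 2.
  rewrite /u Rpow_mult_distr rt_sqr (_ : INR k.*2.+1 = 2 * INR k.+1 - 1); last first.
    by rewrite !S_INR -addnn INRD; ring.
  field; exact: not_0_INR.
have L2 : is_lim_seq u 1.
  apply: (is_lim_seq_le_le (fun _ => 1) _ (fun k => 1 + / INR k.+1)).
  - move=> k; have [lo hi] := rmom_ratio k.*2.
    have M2 : 0 < rmom m1 k.*2 ^ 2 by exact/pow_lt/Mp.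
    have o0 := INR_pos (ltn0Sn k.*2); have k0 := INR_pos (ltn0Sn k).
    have E : rmom m1 k.*2.+1 ^ 2 = INR k.*2.+1 * u k * rmom m1 k.*2 ^ 2 by rewrite rmom_odd uE; ring.
    rewrite E in lo hi.
    have l2 := Rmult_le_reg_r _ _ _ M2 lo; have h2 := Rmult_le_reg_r _ _ _ M2 hi.
    split; first by nra.
    have -> : 1 + / INR k.+1 = (INR k.+1 + 1) / INR k.+1 by field; lra.
    apply: (Rmult_le_reg_l (INR k.*2.+1)) => //; apply: Rle_trans h2 _.
    have e1 : INR k.*2.+1 = 2 * INR k.+1 - 1 by rewrite !S_INR -addnn INRD; ring.
    have e2 : INR k.*2.+2 = 2 * INR k.+1 by rewrite !S_INR -addnn INRD; ring.
    rewrite e1 e2; have : 1 <= INR k.+1 by apply: (le_INR 1); lia.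
    move: (INR k.+1) k0 => q q0 q1.
    have : 0 <= (q - 1) / q by apply: Rmult_le_pos; [lra|exact/Rlt_le/Rinv_0_lt_compat].
    rewrite (_ : (2 * q - 1) * ((q + 1) / q) = 2 * q + (q - 1) / q); last by field; lra.
    lra.
  - exact: is_lim_seq_const.
  have -> : Finite 1 = 1 + 0 by rewrite Rplus_0_r.
  by apply: is_lim_seq_plus'; [exact: is_lim_seq_const|exact: is_lim_seq_invS].
have := is_lim_seq_unique _ _ L1; rewrite (is_lim_seq_unique _ _ L2) => -[E].
have s2 : sqrt 2 * sqrt 2 = 2 by rewrite sqrt_sqrt //; lra.
have F : (2 * m1 * beta) ^ 2 = 1 ^ 2.
  transitivity (m1 * (m1 * 1) * (sqrt 2 * sqrt 2 * beta ^ 2) * (2 - 0)); first by rewrite s2; ring.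
  by rewrite pow1 [RHS]E; ring.
have : 2 * m1 * beta = 1.
  apply: Rsqr_inj; [apply: Rmult_le_pos; nra|lra|].
  by rewrite !Rsqr_pow2.
by move=> G; apply: (Rmult_eq_reg_r (2 * beta)); [rewrite Rinv_l; lra|lra].
Qed.

(** Ratio test: consecutive moments grow by a factor of order sqrt k only, against k + 1 in the
    factorial. All truncation errors of the limit laws have this form. *)
Lemma rmom_exp_small rho l : 0 <= rho ->
  is_lim_seq (fun k => rho ^ k * rmom m1 (l + k) / INR k`!) 0.
Proof.
case=> [r0|<-]; last first.
  apply: is_lim_seq_ext_loc (is_lim_seq_const 0); exists 1%nat => -[|k] H; first lia.
  by rewrite /= /Rdiv !Rmult_0_l.
pose a k := rho ^ k * rmom m1 (l + k) / INR k`!.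
have ap k : 0 < a k.
  by apply: Rdiv_lt_0_compat; [apply: Rmult_lt_0_compat => //; exact: pow_lt|exact: fact_pos].
have rE k : a k.+1 / a k = rho * (rmom m1 (l + k).+1 / rmom m1 (l + k)) / INR k.+1.
  rewrite /a addnS factS INRM /=.
  have := Mp (l + k); have := fact_pos k; have := INR_pos (ltn0Sn k); have := pow_lt _ k r0 => *.
  by field; lra.
have D : is_lim_seq (fun k => Rabs (a k.+1 / a k)) 0.
  apply: (is_lim_seq_le_le (fun _ => 0) _ (fun k => rho * sqrt (INR l.+2) * / rt k)).
  - move=> k; rewrite Rabs_pos_eq; last by apply/Rlt_le/Rdiv_lt_0_compat.
    split; first by apply/Rlt_le/Rdiv_lt_0_compat.
    have [_ hi] := rmom_ratio (l + k); have M0 := Mp (l + k); have M1 := Mp (l + k).+1.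
    have sq : (rmom m1 (l + k).+1 / rmom m1 (l + k)) ^ 2 <= INR l.+2 * INR k.+1.
      apply: (Rmult_le_reg_r (rmom m1 (l + k) ^ 2)); first exact: pow_lt.
      rewrite (_ : (_ / _) ^ 2 * _ = rmom m1 (l + k).+1 ^ 2); last by field; lra.
      apply: Rle_trans hi _; apply: Rmult_le_compat_r; first exact: pow2_ge_0.
      rewrite !S_INR INRD; have := pos_INR l; have := pos_INR k; nra.
    have r1 : rmom m1 (l + k).+1 / rmom m1 (l + k) <= sqrt (INR l.+2) * rt k.
      apply: Rsqr_incr_0_var; last by apply: Rmult_le_pos; [exact: sqrt_pos|exact/Rlt_le/rt_pos].
      by rewrite !Rsqr_pow2 Rpow_mult_distr rt_sqr pow2_sqrt //; exact: pos_INR.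
    rewrite rE (_ : rho * sqrt (INR l.+2) * / rt k = rho * (sqrt (INR l.+2) * rt k) / INR k.+1); last first.
      by rewrite -(rt_sqr k); have := rt_pos k => *; field; lra.
    apply: Rmult_le_compat_r; first exact/Rlt_le/Rinv_0_lt_compat/INR_pos.
    by apply: Rmult_le_compat_l; lra.
  - exact: is_lim_seq_const.
  have -> : Finite 0 = rho * sqrt (INR l.+2) * 0 by rewrite Rmult_0_r.
  by apply: is_lim_seq_mult'; [exact: is_lim_seq_const|exact: rt_inv_lim].
have an k : a k <> 0 by have := ap k; lra.
have S := ex_series_DAlembert a 0 Rlt_0_1 an D.
apply: is_lim_seq_ext (ex_series_lim_0 _ S) => k.
by rewrite Rabs_pos_eq //; exact/Rlt_le/ap.
Qed.
End Wallis.

(** * Alternating Taylor polynomials of the exponential *)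

Definition alt_taylor (k : nat) (y : R) : R := \big[Rplus/0]_(i < k) ((- y) ^ i / INR i`!).

Lemma is_derive_alt_taylor k y : is_derive (alt_taylor k.+1) y (- alt_taylor k y).
Proof.
have -> : - alt_taylor k y = \big[Rplus/0]_(i < k.+1) (if (i : nat) is i'.+1 then - ((- y) ^ i' / INR i'`!) else 0).
  rewrite big_ord_recl Rplus_0_l.
  have -> : - alt_taylor k y = -1 * alt_taylor k y by ring.
  by rewrite /alt_taylor big_distrr; apply: eq_bigr => i _ /=; ring.
apply: (@is_derive_big _ _ (fun (i : 'I_k.+1) y => (- y) ^ i / INR i`!)
  (fun (i : 'I_k.+1) y => if (i : nat) is i'.+1 then - ((- y) ^ i' / INR i'`!) else 0)) => -[i ik] /=.
case: i {ik} => [|i]; first by apply: is_derive_ext (is_derive_const (1 / INR 0`!) y).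
have i1 : INR i.+1 <> 0 by exact: not_0_INR.
have fi := fact_pos i; auto_derive => //; rewrite factS INRM /=; field; lra.
Qed.

(* With Q_k = (-1)^k (e^-y - Taylor polynomial with k terms), Q_(k+1)' = Q_k. *)
Lemma alt_taylor_bound k y : 0 <= y ->
  0 <= (-1) ^ k * (exp (- y) - alt_taylor k y) <= y ^ k / INR k`!.
Proof.
elim: k y => [|k IH] y y0.
  rewrite /alt_taylor big_ord0 fact0 INR1 /=.
  have := exp_pos (- y); have : exp (- y) <= 1 by apply: exp_le1; lra.
  lra.
have D t : is_derive (fun y => (-1) ^ k.+1 * (exp (- y) - alt_taylor k.+1 y)) t
    ((-1) ^ k * (exp (- t) - alt_taylor k t)).
  have := is_derive_scal (fun y => exp (- y) - alt_taylor k.+1 y) t ((-1) ^ k.+1)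
     (- exp (- t) - - alt_taylor k t).
  rewrite (_ : (-1) ^ k.+1 * _ = (-1) ^ k * (exp (- t) - alt_taylor k t)); last by rewrite /=; ring.
  apply; apply: (is_derive_minus (V := R_NormedModule)); last exact: is_derive_alt_taylor.
  by auto_derive => //; ring.
have E0 : alt_taylor k.+1 0 = 1.
  rewrite /alt_taylor big_ord_recl big1 => [|i _]; first by rewrite fact0 INR1 /=; field.
  by rewrite lift0 Ropp_0 /= Rmult_0_l /Rdiv Rmult_0_l.
split.
  apply: (@nonneg_of_derive (fun y => (-1) ^ k.+1 * (exp (- y) - alt_taylor k.+1 y))
    (fun t => (-1) ^ k * (exp (- t) - alt_taylor k t))) => // [t t0|].
    by case: (IH t t0).
  by rewrite E0 Ropp_0 exp_0; right; ring.
suff : 0 <= y ^ k.+1 / INR k.+1`! - (-1) ^ k.+1 * (exp (- y) - alt_taylor k.+1 y) by lra.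
apply: (@nonneg_of_derive (fun y => y ^ k.+1 / INR k.+1`! - (-1) ^ k.+1 * (exp (- y) - alt_taylor k.+1 y))
  (fun t => t ^ k / INR k`! - (-1) ^ k * (exp (- t) - alt_taylor k t))) => // [t t0|t t0|].
- apply: (is_derive_minus (V := R_NormedModule)); last exact: D.
  auto_derive => //; rewrite factS INRM /=; field.
  by split; [have := fact_pos k; lra|exact: not_0_INR].
- by have := IH t t0; lra.
by rewrite E0 Ropp_0 exp_0; right; rewrite /= /Rdiv; ring.
Qed.

Lemma alt_taylor_abs k y : 0 <= y -> Rabs (exp (- y) - alt_taylor k y) <= y ^ k / INR k`!.
Proof.
move=> y0; have [lo hi] := alt_taylor_bound k y0.
have -> : Rabs (exp (- y) - alt_taylor k y) = Rabs ((-1) ^ k * (exp (- y) - alt_taylor k y)).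
  by rewrite Rabs_mult pow_1_abs Rmult_1_l.
by rewrite Rabs_pos_eq.
Qed.

(** * Poisson distribution functions and Chebyshev bounds *)

Definition poisson_term (y : R) (l : nat) : R := y ^ l / INR l`!.
(** P(Poisson(y) < L), with strict inequality; [poisson_term] lacks the factor exp(- y). *)
Definition poisson_cdf (y : R) (L : nat) : R := exp (- y) * \big[Rplus/0]_(l < L) poisson_term y l.

Lemma poisson_term_ge0 y l : 0 <= y -> 0 <= poisson_term y l.
Proof.
move=> y0; apply: Rmult_le_pos; first exact: pow_le.
exact/Rlt_le/Rinv_0_lt_compat/fact_pos.
Qed.

Lemma poisson_termS y l : INR l.+1 * poisson_term y l.+1 = y * poisson_term y l.
Proof.
rewrite /poisson_term factS INRM /=; field.
by split; [have := fact_pos l; lra|exact: not_0_INR].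
Qed.

Lemma is_derive_poisson_cdf L y :
  is_derive (fun y => poisson_cdf y L.+1) y (- (exp (- y) * poisson_term y L)).
Proof.
elim: L y => [|L IH] y.
  apply: (is_derive_ext (fun y => exp (- y))).
    by move=> t; rewrite /poisson_cdf big_ord1 /poisson_term fact0 INR1 /=; field.
  by rewrite /poisson_term fact0 INR1 /=; auto_derive => //; field.
apply: (is_derive_ext (fun y => poisson_cdf y L.+1 + exp (- y) * poisson_term y L.+1)).
  by move=> t; rewrite {2}/poisson_cdf big_ord_recr /= Rmult_plus_distr_l.
have D : is_derive (fun y => exp (- y) * poisson_term y L.+1) y
    (exp (- y) * poisson_term y L - exp (- y) * poisson_term y L.+1).
  rewrite /poisson_term; auto_derive => //; rewrite factS INRM /=; field.
  by split; [have := fact_pos L; lra|exact: not_0_INR].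
have := is_derive_plus (V := R_NormedModule) _ _ _ _ _ (IH y) D.
by congr is_derive; rewrite /plus /=; ring.
Qed.

Lemma poisson_cdf_bound L y : 0 <= y -> 0 <= 1 - poisson_cdf y L <= y ^ L / INR L`!.
Proof.
case: L => [|L] y0; first by rewrite /poisson_cdf big_ord0 fact0 INR1 /=; lra.
have D t : is_derive (fun y => 1 - poisson_cdf y L.+1) t (exp (- t) * poisson_term t L).
  have := is_derive_minus (V := R_NormedModule) _ _ _ _ _ (is_derive_const 1 t) (is_derive_poisson_cdf L t).
  by congr is_derive; rewrite /minus /plus /opp /zero /=; ring.
have E0 : poisson_cdf 0 L.+1 = 1.
  rewrite /poisson_cdf big_ord_recl big1 => [|i _].
    by rewrite /poisson_term Ropp_0 exp_0 fact0 INR1 /=; field.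
  by rewrite lift0 /poisson_term /= Rmult_0_l /Rdiv Rmult_0_l.
have e1 t : 0 <= t -> exp (- t) <= 1 by move=> t0; apply: exp_le1; lra.
split.
  apply: (@nonneg_of_derive (fun y => 1 - poisson_cdf y L.+1)
    (fun t => exp (- t) * poisson_term t L)) => // [t t0|]; last by rewrite E0; lra.
  by apply: Rmult_le_pos; [exact/Rlt_le/exp_pos|exact: poisson_term_ge0].
suff : 0 <= y ^ L.+1 / INR L.+1`! - (1 - poisson_cdf y L.+1) by lra.
apply: (@nonneg_of_derive (fun y => y ^ L.+1 / INR L.+1`! - (1 - poisson_cdf y L.+1))
  (fun t => poisson_term t L - exp (- t) * poisson_term t L)) => // [t t0|t t0|].
- apply: (is_derive_minus (V := R_NormedModule)); last exact: D.
  rewrite /poisson_term; auto_derive => //; rewrite factS INRM /=; field.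
  by split; [have := fact_pos L; lra|exact: not_0_INR].
- by have := e1 t t0; have := poisson_term_ge0 L t0; nra.
by rewrite E0 /= Rmult_0_l /Rdiv Rmult_0_l; lra.
Qed.

(** The Poisson variance for a truncated sum, with its exact boundary term; this term has a
    favourable sign once N >= y. *)
Lemma poisson_variance y N :
  \big[Rplus/0]_(l < N) ((INR l - y) ^ 2 * poisson_term y l) =
  y * \big[Rplus/0]_(l < N) poisson_term y l - INR N * (INR N - y) * poisson_term y N.
Proof.
elim: N => [|N IH]; first by rewrite !big_ord0 INR0; ring.
rewrite !big_ord_recr /= IH /=.
rewrite (_ : INR N.+1 * (INR N.+1 - y) * poisson_term y N.+1 =
  (INR N.+1 - y) * (INR N.+1 * poisson_term y N.+1)); last by ring.
rewrite poisson_termS S_INR; ring.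
Qed.

Lemma poisson_variance_le y N : 0 <= y -> y <= INR N ->
  exp (- y) * \big[Rplus/0]_(l < N) ((INR l - y) ^ 2 * poisson_term y l) <= y.
Proof.
move=> y0 yN; rewrite poisson_variance.
have := poisson_cdf_bound N y0; rewrite /poisson_cdf => -[h _].
have : 0 <= INR N * (INR N - y) * poisson_term y N.
  apply: Rmult_le_pos; last exact: poisson_term_ge0.
  by apply: Rmult_le_pos; [exact: pos_INR|lra].
have := exp_pos (- y) => e0 q0.
have := Rmult_le_pos _ _ (Rlt_le _ _ e0) q0; nra.
Qed.

(** Chebyshev's inequality for values at most L <= y; the variance sum is truncated just above y, so
    it stays finite. *)
Lemma poisson_lower_tail y L : 0 <= y -> INR L.+1 <= y + 1 ->
  poisson_cdf y L.+1 * (y - INR L) ^ 2 <= y.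
Proof.
rewrite S_INR => y0 Ly; have [N HN] := nfloor_ex y y0.
have LN : (L.+1 <= N.+1)%nat.
  by rewrite ltnS leqNgt; apply/negP => /leP/le_INR; rewrite S_INR; lra.
apply: Rle_trans (@poisson_variance_le y N.+1 y0 _); last by rewrite S_INR; lra.
rewrite /poisson_cdf Rmult_assoc; apply: Rmult_le_compat_l; first exact/Rlt_le/exp_pos.
rewrite -!(big_mkord xpredT (fun l => (INR l - y) ^ 2 * poisson_term y l)) (big_cat_nat (n := L.+1)) //= big_mkord.
rewrite -[X in X <= _]Rplus_0_r; apply: Rplus_le_compat; last first.
  by apply: Rsum_ge0 => i _; apply: Rmult_le_pos; [exact: pow2_ge_0|exact: poisson_term_ge0].
rewrite Rmult_comm big_distrr; apply: Rsum_le => i _ /=.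
apply: Rmult_le_compat_r; first exact: poisson_term_ge0.
have : INR i <= INR L by apply: le_INR; have := ltn_ord i; lia.
nra.
Qed.

(** Chebyshev's inequality again. The infinite tail is cut at N, and the rest, at most y^N / N!,
    vanishes as N grows. *)
Lemma poisson_upper_tail y L : 0 <= y -> y <= INR L ->
  (1 - poisson_cdf y L) * (INR L - y) ^ 2 <= y.
Proof.
move=> y0 yL.
have Z : is_lim_seq (fun N => y ^ N / INR N`!) 0.
  apply/is_lim_seq_Reals => eps e0; have [N HN] := cv_speed_pow_fact y eps e0.
  exists N => n Nn; have := HN n Nn; rewrite (_ : Factorial.fact n = n`!) //.
  by elim: n {Nn} => // n IH; rewrite factS /= IH.
have B : is_lim_seq (fun N => y + y ^ N / INR N`! * (INR L - y) ^ 2) (y + 0 * (INR L - y) ^ 2).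
  apply: is_lim_seq_plus'; first exact: is_lim_seq_const.
  by apply: is_lim_seq_mult' => //; exact: is_lim_seq_const.
rewrite Rmult_0_l Rplus_0_r in B.
apply: (is_lim_seq_le_loc (fun _ => _) _ (Finite _) (Finite _) _ (is_lim_seq_const _) B).
exists L => N /leP LN; have [_ h] := poisson_cdf_bound N y0.
have yN : y <= INR N by apply: Rle_trans yL _; apply: le_INR; exact/leP.
have V := poisson_variance_le y0 yN.
suff : (poisson_cdf y N - poisson_cdf y L) * (INR L - y) ^ 2 <= y.
  by have := pow2_ge_0 (INR L - y); nra.
apply: Rle_trans V.
rewrite /poisson_cdf -Rmult_minus_distr_l Rmult_assoc; apply: Rmult_le_compat_l; first exact/Rlt_le/exp_pos.
have split F : \big[Rplus/0]_(l < N) F (l : nat) =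
    \big[Rplus/0]_(l < L) F (l : nat) + \big[Rplus/0]_(L <= l < N) F l.
  by rewrite -!(big_mkord xpredT) (big_cat_nat (n := L)).
rewrite (split (poisson_term y)) (split (fun l => (INR l - y) ^ 2 * poisson_term y l)).
rewrite (_ : _ + _ - _ = \big[Rplus/0]_(L <= i < N) poisson_term y i); last by ring.
rewrite -[X in X <= _]Rplus_0_l; apply: Rplus_le_compat.
  by apply: Rsum_ge0 => i _; apply: Rmult_le_pos; [exact: pow2_ge_0|exact: poisson_term_ge0].
rewrite Rmult_comm big_distrr big_nat [X in _ <= X]big_nat; apply: Rsum_le => i /andP[Li _] /=.
apply: Rmult_le_compat_r; first exact: poisson_term_ge0.
have : INR L <= INR i by apply: le_INR; exact/leP.
nra.
Qed.

(** * Gamma and Laplace integrals *)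

Lemma Rpower_half t s : 0 < t -> Rpower t (INR s / 2) = sqrt t ^ s.
Proof.
move=> t0; rewrite (_ : INR s / 2 = / 2 * INR s); last by field.
by rewrite -Rpower_mult Rpower_sqrt // Rpower_pow //; exact: sqrt_lt_R0.
Qed.

Lemma is_derive_RInt0 (h : R -> R) A : (forall x, continuous h x) ->
  is_derive (fun A => RInt h 0 A) A (h A).
Proof.
move=> hc; apply: (is_derive_RInt (V := R_NormedModule) h (fun A => RInt h 0 A) 0) => //.
apply: filter_forall => b; apply: (RInt_correct (V := R_CompleteNormedModule)).
exact: continuous_ex_RInt.
Qed.

(** E(X^l exp(- rho X)), the integral in [mpo_pmf]. *)
Definition lap (l : nat) (rho : R) : R :=
  RInt_gen (fun x => x ^ l * exp (- rho * x) * ray x) (at_point 0) (Rbar_locally p_infty).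

Lemma cont_lap l rho x : continuous (fun x => x ^ l * exp (- rho * x) * ray x) x.
Proof. by apply: ex_derive_continuous; rewrite /ray; auto_derive. Qed.

Section RayleighIntegrals.
Variable m1 : R.
Hypothesis Hm : forall s, improper (fun x => x ^ s * ray x) (rmom m1 s).

(* Substituting t = x^2 / 2 in the Gamma integral. *)
Lemma Gamma_rmom s : Rpower 2 (INR s / 2) * Gamma (INR s / 2 + 1) = rmom m1 s.
Proof.
pose h x := x ^ s * ray x; pose J A := RInt h 0 A.
(* [Phi] is a primitive of the Gamma integrand on t > 0. It extends continuously to 0 with value 0,
   which settles the lower limit of integration. *)
have hc : forall x, continuous h x by exact: cont_pow_ray.
pose c := / Rpower 2 (INR s / 2); pose Phi t := c * J (sqrt (2 * t)).
have c0 : 0 < Rpower 2 (INR s / 2) by exact: exp_pos.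
pose g t := Rpower t (INR s / 2 + 1 - 1) * exp (- t).
have gE t : 0 < t -> g t = sqrt t ^ s * exp (- t).
  by move=> t0; rewrite /g -Rpower_half // (_ : INR s / 2 + 1 - 1 = INR s / 2) //; ring.
have D t : 0 < t -> is_derive Phi t (g t).
  move=> t0; have st : 0 < sqrt t by exact: sqrt_lt_R0.
  have s2 : 0 < sqrt 2 by apply: sqrt_lt_R0; lra.
  have sE : sqrt (2 * t) = sqrt 2 * sqrt t by rewrite sqrt_mult_alt //; lra.
  have D1 : is_derive (fun t => sqrt (2 * t)) t (/ sqrt (2 * t)).
    auto_derive; first lra.
    by rewrite sE; field; lra.
  have D2 := is_derive_comp J (fun t => sqrt (2 * t)) t _ _ (is_derive_RInt0 (sqrt (2 * t)) hc) D1.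
  have D3 := is_derive_scal _ t c _ D2.
  rewrite (_ : g t = c * scal (/ sqrt (2 * t)) (h (sqrt (2 * t)))) //.
  rewrite gE // /scal /= /mult /= /h /ray /rayleigh_density /c Rpower_half; last lra.
  rewrite (_ : - sqrt (2 * t) ^ 2 / 2 = - t); last first.
    by rewrite pow2_sqrt; [field|lra].
  rewrite sE Rpow_mult_distr; have : 0 < sqrt 2 ^ s by exact: pow_lt.
  by move=> p2; field; lra.
have IG a b : 0 < a -> a <= b -> is_RInt g a b (Phi b - Phi a).
  move=> a0 ab; apply: (is_RInt_derive Phi) => t; rewrite Rmin_left // => -[at' _].
    by apply: D; lra.
  apply: (continuous_ext_loc _ (fun t => exp (INR s / 2 * ln t) * exp (- t))).
    by apply: filter_forall => u; rewrite /g /Rpower (_ : INR s / 2 + 1 - 1 = INR s / 2) //; ring.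
  by apply: ex_derive_continuous; auto_derive; lra.
have L : is_RInt_gen g (at_right 0) (Rbar_locally p_infty) (c * rmom m1 s).
  move=> P [eps HP].
  have e2 : 0 < eps / 2 by have := cond_pos eps; lra.
  have [_ Jl] := Hm s.
  have Cl : is_lim (fun A => c * J A) p_infty (c * rmom m1 s) := is_lim_scal_l _ c _ _ Jl.
  move/is_lim_spec: Cl => /(_ (mkposreal _ e2)) [M HM].
  have C0 : continuous Phi 0.
    apply: (continuous_scal_r (V := R_NormedModule)).
    apply: (continuous_comp (fun t => sqrt (2 * t)) J).
      apply: (continuous_comp (fun t => 2 * t) sqrt).
        by apply: ex_derive_continuous; auto_derive.
      by apply/continuity_pt_filterlim/continuity_pt_sqrt; lra.
    by apply: ex_derive_continuous; eexists; exact: is_derive_RInt0.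
  have P0 : Phi 0 = 0.
    by rewrite /Phi /J Rmult_0_r sqrt_0 (RInt_point (V := R_CompleteNormedModule)) /zero /= Rmult_0_r.
  have HQ : at_right 0 (fun a => 0 < a /\ Rabs (Phi a) < eps / 2).
    have := C0 _ (locally_ball (Phi 0) (mkposreal _ e2)) => -[d Hd].
    exists d => y yd y0; split=> //.
    by have := Hd y yd; rewrite /ball /= /AbsRing_ball /abs /minus /plus /opp /= P0 Ropp_0 Rplus_0_r.
  apply: (Filter_prod _ _ _ (fun a => (0 < a /\ Rabs (Phi a) < eps / 2) /\ a < 1)
    (fun b => Rmax 1 ((Rmax M 0) ^ 2) < b)) => /=.
  - apply: filter_and => //; exists (mkposreal _ Rlt_0_1) => y.
    by rewrite /ball /= /AbsRing_ball /abs /minus /plus /opp /= Ropp_0 Rplus_0_r => /Rabs_def2; lra.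
  - by exists (Rmax 1 ((Rmax M 0) ^ 2)).
  move=> a b [[a0 Pa] a1] bM; have b1 := Rle_lt_trans _ _ _ (Rmax_l _ _) bM.
  have bM2 := Rle_lt_trans _ _ _ (Rmax_r _ _) bM.
  exists (Phi b - Phi a); split; first by apply: IG; lra.
  have Mb : M < sqrt (2 * b).
    apply: Rle_lt_trans (Rmax_l M 0) _.
    rewrite -(sqrt_pow2 (Rmax M 0)); last exact: Rmax_r.
    by apply: sqrt_lt_1_alt; split; [exact: pow2_ge_0|lra].
  apply: HP; rewrite /ball /= /AbsRing_ball /abs /minus /plus /opp /=.
  have /Rabs_def2 /= H1 := HM _ Mb; move/Rabs_def2: Pa => H2.
  by apply: Rabs_def1; rewrite -/(Phi b) in H1; lra.
rewrite /Gamma (is_RInt_gen_unique (V := R_CompleteNormedModule) _ _ L) /c.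
by rewrite -Rmult_assoc Rinv_r ?Rmult_1_l //; lra.
Qed.

Lemma lap_improper l rho : 0 <= rho -> improper (fun x => x ^ l * exp (- rho * x) * ray x) (lap l rho).
Proof.
move=> r0.
have le x : 0 <= x -> x ^ l * exp (- rho * x) * ray x <= x ^ l * ray x.
  move=> x0; have e1 : exp (- rho * x) <= 1 by apply: exp_le1; nra.
  have p : 0 <= x ^ l * ray x by apply: Rmult_le_pos; [exact: pow_le|exact: ray_ge0].
  by nra.
suff [I HI] : exists I, improper (fun x => x ^ l * exp (- rho * x) * ray x) I.
  by rewrite /lap (is_RInt_gen_unique (V := R_CompleteNormedModule) _ _ (improper_is_RInt_gen HI)).
apply: (@improper_exists _ (rmom m1 l)) => [x|x x0|A A0]; first exact: cont_lap.
  apply: Rmult_le_pos; last exact: ray_ge0.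
  by apply: Rmult_le_pos; [exact: pow_le|exact/Rlt_le/exp_pos].
apply: Rle_trans (_ : RInt (fun x => x ^ l * ray x) 0 A <= _).
  apply: RInt_le => //; first by apply: continuous_ex_RInt; exact: cont_lap.
    by apply: continuous_ex_RInt; exact: cont_pow_ray.
  by move=> x x0; apply: le; lra.
have [hc hl] := Hm l.
apply: (is_lim_le_loc _ _ p_infty (Finite _) (Finite _) _ (is_lim_const _ _) hl).
exists A => B AB; rewrite (@RInt_split _ 0 A B hc).
suff : 0 <= RInt (fun x => x ^ l * ray x) A B by lra.
apply: RInt_ge0 => // [|x Ax]; first lra.
by apply: Rmult_le_pos; [apply: pow_le|apply: ray_ge0]; lra.
Qed.

Lemma improper_abs_le h k l m : improper h l -> improper k m ->
  (forall x, 0 <= x -> Rabs (h x) <= k x) -> Rabs l <= m.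
Proof.
move=> H K hk.
apply: Rabs_le; split; last first.
  by apply: (improper_le H K) => x x0; have := hk x x0; have := Rle_abs (h x); lra.
have := improper_le (improper_scal (-1) H) K => H2.
suff : -1 * l <= m by lra.
by apply: H2 => x x0; have := hk x x0; have := Rle_abs (- h x); rewrite Rabs_Ropp; lra.
Qed.

Lemma lap_taylor l rho k : 0 <= rho ->
  Rabs (lap l rho - \big[Rplus/0]_(i < k) ((- rho) ^ i / INR i`! * rmom m1 (l + i))) <=
  rho ^ k * rmom m1 (l + k) / INR k`!.
Proof.
move=> r0.
have S : improper (fun x => \big[Rplus/0]_(i < k) ((- rho) ^ i / INR i`! * (x ^ (l + i) * ray x)))
    (\big[Rplus/0]_(i < k) ((- rho) ^ i / INR i`! * rmom m1 (l + i))).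
  by apply: improper_big => i; apply: improper_scal.
have H := improper_plus (lap_improper l r0) (improper_scal (-1) S).
have K := improper_scal (rho ^ k / INR k`!) (Hm (l + k)).
rewrite (_ : _ - _ = lap l rho + -1 * \big[Rplus/0]_(i < k) ((- rho) ^ i / INR i`! * rmom m1 (l + i))); last by ring.
rewrite (_ : _ / _ = rho ^ k / INR k`! * rmom m1 (l + k)); last by rewrite /Rdiv; ring.
apply: (improper_abs_le H K) => x x0.
have -> : x ^ l * exp (- rho * x) * ray x +
    -1 * \big[Rplus/0]_(i < k) ((- rho) ^ i / INR i`! * (x ^ (l + i) * ray x)) =
    x ^ l * ray x * (exp (- (rho * x)) - alt_taylor k (rho * x)).
  rewrite (_ : \big[Rplus/0]_(i < k) _ = x ^ l * ray x * alt_taylor k (rho * x)).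
    by rewrite Ropp_mult_distr_l; ring.
  rewrite big_distrr; apply: eq_bigr => i _ /=.
  by rewrite pow_add Ropp_mult_distr_l Rpow_mult_distr /Rdiv; ring.
rewrite Rabs_mult Rabs_pos_eq; last by apply: Rmult_le_pos; [exact: pow_le|exact: ray_ge0].
apply: Rle_trans (_ : x ^ l * ray x * ((rho * x) ^ k / INR k`!) <= _).
  apply: Rmult_le_compat_l; first by apply: Rmult_le_pos; [exact: pow_le|exact: ray_ge0].
  by apply: alt_taylor_abs; apply: Rmult_le_pos.
by right; rewrite pow_add Rpow_mult_distr /Rdiv; ring.
Qed.

Lemma poisson_cdf_improper rho s L : 0 <= rho ->
  improper (fun x => x ^ s * poisson_cdf (rho * x) L * ray x)
    (\big[Rplus/0]_(l < L) (rho ^ l / INR l`! * lap (l + s) rho)).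
Proof.
move=> r0.
have S : improper (fun x => \big[Rplus/0]_(l < L) (rho ^ l / INR l`! * (x ^ (l + s) * exp (- rho * x) * ray x)))
    (\big[Rplus/0]_(l < L) (rho ^ l / INR l`! * lap (l + s) rho)).
  by apply: improper_big => i; apply/improper_scal/lap_improper.
apply: improper_ext S => x; rewrite /poisson_cdf.
rewrite (_ : _ * _ * _ = x ^ s * exp (- (rho * x)) * ray x * \big[Rplus/0]_(l < L) poisson_term (rho * x) l); last by ring.
rewrite big_distrr; apply: eq_bigr => l _.
rewrite /poisson_term pow_add Rpow_mult_distr Ropp_mult_distr_l /Rdiv /=; ring.
Qed.

(** The sum is a truncated s-th factorial moment of MPo(rho X). Up to rho^s the difference is E(X^s
    P(Poisson(rho X) >= N)), and [poisson_cdf_bound] applies under the integral. *)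
Lemma mixed_poisson_moment rho s N : 0 <= rho ->
  Rabs (rho ^ s * rmom m1 s - \big[Rplus/0]_(l < N) (rho ^ (l + s) / INR l`! * lap (l + s) rho)) <=
  rho ^ s * (rho ^ N * rmom m1 (s + N) / INR N`!).
Proof.
move=> r0.
rewrite (_ : \big[Rplus/0]_(l < N) _ = rho ^ s * \big[Rplus/0]_(l < N) (rho ^ l / INR l`! * lap (l + s) rho)); last first.
  by rewrite big_distrr; apply: eq_bigr => l _; rewrite pow_add /Rdiv /=; ring.
rewrite -Rmult_minus_distr_l Rabs_mult Rabs_pos_eq; last exact: pow_le.
apply: Rmult_le_compat_l; first exact: pow_le.
have H := improper_plus (Hm s) (improper_scal (-1) (poisson_cdf_improper s N r0)).
have K := improper_scal (rho ^ N / INR N`!) (Hm (s + N)).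
rewrite (_ : _ - _ = rmom m1 s + -1 * \big[Rplus/0]_(l < N) (rho ^ l / INR l`! * lap (l + s) rho)); last by ring.
rewrite (_ : rho ^ N * _ / _ = rho ^ N / INR N`! * rmom m1 (s + N)); last by rewrite /Rdiv; ring.
apply: (improper_abs_le H K) => x x0.
rewrite (_ : _ + _ = x ^ s * ray x * (1 - poisson_cdf (rho * x) N)); last by ring.
have p : 0 <= x ^ s * ray x by apply: Rmult_le_pos; [exact: pow_le|exact: ray_ge0].
have [lo hi] := poisson_cdf_bound N (Rmult_le_pos _ _ r0 x0).
rewrite Rabs_pos_eq; last exact: Rmult_le_pos.
apply: Rle_trans (Rmult_le_compat_l _ _ _ p hi) _.
by right; rewrite pow_add Rpow_mult_distr /Rdiv; ring.
Qed.
End RayleighIntegrals.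

(** * From factorial moments to limit laws *)

(** Exchange of limits for truncated expansions: K is fixed so that both truncation errors are
    small, and only then n grows. *)
Lemma is_lim_seq_bracket (u : nat -> R) (L : R) (v w : nat -> nat -> R) (V W W' : nat -> R) :
  (forall K n, Rabs (u n - v K n) <= w K n) ->
  (forall K, is_lim_seq (v K) (V K)) -> (forall K, is_lim_seq (w K) (W K)) ->
  (forall K, Rabs (L - V K) <= W' K) ->
  is_lim_seq W 0 -> is_lim_seq W' 0 -> is_lim_seq u L.
Proof.
move=> uv vV wW LV W0 W0'; apply/is_lim_seq_spec => eps.
have e0 := cond_pos eps.
have e4 : 0 < eps / 4 by lra.
move/is_lim_seq_spec: W0 => /(_ (mkposreal _ e4)) [K1 H1].
move/is_lim_seq_spec: W0' => /(_ (mkposreal _ e4)) [K2 H2].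
set K := maxn K1 K2; have HW := H1 K ltac:(lia); have HW' := H2 K ltac:(lia).
rewrite /= !Rminus_0_r in HW HW'.
move/is_lim_seq_spec: (vV K) => /(_ (mkposreal _ e4)) [N1 G1].
move/is_lim_seq_spec: (wW K) => /(_ (mkposreal _ e4)) [N2 G2].
exists (maxn N1 N2) => n /leP nN.
have {G1} g1 := G1 n ltac:(lia); have {G2} g2 := G2 n ltac:(lia); rewrite /= in g1 g2.
move: (uv K n) (LV K) => a b.
have := Rle_abs (W K); have := Rle_abs (W' K).
move: g1 g2 a b => /Rabs_def2 g1 /Rabs_def2 g2 /Rabs_le_between a /Rabs_le_between b c d.
by apply: Rabs_def1; lra.
Qed.

Lemma sum_n_big (a : nat -> R) n : sum_n a n = \big[Rplus/0]_(k < n.+1) a k.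
Proof.
elim: n => [|n IH]; first by rewrite sum_O big_ord1.
by rewrite sum_Sn IH [RHS]big_ord_recr.
Qed.

Lemma is_series_finite (a : nat -> R) N : (forall n, (N <= n)%nat -> a n = 0) ->
  is_series a (\big[Rplus/0]_(k < N) a k).
Proof.
move=> a0; change (is_lim_seq (sum_n a) (\big[Rplus/0]_(k < N) a k)).
apply: (is_lim_seq_ext_loc (fun _ => \big[Rplus/0]_(k < N) a k)); last exact: is_lim_seq_const.
exists N => n /leP Nn; rewrite sum_n_big.
rewrite -!(big_mkord xpredT) [RHS](big_cat_nat (n := N)) //=; last exact: leqW.
by rewrite [X in _ + X]big_nat [X in _ + X]big1 ?Rplus_0_r // => i /andP[Ni _]; exact: a0.
Qed.

Lemma alternating_binomial m K :
  \big[Rplus/0]_(i < K.+1) ((-1) ^ i * INR 'C(m.+1, i)) = (-1) ^ K * INR 'C(m, K).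
Proof.
elim: K => [|K IH]; first by rewrite big_ord1 !bin0.
rewrite big_ord_recr /= IH binS INRD; ring.
Qed.

(* Bonferroni: truncating the inclusion-exclusion sum errs by at most the first omitted term. *)
Lemma bonferroni m K :
  Rabs ((if m == 0%nat then 1 else 0) - \big[Rplus/0]_(i < K) ((-1) ^ i * INR 'C(m, i))) <= INR 'C(m, K).
Proof.
case: K => [|K].
  by rewrite big_ord0 bin0 INR1; case: eqP => _; rewrite Rminus_0_r ?Rabs_R1 ?Rabs_R0; lra.
case: m => [|m] /=.
  rewrite big_ord_recl big1 => [|i _]; last by rewrite lift0 bin0n INR0 Rmult_0_r.
  by rewrite bin0 INR1 /= (_ : _ - _ = 0) ?Rabs_R0; [exact: pos_INR|ring].
rewrite alternating_binomial Rminus_0_l Rabs_Ropp Rabs_mult pow_1_abs Rmult_1_l.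
by rewrite Rabs_pos_eq ?binS ?INRD; have := pos_INR 'C(m, K); have := pos_INR 'C(m, K.+1); lra.
Qed.

(** * Limit laws for an abstract sequence of expectations *)

Section LimitLaws.
(** [Ex n] is the expectation of a function of the n-th count. Linearity, positivity, mass one and
    the limits of factorial moments are all that the limit laws use about it. *)
Variable Ex : nat -> (nat -> R) -> R.
Hypothesis Elin : forall n g h c, Ex n (fun k => g k + c * h k) = Ex n g + c * Ex n h.
Hypothesis Epos : forall n g, (forall k, 0 <= g k) -> 0 <= Ex n g.
Hypothesis Eone : forall n, Ex n (fun _ => 1) = 1.

Lemma Ex_ext n g h : (forall k, g k = h k) -> Ex n g = Ex n h.
Proof. by move=> e; congr Ex; apply: functional_extensionality. Qed.

Lemma Ex0 n : Ex n (fun _ => 0) = 0.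
Proof.
have := Elin n (fun _ => 0) (fun _ => 0) 1.
by rewrite (@Ex_ext n (fun k => 0 + 1 * 0) (fun _ => 0)); [lra|move=> k; ring].
Qed.

Lemma Ex_scal n c g : Ex n (fun k => c * g k) = c * Ex n g.
Proof.
have := Elin n (fun _ => 0) g c; rewrite Ex0 Rplus_0_l => <-.
by apply: Ex_ext => k; ring.
Qed.

Lemma Ex_add n g h : Ex n (fun k => g k + h k) = Ex n g + Ex n h.
Proof. by rewrite -[Ex n h]Rmult_1_l -Elin; apply: Ex_ext => k; ring. Qed.

Lemma Ex_const n c : Ex n (fun _ => c) = c.
Proof. by rewrite -{2}[c]Rmult_1_r -(Eone n) -Ex_scal; apply: Ex_ext => k; ring. Qed.

Lemma Ex_le n g h : (forall k, g k <= h k) -> Ex n g <= Ex n h.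
Proof.
move=> gh; have : 0 <= Ex n (fun k => h k + -1 * g k) by apply: Epos => k; have := gh k; lra.
by rewrite Elin; lra.
Qed.

Lemma Ex_big n (I : Type) (r : seq I) (g : I -> nat -> R) :
  Ex n (fun k => \big[Rplus/0]_(i <- r) g i k) = \big[Rplus/0]_(i <- r) Ex n (g i).
Proof.
elim: r => [|i r IH].
  by rewrite big_nil -[RHS](Ex0 n); apply: Ex_ext => k; rewrite big_nil.
by rewrite big_cons -IH -Ex_add; apply: Ex_ext => k; rewrite big_cons.
Qed.

Lemma Ex_abs_sub n g h w : (forall k, Rabs (g k - h k) <= w k) -> Rabs (Ex n g - Ex n h) <= Ex n w.
Proof.
move=> H.
have H1 : Ex n g <= Ex n (fun k => h k + w k).
  by apply: Ex_le => k; have /Rabs_le_between := H k; lra.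
have H2 : Ex n h <= Ex n (fun k => g k + w k).
  by apply: Ex_le => k; have /Rabs_le_between := H k; lra.
by rewrite !Ex_add in H1 H2; apply: Rabs_le; lra.
Qed.

Variable m1 : R.
Hypothesis Hm : forall s, improper (fun x => x ^ s * ray x) (rmom m1 s).

(** * The Rayleigh limit *)

Section ScaledLimit.
Variable lam : nat -> R.
Hypothesis lam_pos : forall n, 0 < lam n.
Hypothesis lam_inv : is_lim_seq (fun n => / lam n) 0.
Hypothesis Hfac : forall s,
  is_lim_seq (fun n => Ex n (fun k => ffact (INR k) s) / lam n ^ s) (rmom m1 s).

(** k times the i-th falling factorial of k is the (i+1)-st plus i times the i-th. Powers are thus
    traded for falling factorials one factor at a time, and the second term is lost because 1 / lam
    -> 0. *)
Lemma scaled_moments s : is_lim_seq (fun n => Ex n (fun k => (INR k / lam n) ^ s)) (rmom m1 s).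
Proof.
have H a : forall i, is_lim_seq (fun n => Ex n (fun k => INR k ^ a * ffact (INR k) i) / lam n ^ (a + i)) (rmom m1 (a + i)).
  elim: a => [|a IH] i.
    by rewrite add0n; apply: is_lim_seq_ext (@Hfac i) => n; congr (_ / _); apply: Ex_ext => k /=; ring.
  have -> : Finite (rmom m1 (a.+1 + i)) = rmom m1 (a + i.+1) + INR i * (rmom m1 (a + i) * 0).
    by rewrite addSnnS; congr Finite; ring.
  have L := is_lim_seq_plus' _ _ _ _ (IH i.+1) (is_lim_seq_mult' _ _ _ _ (is_lim_seq_const (INR i))
    (is_lim_seq_mult' _ _ _ _ (IH i) lam_inv)).
  apply: is_lim_seq_ext L => n.
  have -> : Ex n (fun k => INR k ^ a.+1 * ffact (INR k) i) =
     Ex n (fun k => INR k ^ a * ffact (INR k) i.+1) + INR i * Ex n (fun k => INR k ^ a * ffact (INR k) i).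
    by rewrite -Elin; apply: Ex_ext => k /=; ring.
  have := lam_pos n; have := pow_lt _ (a + i) (lam_pos n) => *.
  by rewrite addnS addSn /=; field; lra.
have := H s 0%nat; rewrite addn0; apply: is_lim_seq_ext => n.
rewrite /Rdiv Rmult_comm -Ex_scal; apply: Ex_ext => k /=.
by rewrite Rpow_mult_distr pow_inv; ring.
Qed.

Let Z n k := INR k / lam n.
Let Z0 n k : 0 <= Z n k.
Proof. by apply: Rmult_le_pos; [exact: pos_INR|exact/Rlt_le/Rinv_0_lt_compat]. Qed.

(** Both sides are expanded to K terms of the exponential series. The truncation errors are moments
    of order l + K over K!, removed by [rmom_exp_small]. *)
Lemma scaled_laplace l rho : 0 <= rho ->
  is_lim_seq (fun n => Ex n (fun k => Z n k ^ l * exp (- (rho * Z n k)))) (lap l rho).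
Proof.
move=> r0.
pose c i := (- rho) ^ i / INR i`!.
have W : is_lim_seq (fun K => rho ^ K * rmom m1 (l + K) / INR K`!) 0 by exact: rmom_exp_small.
apply: (@is_lim_seq_bracket _ _
  (fun K n => \big[Rplus/0]_(i < K) (c i * Ex n (fun k => Z n k ^ (l + i))))
  (fun K n => rho ^ K / INR K`! * Ex n (fun k => Z n k ^ (l + K)))
  (fun K => \big[Rplus/0]_(i < K) (c i * rmom m1 (l + i)))
  (fun K => rho ^ K / INR K`! * rmom m1 (l + K))
  (fun K => rho ^ K * rmom m1 (l + K) / INR K`!)) => //.
- move=> K n; rewrite -Ex_scal.
  rewrite (_ : \big[Rplus/0]_(i < K) _ = Ex n (fun k => \big[Rplus/0]_(i < K) (c i * Z n k ^ (l + i)))); last first.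
    by rewrite Ex_big; apply: eq_bigr => i _; rewrite Ex_scal.
  apply: Ex_abs_sub => k; have z0 := Z0 n k.
  rewrite (_ : \big[Rplus/0]_(i < K) _ = Z n k ^ l * alt_taylor K (rho * Z n k)); last first.
    rewrite big_distrr; apply: eq_bigr => i _ /=.
    by rewrite /c pow_add Ropp_mult_distr_l Rpow_mult_distr /Rdiv; ring.
  rewrite -Rmult_minus_distr_l Rabs_mult Rabs_pos_eq; last exact: pow_le.
  apply: Rle_trans (Rmult_le_compat_l _ _ _ (pow_le _ l z0) (alt_taylor_abs K (Rmult_le_pos _ _ r0 z0))) _.
  by right; rewrite pow_add Rpow_mult_distr /Rdiv; ring.
- move=> K; apply: is_lim_seq_big => i; apply: is_lim_seq_mult'; first exact: is_lim_seq_const.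
  exact: scaled_moments.
- by move=> K; apply: is_lim_seq_mult'; [exact: is_lim_seq_const|exact: scaled_moments].
- by move=> K; exact: lap_taylor.
by apply: is_lim_seq_ext W => K; rewrite /Rdiv; ring.
Qed.

Definition smooth_mean (rho : R) (L : nat) : R :=
  \big[Rplus/0]_(l < L) (rho ^ l / INR l`! * lap l rho).

Lemma scaled_poisson_cdf rho L : 0 <= rho ->
  is_lim_seq (fun n => Ex n (fun k => poisson_cdf (rho * Z n k) L)) (smooth_mean rho L).
Proof.
move=> r0; rewrite /smooth_mean.
apply: (is_lim_seq_ext (fun n => \big[Rplus/0]_(l < L)
   (rho ^ l / INR l`! * Ex n (fun k => Z n k ^ l * exp (- (rho * Z n k)))))).
  move=> n; rewrite (_ : \big[Rplus/0]_(l < L) _ = Ex n (fun k => \big[Rplus/0]_(l < L)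
      (rho ^ l / INR l`! * (Z n k ^ l * exp (- (rho * Z n k)))))); last first.
    by rewrite Ex_big; apply: eq_bigr => i _; rewrite Ex_scal.
  apply: Ex_ext => k; rewrite /poisson_cdf big_distrr; apply: eq_bigr => l _ /=.
  by rewrite /poisson_term Rpow_mult_distr /Rdiv; ring.
apply: is_lim_seq_big => l; apply: is_lim_seq_mult'; first exact: is_lim_seq_const.
exact: scaled_laplace.
Qed.

(** Chebyshev's bound z / (m (z - a)^2) for Poisson(m z) against m a, at z = a + d. Written as
    (1/(z-a) + a/(z-a)^2) / m it decreases in z > a, so that z = a + d is the worst case above a. *)
Definition smooth_err (a d m : R) := (/ d + a / d ^ 2) / m.

Lemma smooth_below a d m L z : 0 <= a -> 0 < d -> 0 < m -> m * a < INR L.+1 ->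
  0 <= z -> z <= a - d -> 1 - poisson_cdf (m * z) L.+1 <= smooth_err a d m.
Proof.
move=> a0 d0 m0 aL z0 zd.
have y0 : 0 <= m * z by apply: Rmult_le_pos; lra.
have md : 0 < m * d by exact: Rmult_lt_0_compat.
have Ly : m * d <= INR L.+1 - m * z by nra.
have T := poisson_upper_tail y0 (ltac:(lra) : m * z <= INR L.+1).
have [p0 _] := poisson_cdf_bound L.+1 y0.
have sq : (m * d) ^ 2 <= (INR L.+1 - m * z) ^ 2 by apply: pow_incr; lra.
have H : (1 - poisson_cdf (m * z) L.+1) * (m * d) ^ 2 <= m * a.
  apply: Rle_trans (Rmult_le_compat_l _ _ _ p0 sq) _; apply: Rle_trans T _.
  by apply: Rmult_le_compat_l; lra.
apply: (Rmult_le_reg_r ((m * d) ^ 2)); first exact: pow_lt.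
apply: Rle_trans H _; rewrite /smooth_err (_ : _ * (m * d) ^ 2 = m * (d + a)); last by field; lra.
by apply: Rmult_le_compat_l; lra.
Qed.

Lemma smooth_above a d m L z : 0 <= a -> 0 < d -> 0 < m -> INR L <= m * a ->
  a + d <= z -> poisson_cdf (m * z) L.+1 <= smooth_err a d m.
Proof.
move=> a0 d0 m0 aL zd.
have y0 : 0 <= m * z by apply: Rmult_le_pos; lra.
have e : 0 < z - a by lra.
have me : 0 < m * (z - a) by exact: Rmult_lt_0_compat.
have Ly : m * (z - a) <= m * z - INR L by nra.
have L1 : INR L.+1 <= m * z + 1 by rewrite S_INR; nra.
have T := poisson_lower_tail y0 L1.
have p0 : 0 <= poisson_cdf (m * z) L.+1.
  apply: Rmult_le_pos; first exact/Rlt_le/exp_pos.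
  by apply: Rsum_ge0 => i _; exact: poisson_term_ge0.
have sq : (m * (z - a)) ^ 2 <= (m * z - INR L) ^ 2 by apply: pow_incr; lra.
have H := Rle_trans _ _ _ (Rmult_le_compat_l _ _ _ p0 sq) T.
have H2 : poisson_cdf (m * z) L.+1 <= (/ (z - a) + a * / (z - a) ^ 2) / m.
  apply: (Rmult_le_reg_r ((m * (z - a)) ^ 2)); first exact: pow_lt.
  by apply: Rle_trans H _; right; field; lra.
apply: Rle_trans H2 _; rewrite /smooth_err; apply: Rmult_le_compat_r; first exact/Rlt_le/Rinv_0_lt_compat.
apply: Rplus_le_compat; first by apply: Rinv_le_contravar; lra.
apply: Rmult_le_compat_l => //; apply: Rinv_le_contravar; first exact: pow_lt.
by apply: pow_incr; lra.
Qed.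

Let F c := 1 - exp (- (c ^ 2) / 2).

Lemma ray_le1 x : 0 <= x -> ray x <= 1.
Proof.
move=> x0; have E : exp (- (x ^ 2) / 2) * exp (x ^ 2 / 2) = 1.
  by rewrite -exp_plus -exp_0; congr exp; field.
have := exp_ineq1_le (x ^ 2 / 2) => H; have := exp_pos (- (x ^ 2) / 2) => e0.
rewrite /ray /rayleigh_density.
have h : x <= exp (x ^ 2 / 2) by nra.
by have := Rmult_le_compat_r _ _ _ (Rlt_le _ _ e0) h; rewrite (Rmult_comm (exp _)) E.
Qed.

Lemma ray_cont x : continuous ray x.
Proof. by apply: ex_derive_continuous; rewrite /rayleigh_density; auto_derive. Qed.

Lemma F_diff c d : RInt ray c d = F d - F c.
Proof.
have := @RInt_split ray 0 c d ray_cont; rewrite !RInt_ray /F; lra.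
Qed.

Lemma F_lipschitz c d : 0 <= c -> c <= d -> F d - F c <= d - c.
Proof.
move=> c0 cd; rewrite -F_diff.
apply: Rle_trans (_ : RInt (fun _ => 1) c d <= _).
  apply: RInt_le => //; [exact/continuous_ex_RInt/ray_cont|exact: ex_RInt_const|].
  by move=> x x0; apply: ray_le1; lra.
by rewrite RInt_const /scal /= /mult /=; lra.
Qed.

Lemma F_le1 c : F c <= 1. Proof. by rewrite /F; have := exp_pos (- (c ^ 2) / 2); lra. Qed.
Lemma F_ge0 c : 0 <= F c.
Proof. by rewrite /F; have : exp (- (c ^ 2) / 2) <= 1 by [apply: exp_le1; nra]; lra. Qed.

(** P(Poisson(m x) <= L) differs from the indicator of x <= a by at most [eta] when x is at distance
    at least d from a. Hence its Rayleigh mean lies between the values of F at a - d and a + d, up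
    to [eta]. *)
Lemma smooth_mass a d m L : 0 <= a -> 0 < d -> 0 < m -> INR L <= m * a < INR L.+1 ->
  let J := smooth_mean m L.+1 in
  J <= F (a + d) + smooth_err a d m /\ (d <= a -> F (a - d) - smooth_err a d m <= J).
Proof.
move=> a0 d0 m0 [La aL] J; set eta := smooth_err a d m.
have eta0 : 0 <= eta.
  apply: Rmult_le_pos; last exact/Rlt_le/Rinv_0_lt_compat.
  apply: Rplus_le_le_0_compat; first exact/Rlt_le/Rinv_0_lt_compat.
  by apply: Rmult_le_pos => //; apply/Rlt_le/Rinv_0_lt_compat/pow_lt.
pose h x := poisson_cdf (m * x) L.+1 * ray x.
have H : improper h J.
  have := poisson_cdf_improper Hm 0 L.+1 (Rlt_le _ _ m0).
  rewrite (_ : \big[Rplus/0]_(l < L.+1) _ = J); last by apply: eq_bigr => l _; rewrite addn0.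
  by apply: improper_ext => x; rewrite /h /=; ring.
have [hc hl] := H.
have T01 x : 0 <= x -> 0 <= poisson_cdf (m * x) L.+1 <= 1.
  move=> x0; have y0 : 0 <= m * x by apply: Rmult_le_pos; lra.
  have [p _] := poisson_cdf_bound L.+1 y0; split; last lra.
  apply: Rmult_le_pos; first exact/Rlt_le/exp_pos.
  by apply: Rsum_ge0 => i _; exact: poisson_term_ge0.
have sc c x : continuous (fun x => c * ray x) x.
  by apply: (continuous_scal_r (V := R_NormedModule)); exact: ray_cont.
have scI c u v : RInt (fun x => c * ray x) u v = c * (F v - F u).
  rewrite -F_diff; have := RInt_scal (V := R_CompleteNormedModule) _ u v c (continuous_ex_RInt u v ray_cont).
  by [].
split.
  apply: (is_lim_le_loc _ _ p_infty (Finite _) (Finite _) _ hl (is_lim_const _ _)).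
  exists (a + d) => A Aad; rewrite (@RInt_split h 0 (a + d) A hc).
  apply: Rplus_le_compat.
    rewrite -[F (a + d)]RInt_ray; apply: RInt_le; [lra|exact: continuous_ex_RInt|exact/continuous_ex_RInt/ray_cont|].
    move=> x x0; have := T01 x ltac:(lra); have := @ray_ge0 x ltac:(lra); rewrite /h => r0 t; nra.
  apply: Rle_trans (_ : RInt (fun x => eta * ray x) (a + d) A <= _).
    apply: RInt_le; [lra|exact: continuous_ex_RInt|exact: continuous_ex_RInt|].
    move=> x x0; apply: Rmult_le_compat_r; first by apply: ray_ge0; lra.
    by apply: smooth_above => //; lra.
  by rewrite scI; have := F_le1 A; have := F_ge0 (a + d); nra.
move=> da.
apply: (is_lim_le_loc _ _ p_infty (Finite _) (Finite _) _ (is_lim_const _ _) hl).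
exists (a - d) => A Aad; rewrite (@RInt_split h 0 (a - d) A hc).
have P : 0 <= RInt h (a - d) A.
  apply: RInt_ge0 => // [|x x0]; first lra.
  by apply: Rmult_le_pos; [case: (T01 x ltac:(lra))|apply: ray_ge0; lra].
suff : RInt (fun x => (1 - eta) * ray x) 0 (a - d) <= RInt h 0 (a - d).
  rewrite scI; have -> : F 0 = 0 by rewrite /F (_ : - 0 ^ 2 / 2 = 0) ?exp_0; [ring|field].
  by have := F_le1 (a - d); have := F_ge0 (a - d); nra.
apply: RInt_le; [lra|exact: continuous_ex_RInt|exact: continuous_ex_RInt|].
move=> x x0; apply: Rmult_le_compat_r; first by apply: ray_ge0; lra.
by have := @smooth_below a d m L x a0 d0 m0 aL ltac:(lra) ltac:(lra); rewrite -/eta; lra.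
Qed.

Lemma smooth_param a d e : 0 <= a -> 0 < d -> 0 < e ->
  exists m L, [/\ 0 < m, INR L <= m * a < INR L.+1 & smooth_err a d m <= e].
Proof.
move=> a0 d0 e0; pose c := / d + a / d ^ 2.
have c0 : 0 < c.
  have : 0 <= a / d ^ 2 by apply: Rmult_le_pos => //; apply/Rlt_le/Rinv_0_lt_compat/pow_lt.
  by have := Rinv_0_lt_compat _ d0; rewrite /c; lra.
have m0 : 0 < c / e by exact: Rdiv_lt_0_compat.
have [L HL] := nfloor_ex (c / e * a) (Rmult_le_pos _ _ (Rlt_le _ _ m0) a0).
exists (c / e), L; split=> //; first by rewrite S_INR.
by rewrite /smooth_err -/c; right; field; lra.
Qed.

(** The indicator of Z <= x is compared with smoothings at x + d and x - d. Each side costs at most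
    five times eps / 8: smoothing before and after the limit, the convergence itself, and 2 d from
    [F_lipschitz]. *)
Lemma scaled_cdf x :
  is_lim_seq (fun n => Ex n (fun k => if Rle_dec (INR k / lam n) x then 1 else 0)) (rayleigh_cdf x).
Proof.
have FE : 0 <= x -> rayleigh_cdf x = F x.
  move=> x0; rewrite /rayleigh_cdf; case: Rle_dec => [x1|x1] /=; last by rewrite RInt_ray.
  have -> : x = 0 by lra.
  by rewrite /F (_ : - 0 ^ 2 / 2 = 0) ?exp_0; [ring|field].
case: (Rlt_le_dec x 0) => [xneg|x0].
  have -> : rayleigh_cdf x = 0 by rewrite /rayleigh_cdf; case: Rle_dec => /= *; lra.
  apply: is_lim_seq_ext (is_lim_seq_const 0) => n.
  rewrite -[LHS](Ex0 n); apply: Ex_ext => k; have := Z0 n k; rewrite /Z.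
  by case: Rle_dec => /= *; lra.
rewrite FE //; apply/is_lim_seq_spec => eps; have e0 := cond_pos eps.
have e8 : 0 < eps / 8 by lra.
set d := eps / 8.
have ind01 n k : 0 <= (if Rle_dec (Z n k) x then 1 else 0) <= 1 by case: Rle_dec => /= *; lra.
have T01 m L n k : 0 < m -> 0 <= poisson_cdf (m * Z n k) L <= 1.
  move=> m0; have y0 : 0 <= m * Z n k by apply: Rmult_le_pos; [lra|exact: Z0].
  have [p _] := poisson_cdf_bound L y0; split; last lra.
  apply: Rmult_le_pos; first exact/Rlt_le/exp_pos.
  by apply: Rsum_ge0 => i _; exact: poisson_term_ge0.
have up : eventually (fun n => Ex n (fun k => if Rle_dec (Z n k) x then 1 else 0) < F x + eps).
  have a0 : 0 <= x + d by rewrite /d; lra.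
  have [m [L [m0 mL err]]] := smooth_param a0 e8 e8.
  have [Ju _] := smooth_mass a0 e8 m0 mL.
  move/is_lim_seq_spec: (@scaled_poisson_cdf m L.+1 (Rlt_le _ _ m0)) => /(_ (mkposreal _ e8)) [N HN].
  exists N => n /HN /Rabs_def2 /= [Hn _].
  have : Ex n (fun k => if Rle_dec (Z n k) x then 1 else 0) <=
      Ex n (fun k => poisson_cdf (m * Z n k) L.+1 + d).
    apply: Ex_le => k; have := T01 m L.+1 n k m0; have := Z0 n k => z0 t.
    case: Rle_dec => [zx|zx] /=; last by rewrite /d; lra.
    have := @smooth_below (x + d) (eps / 8) m L (Z n k) a0 e8 m0 (proj2 mL) z0.
    by rewrite /d in err *; lra.
  rewrite Ex_add Ex_const; have := @F_lipschitz x (x + d + eps / 8) x0 ltac:(rewrite /d; lra); rewrite /d in Ju err *; lra.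
have lo : eventually (fun n => F x - eps < Ex n (fun k => if Rle_dec (Z n k) x then 1 else 0)).
  (* If x <= 2 d then F x <= eps / 4 and positivity is enough; otherwise a = x - d satisfies d <= a,
     as [smooth_mass] requires. *)
  case: (Rle_lt_dec x (2 * d)) => xd.
    exists 0%nat => n _; have := Epos n (fun k => proj1 (ind01 n k)).
    have := @F_lipschitz 0 x ltac:(lra) x0.
    have -> : F 0 = 0 by rewrite /F (_ : - 0 ^ 2 / 2 = 0) ?exp_0; [ring|field].
    by rewrite /d in xd; lra.
  have a0 : 0 <= x - d by rewrite /d in xd *; lra.
  have [m [L [m0 mL err]]] := smooth_param a0 e8 e8.
  have [_ Jl] := smooth_mass a0 e8 m0 mL.
  move/is_lim_seq_spec: (@scaled_poisson_cdf m L.+1 (Rlt_le _ _ m0)) => /(_ (mkposreal _ e8)) [N HN].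
  exists N => n /HN /Rabs_def2 /= [_ Hn].
  have : Ex n (fun k => poisson_cdf (m * Z n k) L.+1) <=
      Ex n (fun k => (if Rle_dec (Z n k) x then 1 else 0) + d).
    apply: Ex_le => k; have := T01 m L.+1 n k m0; have := Z0 n k => z0 t.
    case: Rle_dec => [zx|zx] /=; first by rewrite /d; lra.
    have := @smooth_above (x - d) (eps / 8) m L (Z n k) a0 e8 m0 (proj1 mL).
    by rewrite /d in err *; lra.
  rewrite Ex_add Ex_const; have := @F_lipschitz (x - d - eps / 8) x ltac:(rewrite /d in xd *; lra) ltac:(rewrite /d; lra); rewrite /d in Jl err xd *; lra.
have [N1 H1] := up; have [N2 H2] := lo.
exists (maxn N1 N2) => n /leP nN.
by have := H1 n ltac:(lia); have := H2 n ltac:(lia); rewrite /Z => *; apply: Rabs_def1; lra.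
Qed.
End ScaledLimit.

(** * The mixed Poisson limit *)

Section MixedPoissonLimit.
Variable rho : R.
Hypothesis rho0 : 0 <= rho.
Hypothesis Hfac : forall s,
  is_lim_seq (fun n => Ex n (fun k => ffact (INR k) s)) (rho ^ s * rmom m1 s).

(** The formula includes the point mass at rho = 0: then rho^l vanishes for l > 0 and [lap 0 rho] is
    1. *)
Lemma mpo_pmfE l : mpo_pmf rho l = rho ^ l / INR l`! * lap l rho.
Proof.
rewrite /mpo_pmf; case: Req_EM_T => [r0|r0] /=; last by [].
case: l => [|l]; last by rewrite r0 /= /Rdiv !Rmult_0_l.
have L := lap_improper Hm 0 rho0.
have M := Hm 0.
have -> : lap 0 rho = 1.
  rewrite /lap r0 (@is_RInt_gen_unique R_CompleteNormedModule _ _ _ _ _ 1) //.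
  apply: improper_is_RInt_gen; apply: improper_ext M => x /=.
  by rewrite (_ : - 0 * x = 0) ?exp_0; ring.
by rewrite fact0 INR1 /=; field.
Qed.

Lemma factorial_moment_split k r i :
  ffact (INR k) (r + i) / (INR r`! * INR i`!) = INR 'C(k, r) * INR 'C(k - r, i).
Proof.
rewrite ffact_pow_nat (_ : k ^_ (r + i) = (k ^_ r * (k - r) ^_ i)%nat); last first.
  elim: i => [|i IH]; first by rewrite addn0 ffactn0 muln1.
  by rewrite addnS !ffactnSr IH mulnA subnDA.
rewrite -!bin_ffact !INRM; have := fact_pos r; have := fact_pos i => *.
by field; lra.
Qed.

(** Bonferroni's sums for the counts and the Taylor sums of [lap_taylor] for the limit have the same
    coefficients, with the moments replaced by their limits. *)
Lemma mixed_poisson_pmf_lim r :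
  is_lim_seq (fun n => Ex n (fun k => if k == r then 1 else 0)) (mpo_pmf rho r).
Proof.
pose c i := (-1) ^ i / (INR r`! * INR i`!).
have fr := fact_pos r.
have W : is_lim_seq (fun K => rho ^ r / INR r`! * (rho ^ K * rmom m1 (r + K) / INR K`!)) 0.
  have -> : Finite 0 = rho ^ r / INR r`! * 0 by rewrite Rmult_0_r.
  by apply: is_lim_seq_mult'; [exact: is_lim_seq_const|exact: rmom_exp_small].
apply: (@is_lim_seq_bracket _ _
  (fun K n => \big[Rplus/0]_(i < K) (c i * Ex n (fun k => ffact (INR k) (r + i))))
  (fun K n => / (INR r`! * INR K`!) * Ex n (fun k => ffact (INR k) (r + K)))
  (fun K => \big[Rplus/0]_(i < K) (c i * (rho ^ (r + i) * rmom m1 (r + i))))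
  (fun K => / (INR r`! * INR K`!) * (rho ^ (r + K) * rmom m1 (r + K)))
  (fun K => rho ^ r / INR r`! * (rho ^ K * rmom m1 (r + K) / INR K`!))) => //.
- move=> K n; rewrite -Ex_scal.
  rewrite (_ : \big[Rplus/0]_(i < K) _ = Ex n (fun k => \big[Rplus/0]_(i < K) (c i * ffact (INR k) (r + i)))); last first.
    by rewrite Ex_big; apply: eq_bigr => i _; rewrite Ex_scal.
  apply: Ex_abs_sub => k.
  have -> : / (INR r`! * INR K`!) * ffact (INR k) (r + K) = INR 'C(k, r) * INR 'C(k - r, K).
    by rewrite -factorial_moment_split /Rdiv Rmult_comm.
  (* For k < r the truncated difference is 0, but then the binomial coefficient vanishes. *)
  have -> : (if k == r then 1 else 0) = INR 'C(k, r) * (if (k - r)%nat == 0%nat then 1 else 0).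
    case: (ltngtP k r) => [kr|kr|->]; last by rewrite subnn binn INR1 /= Rmult_1_r.
      by rewrite bin_small // INR0 Rmult_0_l.
    by rewrite subn_eq0 leqNgt kr /= Rmult_0_r.
  have -> : \big[Rplus/0]_(i < K) (c i * ffact (INR k) (r + i)) =
      INR 'C(k, r) * \big[Rplus/0]_(i < K) ((-1) ^ i * INR 'C(k - r, i)).
    rewrite big_distrr; apply: eq_bigr => i _ /=.
    transitivity ((-1) ^ i * (ffact (INR k) (r + i) / (INR r`! * INR i`!))).
      by rewrite /c /Rdiv; ring.
    by rewrite factorial_moment_split; ring.
  rewrite -Rmult_minus_distr_l Rabs_mult Rabs_pos_eq; last exact: pos_INR.
  by apply: Rmult_le_compat_l; [exact: pos_INR|exact: bonferroni].
- by move=> K; apply: is_lim_seq_big => i; apply: is_lim_seq_mult'; [exact: is_lim_seq_const|].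
- by move=> K; apply: is_lim_seq_mult'; [exact: is_lim_seq_const|].
- move=> K; rewrite mpo_pmfE.
  have -> : \big[Rplus/0]_(i < K) (c i * (rho ^ (r + i) * rmom m1 (r + i))) =
      rho ^ r / INR r`! * \big[Rplus/0]_(i < K) ((- rho) ^ i / INR i`! * rmom m1 (r + i)).
    rewrite big_distrr; apply: eq_bigr => i _ /=.
    rewrite /c pow_add (_ : - rho = -1 * rho); last by ring.
    by rewrite Rpow_mult_distr; have := fact_pos i => *; field; lra.
  rewrite -Rmult_minus_distr_l Rabs_mult Rabs_pos_eq.
    apply: Rmult_le_compat_l; last exact: lap_taylor.
    by apply: Rmult_le_pos; [exact: pow_le|exact/Rlt_le/Rinv_0_lt_compat].
  by apply: Rmult_le_pos; [exact: pow_le|exact/Rlt_le/Rinv_0_lt_compat].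
apply: is_lim_seq_ext W => K.
by rewrite pow_add; have := fact_pos K => *; field; lra.
Qed.

Lemma mixed_poisson_cdf_lim x :
  is_lim_seq (fun n => Ex n (fun k => if Rle_dec (INR k) x then 1 else 0)) (mpo_cdf rho x).
Proof.
rewrite /mpo_cdf; case: (Rlt_le_dec x 0) => [xneg|x0].
  rewrite (@Series_ext _ (fun _ => 0)); last first.
    by move=> l; case: Rle_dec => //= h; have := pos_INR l; lra.
  rewrite (is_series_unique _ _ (@is_series_finite (fun _ => 0) 0 (fun _ _ => erefl))) big_ord0.
  apply: is_lim_seq_ext (is_lim_seq_const 0) => n.
  rewrite -[LHS](Ex0 n); apply: Ex_ext => k.
  by case: Rle_dec => //= h; have := pos_INR k; lra.
have [N [HN1 HN2]] := nfloor_ex x x0.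
have cmp (T : Type) l (u v : T) : (if Rle_dec (INR l) x then u else v) = (if (l < N.+1)%nat then u else v).
  case: Rle_dec => /= h; case: ltnP => // lN.
    by have : INR N.+1 <= INR l by [apply: le_INR; exact/leP]; rewrite S_INR; lra.
  by have : INR l <= INR N by [apply: le_INR; apply/leP]; lra.
rewrite (@Series_ext _ (fun l => if (l < N.+1)%nat then mpo_pmf rho l else 0)); last by move=> l; exact: cmp.
have Z n : (N.+1 <= n)%nat -> (if (n < N.+1)%nat then mpo_pmf rho n else 0) = 0.
  by move=> Nn; rewrite ltnS leqNgt Nn.
rewrite (is_series_unique _ _ (is_series_finite Z)).
apply: (is_lim_seq_ext (fun n => \big[Rplus/0]_(r < N.+1) Ex n (fun k => if k == r then 1 else 0))).
  move=> n; rewrite -Ex_big; apply: Ex_ext => k; rewrite cmp.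
  case: ltnP => kN; last first.
    by rewrite big1 // => i _; case: eqP => // e; move: kN; rewrite e leqNgt ltn_ord.
  rewrite (bigD1 (Ordinal kN)) //= eqxx big1 ?Rplus_0_r // => i /eqP ne.
  by case: eqP => // e; case: ne; apply: val_inj.
rewrite (eq_bigr (fun r : 'I_N.+1 => mpo_pmf rho r)); last by move=> r _; rewrite ltn_ord.
by apply: is_lim_seq_big => r; exact: mixed_poisson_pmf_lim.
Qed.

(** The moment of Y^a times the i-th falling factorial of Y, for Y distributed as MPo(rho X),
    reduced to factorial moments by the same identity as in [scaled_moments]. *)
Fixpoint mixed_moment (a i : nat) : R :=
  match a with
  | O => rho ^ i * rmom m1 i
  | S a' => mixed_moment a' i.+1 + INR i * mixed_moment a' i
  end.

Lemma mixed_poisson_raw_lim a i :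
  is_lim_seq (fun n => Ex n (fun k => INR k ^ a * ffact (INR k) i)) (mixed_moment a i).
Proof.
elim: a i => [|a IH] i.
  by apply: is_lim_seq_ext (@Hfac i) => n; apply: Ex_ext => k /=; ring.
have L := is_lim_seq_plus' _ _ _ _ (IH i.+1) (is_lim_seq_mult' _ _ _ _ (is_lim_seq_const (INR i)) (IH i)).
apply: is_lim_seq_ext L => n; rewrite -Elin; apply: Ex_ext => k /=; ring.
Qed.

Lemma mixed_poisson_series a i :
  is_series (fun l => INR l ^ a * ffact (INR l) i * mpo_pmf rho l) (mixed_moment a i).
Proof.
elim: a i => [|a IH] i; last first.
  have L := is_series_plus _ _ _ _ (IH i.+1) (is_series_scal (INR i) _ _ (IH i)).
  apply: is_series_ext L => l; rewrite /plus /scal /= /mult /=; ring.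
pose u l := INR l ^ 0 * ffact (INR l) i * mpo_pmf rho l.
change (is_lim_seq (sum_n u) (mixed_moment 0 i)).
(* The falling factorial kills the terms l < i, so the partial sums may start at i and match
   [mixed_poisson_moment]. *)
apply/(is_lim_seq_incr_n _ i).
have E N : sum_n u (N + i)%coq_nat = \big[Rplus/0]_(l < N.+1) (rho ^ (l + i) / INR l`! * lap (l + i) rho).
  rewrite sum_n_big (_ : (N + i)%coq_nat.+1 = (i + N.+1)%nat); last by lia.
  rewrite big_split_ord big1 /= => [|l _]; last by rewrite /u ffact_pow_nat ffact_small // INR0; ring.
  rewrite Rplus_0_l; apply: eq_bigr => l _; rewrite /u mpo_pmfE (addnC l) ffact_pow_nat.
  have -> : INR (i + l)`! = INR ((i + l) ^_ i) * INR l`!.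
    by rewrite -INRM -(ffact_fact (leq_addr l i)) addKn.
  have := fact_pos l; have : 0 < INR ((i + l) ^_ i) by apply: INR_pos; rewrite ffact_gt0 leq_addr.
  by move=> *; rewrite /=; field; lra.
have L : is_lim_seq (fun N => rho ^ i * (rho ^ N.+1 * rmom m1 (i + N.+1) / INR N.+1`!)) 0.
  have -> : Finite 0 = rho ^ i * 0 by rewrite Rmult_0_r.
  apply: is_lim_seq_mult'; first exact: is_lim_seq_const.
  by apply/(is_lim_seq_incr_1 (fun N => rho ^ N * rmom m1 (i + N) / INR N`!)); exact: rmom_exp_small.
apply/is_lim_seq_spec => eps; move/is_lim_seq_spec: L => /(_ eps) [N HN].
exists N => n /HN; rewrite Rminus_0_r E => /(Rle_lt_trans _ _ _ (Rle_abs _)).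
by apply: Rle_lt_trans; rewrite Rabs_minus_sym; exact: mixed_poisson_moment.
Qed.
End MixedPoissonLimit.
End LimitLaws.

(** * Conclusion *)

Lemma lambda_pos n j : (0 < n)%nat -> (0 < j)%nat -> 0 < lambda n j.
Proof.
move=> n0 j0; rewrite lambdaE //; apply: Rmult_lt_0_compat; last exact: theta_pos.
exact/sqrt_lt_R0/INR_pos.
Qed.

Lemma is_lim_seq_pow (u : nat -> R) (l : R) s : is_lim_seq u l -> is_lim_seq (fun n => u n ^ s) (l ^ s).
Proof.
move=> ul; elim: s => [|s IH]; first exact: is_lim_seq_const.
exact: is_lim_seq_mult'.
Qed.

Section Transfer.
Variable beta : R.
Hypothesis beta0 : 0 < beta.
Hypothesis Hb : is_lim_seq (fun n => bb n * rt n) beta.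

(* lambda is of order sqrt n / j^(3/2), so a lower bound on lambda forces j = O(sqrt n). *)
Lemma small_of_lambda (j : nat -> nat) c : 0 < c ->
  eventually (fun n => (0 < j n)%nat) ->
  eventually (fun n => c <= lambda n (j n)) ->
  is_lim_seq (fun n => INR (j n) / INR n) 0.
Proof.
move=> c0 [N1 H1] [N2 H2]; have [K K0 HK] := bb_upper Hb.
have L : is_lim_seq (fun n => K / c * (rt n / sqrt (INR n)) ^ 1 * / rt n) (K / c * 1 * 0).
  apply: is_lim_seq_mult'; last exact: rt_inv_lim.
  apply: is_lim_seq_mult'; first exact: is_lim_seq_const.
  exact: rt_sqrt_lim.
rewrite Rmult_0_r in L.
apply: (is_lim_seq_le_le_loc (fun _ => 0) _ _ _ _ (is_lim_seq_const 0) L).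
exists (maxn 1 (maxn N1 N2)) => n /leP nN.
have j0 := H1 n ltac:(lia); have h := H2 n ltac:(lia).
have n0 : (0 < n)%nat by lia.
have np := INR_pos n0; have jp := INR_pos j0; have rn := rt_pos n; have sn := sqrt_lt_R0 _ np.
split; first by apply: Rmult_le_pos; [lra|exact/Rlt_le/Rinv_0_lt_compat].
rewrite lambdaE // /theta in h.
have h2 : sqrt (INR n) * (bb (j n) / INR (j n)) <= sqrt (INR n) * (K / INR (j n)).
  apply: Rmult_le_compat_l; first lra.
  apply: Rmult_le_compat_r; first exact/Rlt_le/Rinv_0_lt_compat.
  apply: Rle_trans (HK _) _; rewrite -[X in _ <= X]Rmult_1_r; apply: Rmult_le_compat_l; first lra.
  by rewrite -Rinv_1; apply: Rinv_le_contravar; [lra|exact: rt_ge1].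
have h3 : c * INR (j n) <= sqrt (INR n) * K.
  have := Rmult_le_compat_r _ _ _ (Rlt_le _ _ jp) (Rle_trans _ _ _ h h2).
  by rewrite (_ : _ * (K / INR (j n)) * _ = sqrt (INR n) * K) //; field; lra.
apply: (Rmult_le_reg_l (c * INR n)); first exact: Rmult_lt_0_compat.
rewrite (_ : c * INR n * (INR (j n) / INR n) = c * INR (j n)); last by field; lra.
apply: Rle_trans h3 _; right; rewrite pow_1 -{2}(sqrt_sqrt (INR n)); last lra.
by field; lra.
Qed.

Lemma C_expect_ffact n j s : (0 < n)%nat -> C_expect n j (fun k => ffact (INR k) s) = fmom j s n.
Proof. exact: C_expectE. Qed.

Variable m1 : R.
Hypothesis Hm : forall s, improper (fun x => x ^ s * ray x) (rmom m1 s).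

Lemma mom_constE s : mom_const beta s = rmom m1 s.
Proof. by rewrite /mom_const (wallis Hm beta0 Hb). Qed.

Lemma fmom_scaled_lim (j : nat -> nat) s :
  eventually (fun n => (0 < j n)%nat) ->
  is_lim_seq (fun n => INR (j n) / INR n) 0 ->
  is_lim_seq (fun n => fmom (j n) s n / lambda n (j n) ^ s) (rmom m1 s).
Proof. by move=> *; rewrite -mom_constE; exact: fmom_lim. Qed.

(** For rho > 0, lambda is bounded below, so j = o(n) and the asymptotics apply. For rho = 0, j may
    be of order n; the uniform bound then forces the limit 0 for s > 0, while s = 0 is exact. *)
Lemma fmom_lambda_lim (j : nat -> nat) rho s :
  (forall n, (2 <= n)%nat -> (1 <= j n <= n - 1)%nat) -> 0 <= rho ->
  is_lim_seq (fun n => lambda n (j n)) rho ->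
  is_lim_seq (fun n => fmom (j n) s n) (rho ^ s * rmom m1 s).
Proof.
move=> jn rho0 ll.
have jp : eventually (fun n => (0 < j n)%nat).
  by exists 2%nat => n /leP /jn /andP[].
have lp : eventually (fun n => 0 < lambda n (j n)).
  by exists 2%nat => n /leP n2; apply: lambda_pos; [lia|case/andP: (jn n n2)].
case: rho0 => [r0|r0].
  have r2 : 0 < rho / 2 by lra.
  have cl : eventually (fun n => rho / 2 <= lambda n (j n)).
    move/is_lim_seq_spec: ll => /(_ (mkposreal _ r2)) [N HN]; exists N => n /HN /Rabs_def2 /=; lra.
  have L := is_lim_seq_mult' _ _ _ _ (@is_lim_seq_pow _ _ s ll) (@fmom_scaled_lim j s jp (small_of_lambda r2 jp cl)).
  apply: is_lim_seq_ext_loc L; have [N HN] := lp; exists N => n /HN lpn.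
  by have := pow_lt _ s lpn => *; field; lra.
case: s => [|s].
  rewrite /= Rmult_1_r; apply: is_lim_seq_ext (is_lim_seq_const 1) => n.
  by rewrite fmom0.
rewrite -r0 in ll *; have [K K0 HK] := fmom_upper beta0 Hb s.+1.
rewrite (_ : 0 ^ s.+1 * rmom m1 s.+1 = K * 0 ^ s.+1); last by rewrite /=; ring.
apply: is_lim_seq_le_le_loc (is_lim_seq_mult' _ _ _ _ (is_lim_seq_const K) (@is_lim_seq_pow _ _ s.+1 ll)).
  exists 2%nat => n /leP n2; split; last by apply: HK; [case/andP: (jn n n2)|lia].
  by apply: size_expect_ge0 => k; exact: ffact_ge0.
rewrite (_ : K * 0 ^ s.+1 = 0); [exact: is_lim_seq_const|by rewrite /=; ring].
Qed.
End Transfer.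

Lemma is_lim_seq_shift2 (u : nat -> R) (l : Rbar) :
  is_lim_seq (fun n => u n.+2) l -> is_lim_seq u l.
Proof. by move=> H; apply/is_lim_seq_incr_1/is_lim_seq_incr_1. Qed.

Lemma is_lim_seq_shift2' (u : nat -> R) (l : Rbar) :
  is_lim_seq u l -> is_lim_seq (fun n => u n.+2) l.
Proof. by move=> /is_lim_seq_incr_1 /is_lim_seq_incr_1. Qed.

(** Shifted by two because the range of j is prescribed from n = 2 on; [lambda] is then positive at
    every index. *)
Definition law (j : nat -> nat) (n : nat) (g : nat -> R) : R := size_expect (j n.+2) n.+2 n.+2 g.

Lemma C_expect_law (j : nat -> nat) n g : C_expect n.+2 (j n.+2) g = law j n g.
Proof. exact: C_expectE. Qed.

Lemma law_lin j n g h c : law j n (fun k => g k + c * h k) = law j n g + c * law j n h.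
Proof. exact: size_expect_lin. Qed.

Lemma law_pos j n g : (forall k, 0 <= g k) -> 0 <= law j n g.
Proof. exact: size_expect_ge0. Qed.

Lemma law_one j n : law j n (fun _ => 1) = 1.
Proof. exact: (fmom0 (j n.+2) n.+2). Qed.


Theorem theorem4 :
  (* factorial moments, j = o(n) *)
  (forall (s : nat) (j : nat -> nat),
     (1 <= s)%nat ->
     (forall n, (1 <= j n)%nat) ->
     is_lim_seq (fun n => INR (j n) / INR n)%R 0%R ->
     is_lim_seq (fun n => C_expect n (j n) (fun k => ffact (INR k) s)
                  / (lambda n (j n) ^ s * Rpower 2 (INR s / 2)
                     * Gamma (INR s / 2 + 1)))%R 1%R)
  /\
  (* factorial moments, uniform O-bound for 1 <= j <= n-1 *)
  (forall s : nat, (1 <= s)%nat ->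
     exists K : R, forall n j : nat, (1 <= j <= n - 1)%nat ->
       (Rabs (C_expect n j (fun k => ffact (INR k) s))
        <= K * lambda n j ^ s)%R)
  /\
  (* (i) lambda -> oo : C/lambda -> Rayleigh, with all moments *)
  (forall j : nat -> nat,
     (forall n, (2 <= n)%nat -> (1 <= j n <= n - 1)%nat) ->
     is_lim_seq (fun n => lambda n (j n)) p_infty ->
     conv_distr
       (fun n x => C_expect n (j n)
          (fun k => if Rle_dec (INR k / lambda n (j n)) x then 1%R else 0%R))
       rayleigh_cdf
     /\ forall s : nat, exists m : R,
          is_RInt_gen (fun x => x ^ s * rayleigh_density x)%R
                      (at_point 0) (Rbar_locally p_infty) m
          /\ is_lim_seq (fun n => C_expect n (j n)
                           (fun k => (INR k / lambda n (j n)) ^ s)%R) m)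
  /\
  (* (ii) lambda -> rho in [0,oo) : C -> MPo(rho X), with all moments *)
  (forall (j : nat -> nat) (rho : R),
     (forall n, (2 <= n)%nat -> (1 <= j n <= n - 1)%nat) ->
     (0 <= rho)%R ->
     is_lim_seq (fun n => lambda n (j n)) rho ->
     conv_distr
       (fun n x => C_expect n (j n)
          (fun k => if Rle_dec (INR k) x then 1%R else 0%R))
       (mpo_cdf rho)
     /\ forall s : nat, exists m : R,
          is_series (fun l => INR l ^ s * mpo_pmf rho l)%R m
          /\ is_lim_seq (fun n => C_expect n (j n) (fun k => INR k ^ s)%R) m).
Proof.
have [beta beta0 Hb] := bb_rt_lim; have [m1 Hm] := ray_moments.
have m1p : (0 < m1)%R := first_moment_pos Hm.
split; [|split; [|split]].
- move=> s j _ j1 jl.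
  have L := @fmom_scaled_lim beta beta0 Hb m1 Hm j s (ex_intro _ 0%nat (fun n _ => j1 n)) jl.
  have Mp := rmom_pos s m1p.
  have L1 := is_lim_seq_div' _ _ _ _ L (is_lim_seq_const (rmom m1 s)) (Rgt_not_eq _ _ Mp).
  have -> : Finite 1 = (rmom m1 s / rmom m1 s)%R by congr Finite; field; lra.
  apply: is_lim_seq_ext_loc L1; exists 1%nat => n /leP n1.
  rewrite C_expect_ffact // Rmult_assoc (Gamma_rmom Hm).
  have := pow_lt _ s (lambda_pos n1 (j1 n)) => lp.
  by field; lra.
- move=> s _; have [K K0 HK] := fmom_upper beta0 Hb s.
  exists K => n j /andP[j1 jn]; have n0 : (0 < n)%nat by lia.
  rewrite C_expect_ffact // Rabs_pos_eq; first exact: HK.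
  by apply: size_expect_ge0 => k; exact: ffact_ge0.
- move=> j jn ll.
  have j2 n : (0 < j n.+2)%nat by case/andP: (jn n.+2 isT).
  have jp : eventually (fun n => (0 < j n)%nat) by exists 2%nat => -[|[|n]] //; lia.
  have cl : eventually (fun n => (1 <= lambda n (j n))%R).
    move/is_lim_seq_spec: (ll) => /(_ 1%R) [N HN]; exists N => n /HN; lra.
  (* Divergence of lambda already implies j = o(n), so the first asymptotics are available. *)
  have jl := small_of_lambda Hb Rlt_0_1 jp cl.
  pose lam n := lambda n.+2 (j n.+2).
  have lam0 n : (0 < lam n)%R by exact: lambda_pos.
  have laminv : is_lim_seq (fun n => / lam n)%R 0%R.
    have -> : Finite 0 = Rbar_inv p_infty by [].
    by apply: is_lim_seq_inv => //; exact: (is_lim_seq_shift2' ll).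
  have Hfac s : is_lim_seq (fun n => law j n (fun k => ffact (INR k) s) / lam n ^ s)%R (rmom m1 s).
    exact: (is_lim_seq_shift2' (@fmom_scaled_lim beta beta0 Hb m1 Hm j s jp jl)).
  split.
    move=> x _; apply: is_lim_seq_shift2.
    apply: is_lim_seq_ext (@scaled_cdf (law j) (@law_lin j) (@law_pos j) (@law_one j)
      m1 Hm lam lam0 laminv Hfac x) => n.
    by rewrite C_expect_law.
  move=> s; exists (rmom m1 s); split; first exact: improper_is_RInt_gen.
  apply: is_lim_seq_shift2.
  apply: is_lim_seq_ext (@scaled_moments (law j) (@law_lin j) m1 lam lam0 laminv Hfac s) => n.
  by rewrite C_expect_law.
move=> j rho jn rho0 ll.
have Hfac s : is_lim_seq (fun n => law j n (fun k => ffact (INR k) s)) (rho ^ s * rmom m1 s)%R.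
  exact: (is_lim_seq_shift2' (@fmom_lambda_lim beta beta0 Hb m1 Hm j rho s jn rho0 ll)).
split.
  move=> x _; apply: is_lim_seq_shift2.
  apply: is_lim_seq_ext (@mixed_poisson_cdf_lim (law j) (@law_lin j) (@law_pos j)
    m1 Hm rho rho0 Hfac x) => n.
  by rewrite C_expect_law.
move=> s; exists (mixed_moment m1 rho s 0); split.
  apply: is_series_ext (@mixed_poisson_series m1 Hm rho rho0 s 0) => l.
  by rewrite /= Rmult_1_r.
apply: is_lim_seq_shift2.
apply: is_lim_seq_ext (@mixed_poisson_raw_lim (law j) (@law_lin j) m1 rho Hfac s 0) => n.
rewrite C_expect_law; apply: Ex_ext => k.
by rewrite /= Rmult_1_r.
Qed.
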